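(* Let $\mathcal H$ and $\mathcal U$ be Hilbert spaces, let $A$ be a maximal dissipative operator in $\mathcal H$, and let $B\in L(\mathcal U,\mathcal H)$. Let $\mathbf r$ be the non-negative symmetric sesquilinear form with domain $\operatorname{dom}(\mathbf r)=\operatorname{dom}A$ given by $$\mathbf r[x,y]=-\tfrac12\big(\langle Ax,y\rangle+\langle x,Ay\rangle\big),\qquad x,y\in\operatorname{dom}A.$$ Let $\mathcal R:\mathcal H\times L^2_{\rm loc}(\mathbb R_0^+,\mathcal U)\to L^2_{\rm loc}(\mathbb R_0^+,\mathcal H_A)$ be the dissipation operator associated with $(A,B)$ as defined in the context. Then the following are equivalent: (i) there exists a non-negative (possibly unbounded) self-adjoint operator $R$ in $\mathcal H$ with $\operatorname{dom}R^{1/2}\supset\operatorname{dom}A$ such that for all $x_0\in\mathcal H$ and all $u\in L^2_{\rm loc}(\mathbb R_0^+,\mathcal U)$, for a.e. $t\ge0$, one has $x_u(t;x_0)\in\operatorname{dom}R^{1/2}$ and $$\|\mathcal R(x_0,u)(t)\|_A=\|R^{1/2}x_u(t;x_0)\|;$$ (ii) the form $\mathbf r$ is closable.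
   Context: Hilbert spaces are complex, with inner product $\langle\cdot,\cdot\rangle$ linear in the first argument. $L(\mathcal U,\mathcal H)$ denotes the bounded linear operators from $\mathcal U$ to $\mathcal H$, and $\mathbb R_0^+=[0,\infty)$. A linear operator $A$ in $\mathcal H$ is maximal dissipative if it generates a $C_0$-semigroup of contractions on $\mathcal H$ (equivalently, by Lumer–Phillips, $\operatorname{Re}\langle Ax,x\rangle\le 0$ for all $x\in\operatorname{dom}A$ and $A-I$ is surjective). Let $(S(t))_{t\ge0}$ be this semigroup. For $x_0\in\mathcal H$ and $u\in L^1_{\rm loc}(\mathbb R_0^+,\mathcal U)$ the mild solution of $\dot x=Ax+Bu$, $x(0)=x_0$, is $$x_u(t;x_0)=S(t)x_0+\int_0^tS(t-s)Bu(s)\,ds,\qquad t\ge0.$$ If $x_0\in\operatorname{dom}A$ and $u$ is $C^1$, then $x_u(t;x_0)\in\operatorname{dom}A$ for all $t\geq 0$. The graph norm is $\|x\|_A=(\|x\|^2+\|Ax\|^2)^{1/2}$, and $\mathcal H_A=(\operatorname{dom}A,\|\cdot\|_A)$, a Hilbert space with inner product $\langle\cdot,\cdot\rangle_A$. Dissipation operator $\mathcal R$: Let $M$ be the bounded non-negative self-adjoint operator in $\mathcal H_A$ with $\mathbf r[x,y]=\langle Mx,y\rangle_A$ for all $x,y\in\operatorname{dom}A$. For $T>0$ let $\mathcal R_T:\mathcal H\times L^2(0,T;\mathcal U)\to L^2(0,T;\mathcal H_A)$ be the unique bounded linear operator satisfying $\mathcal R_T(x_0,u)(t)=M^{1/2}x_u(t;x_0)$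 for $t\in[0,T]$ whenever $x_0\in\operatorname{dom}A$ and $u\in C^1([0,T],\mathcal U)$ (such an operator exists, and these are compatible under restriction to smaller intervals). Then $\mathcal R(x_0,u)$ is defined by $\mathcal R(x_0,u)|_{[0,T]}=\mathcal R_T(x_0,u|_{[0,T]})$ for every $T>0$. It satisfies, with $x(t)=x_u(t;x_0)$ and $y(t)=B^*x(t)$, $$\tfrac12\|x(T)\|^2-\tfrac12\|x_0\|^2=\int_0^T\operatorname{Re}\langle u,y\rangle\,dt-\int_0^T\|\mathcal R(x_0,u)(t)\|_A^2\,dt$$ for all $x_0\in\mathcal H$, $u\in L^2_{\rm loc}(\mathbb R_0^+,\mathcal U)$, $T>0$. Closed and closable forms: write $\mathbf a[x]=\mathbf a[x,x]$. A non-negative symmetric form $\mathbf a$ on $\mathcal H$ is closed if for any sequence $(x_n)\subset\operatorname{dom}(\mathbf a)$ with $x_n\to x$ in $\mathcal H$ and $\mathbf a[x_n-x_m]\to0$ as $n,m\to\infty$ one has $x\in\operatorname{dom}(\mathbf a)$ and $\mathbf a[x_n]\to\mathbf a[x]$. It is closable if it admits a closed extension; equivalently, if $x_n\to0$ and $\mathbf a[x_n-x_m]\to0$ as $n,m\to\infty$ imply $\mathbf a[x_n]\to0$. *)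

(* Defs.v *)
From HB Require Import structures.
From mathcomp Require Import all_boot all_order all_algebra.
From mathcomp Require Import complex.
From mathcomp Require Import all_classical all_reals all_analysis.
From mathcomp Require Import ring.
Import Order.TTheory GRing.Theory Num.Theory.
Import numFieldNormedType.Exports.

Set Implicit Arguments.
Unset Strict Implicit.
Unset Printing Implicit Defensive.

Local Open Scope classical_set_scope.
Local Open Scope complex_scope.
Local Open Scope ring_scope.

HB.mixin Record NormedModule_hasInnerProduct (R : realType) H
    & NormedModule R[i] H := {
  hdot : H -> H -> R[i];
  hdot_linear : forall y, scalar (hdot^~ y);
  hdotC : forall x y, hdot x y = Num.conj (hdot y x);
  hdot_norm : forall x, hdot x x = `|x| ^+ 2
}.

#[short(type="preHilbertType")]
HB.structure Definition PreHilbert (R : realType) :=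
  {H of NormedModule_hasInnerProduct R H & NormedModule R[i] H}.

#[short(type="hilbertType")]
HB.structure Definition Hilbert (R : realType) :=
  {H of PreHilbert R H & CompleteNormedModule R[i] H}.

HB.factory Record Lmodule_hasInnerProduct (R : realType) H
    & GRing.Lmodule R[i] H := {
  ip : H -> H -> R[i];
  ip_linear : forall y, scalar (ip^~ y);
  ipC : forall x y, ip x y = Num.conj (ip y x);
  ip_ge0 : forall x, 0 <= ip x x;
  ip_eq0 : forall x, ip x x = 0 -> x = 0
}.

HB.builders Context R H & Lmodule_hasInnerProduct R H.

Let ipDl x y z : ip (x + y) z = ip x z + ip y z.
Proof. by have := ip_linear z 1 x y; rewrite scale1r mul1r. Qed.

Let ip0l z : ip 0 z = 0.
Proof. by apply: (addrI (ip 0 z)); rewrite -ipDl !addr0. Qed.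

Let ipZl a x z : ip (a *: x) z = a * ip x z.
Proof. by have := ip_linear z a x 0; rewrite addr0 ip0l addr0. Qed.

Let ipDr x y z : ip z (x + y) = ip z x + ip z y.
Proof. by rewrite ipC ipDl rmorphD/= -!ipC. Qed.

Let ipZr a x z : ip z (a *: x) = Num.conj a * ip z x.
Proof. by rewrite ipC ipZl rmorphM/= -ipC. Qed.

Let norm x : R[i] := sqrtC (ip x x).

Let norm_ge0 x : 0 <= norm x.
Proof. by rewrite sqrtC_ge0 ip_ge0. Qed.

Let cauchy_schwarz x y : `|ip x y| <= norm x * norm y.
Proof.
have [/ip_eq0 ->|y0] := eqVneq (ip y y) 0.
  by rewrite ipC ip0l rmorph0 normr0 mulr_ge0 ?norm_ge0.
have ygt0 : 0 < ip y y by rewrite lt_neqAle eq_sym y0 ip_ge0.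
rewrite -(ler_sqr (normr_nneg _)) ?nnegrE ?mulr_ge0 ?norm_ge0//.
rewrite exprMn !sqrtCK -ler_pdivrMr//.
have := ip_ge0 (x + (- (ip x y / ip y y)) *: y).
rewrite ipDl !ipDr !ipZl !ipZr [ip y x]ipC.
rewrite rmorphN rmorphM fmorphV/= -(ipC y y) normCK.
set a := ip x y; set b := Num.conj a; set c := ip y y.
suff -> : ip x x + - (b / c) * a + (- (a / c) * b + - (a / c) * (- (b / c) * c)) =
  ip x x - a * b / c by rewrite subr_ge0.
by field.
Qed.

Let le_normD x y : norm (x + y) <= norm x + norm y.
Proof.
rewrite -ler_sqr ?nnegrE ?addr_ge0 ?norm_ge0// sqrtCK sqrrD !sqrtCK.
have -> : ip (x + y) (x + y) = ip x x + (ip x y + ip y x) + ip y y.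
  by rewrite ipDl !ipDr !addrA.
rewrite lerD2r lerD2l [ip y x]ipC.
have re : ip x y + Num.conj (ip x y) \is Num.real.
  by rewrite CrealE rmorphD /= conjCK addrC.
apply: (le_trans (real_ler_norm re)); apply: (le_trans (ler_normD _ _)).
by rewrite norm_conjC -mulr2n lerMn2r cauchy_schwarz orbT.
Qed.

Let normrZ l x : norm (l *: x) = `|l| * norm x.
Proof.
by rewrite /norm ipZl ipZr mulrA -normCK rootCMl ?exprn_ge0// sqrCK.
Qed.

Let normr0_eq0 x : norm x = 0 -> x = 0.
Proof. by move=> /eqP; rewrite sqrtC_eq0 => /eqP/ip_eq0. Qed.

HB.instance Definition _ :=
  Lmodule_isNormed.Build R[i] H le_normD normrZ normr0_eq0.

Let ip_norm x : ip x x = `|x| ^+ 2.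
Proof. by rewrite sqrtCK. Qed.

HB.instance Definition _ :=
  NormedModule_hasInnerProduct.Build R H ip_linear ipC ip_norm.

HB.end.

Definition hnorm (R : realType) (H : preHilbertType R) (x : H) : R :=
  complex.Re `|x|.

(* A linear operator in [H]: the values of [app] outside [dom] are irrelevant. *)
Record operator (R : realType) (H : preHilbertType R) := Operator {
  dom : set H;
  app :> H -> H;
  dom_submod : submod_closed (fun x => x \in dom);
  app_linear : forall (a : R[i]) x y, dom x -> dom y ->
    app (a *: x + y) = a *: app x + app y
}.

(* The domain of [A] with the graph inner product, so that the norm is
   sqrt (|x|^2 + |A x|^2). It is complete when [A] is closed, but only its
   inner product and norm are used. *)
Section graph_space.
Variables (R : realType) (H : preHilbertType R) (A : operator H).

Record graph_space := GraphSpace {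
  gval :> H;
  gvalP : gval \in dom A
}.

HB.instance Definition _ := [isSub for gval].
HB.instance Definition _ := [Choice of graph_space by <:].

Let dom_pred : {pred H} := fun x => x \in dom A.
HB.instance Definition _ :=
  GRing.isSubmodClosed.Build R[i] H dom_pred (dom_submod A).
HB.instance Definition _ :=
  GRing.SubChoice_isSubLmodule.Build R[i] H dom_pred graph_space
    (dom_submod A).

Definition graph_dot (x y : graph_space) : R[i] :=
  hdot (gval x) (gval y) + hdot (A (gval x)) (A (gval y)).

Let gdot_linear y : scalar (graph_dot^~ y).
Proof.
move=> a x1 x2; rewrite /graph_dot.
have -> : gval (a *: x1 + x2) = a *: gval x1 + gval x2 by [].
have d (x : graph_space) : dom A (gval x) by exact: set_mem (gvalP x).
rewrite (app_linear a (d x1) (d x2)) !hdot_linear.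
by rewrite mulrDr addrACA.
Qed.

Let gdotC x y : graph_dot x y = Num.conj (graph_dot y x).
Proof. by rewrite /graph_dot rmorphD/= -!hdotC. Qed.

Let gdot_ge0 x : 0 <= graph_dot x x.
Proof. by rewrite /graph_dot !hdot_norm addr_ge0// exprn_ge0. Qed.

Let gdot_eq0 x : graph_dot x x = 0 -> x = 0.
Proof.
rewrite /graph_dot !hdot_norm => /eqP.
rewrite paddr_eq0 ?exprn_ge0// => /andP[+ _].
rewrite sqrf_eq0 normr_eq0 => /eqP x0; exact: val_inj.
Qed.

HB.instance Definition _ :=
  Lmodule_hasInnerProduct.Build R graph_space
    gdot_linear gdotC gdot_ge0 gdot_eq0.

End graph_space.

Section operators.
Variables (R : realType) (H : preHilbertType R).
Implicit Types (A Q : operator H) (M : {linear H -> H}).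

Definition self_adjoint A : Prop :=
  dense (dom A) /\
  forall y z, dom A y /\ A y = z <->
    forall x, dom A x -> hdot (A x) y = hdot x z.

Definition nonneg_operator A : Prop := forall x, dom A x -> 0 <= hdot (A x) x.

Definition is_sqrt A Q : Prop :=
  [/\ self_adjoint Q, nonneg_operator Q,
    forall x, dom A x <-> dom Q x /\ dom Q (Q x) &
    forall x, dom A x -> A x = Q (Q x)].

Definition bounded_nonneg_self_adjoint M : Prop :=
  [/\ continuous M, forall x y, hdot (M x) y = hdot x (M y) &
    forall x, 0 <= hdot (M x) x].

End operators.

Section forms.
Variables (R : realType) (H : preHilbertType R).

Record sform := SForm { fdom : set H; fval :> H -> H -> R[i] }.
Implicit Types a b : sform.

Definition nonneg_symmetric a : Prop :=
  [/\ submod_closed (fun x => x \in fdom a),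
    forall (c : R[i]) x y z, fdom a x -> fdom a y -> fdom a z ->
      a (c *: x + y) z = c * a x z + a y z,
    forall x y, fdom a x -> fdom a y -> a x y = Num.conj (a y x) &
    forall x, fdom a x -> 0 <= a x x].

Definition form_cauchy a (x_ : nat -> H) : Prop :=
  (a (x_ n.1 - x_ n.2) (x_ n.1 - x_ n.2) : R[i]^o) @[n --> (\oo, \oo)] --> 0.

Definition closed_form a : Prop :=
  forall (x_ : nat -> H) (x : H), (forall n, fdom a (x_ n)) ->
    x_ @ \oo --> x -> form_cauchy a x_ ->
    fdom a x /\ (a (x_ n) (x_ n) : R[i]^o) @[n --> \oo] --> (a x x : R[i]^o).

Definition closable_form a : Prop :=
  exists b, [/\ nonneg_symmetric b, closed_form b, fdom a `<=` fdom b &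
    forall x y, fdom a x -> fdom a y -> b x y = a x y].

Definition dissipation_form (A : operator H) : sform :=
  SForm (dom A) (fun x y => - 2^-1 * (hdot (A x) y + hdot x (A y))).

End forms.

Section bochner.
Variables (R : realType) (V : preHilbertType R).
Implicit Types (T : R) (f s : R -> V).
Local Notation mu := (@lebesgue_measure R).

Definition simple_function s : Prop :=
  finite_set (range s) /\ forall v, measurable (s @^-1` [set v]).

Definition simple_integral T s : V :=
  \sum_(v \in range s)
    (fine (mu (`[0, T] `&` s @^-1` [set v])))%:C *: v.

(* [f] on [0, T] is a Borel representative, so that its norm is a Borel
   function; every Bochner measurable class has one. *)
Definition strongly_measurable T f : Prop :=
  exists s_ : nat -> R -> V, (forall n, simple_function (s_ n)) /\
    forall t, t \in `[0, T] -> s_ n t @[n --> \oo] --> f t.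

Definition is_bochner_integral T f (v : V) : Prop :=
  strongly_measurable T f /\
  exists s_ : nat -> R -> V,
    [/\ forall n, simple_function (s_ n),
      (\int[mu]_(t in `[0%R, T]) (hnorm (f t - s_ n t))%:E)%E
        @[n --> \oo] --> 0%E &
      simple_integral T (s_ n) @[n --> \oo] --> v].

Definition bochner_integral T f : V := xget 0 (is_bochner_integral T f).

Definition sq_norm T f : \bar R :=
  (\int[mu]_(t in `[0%R, T]) (hnorm (f t) ^+ 2)%:E)%E.

Definition L2 T f : Prop :=
  strongly_measurable T f /\ (sq_norm T f < +oo)%E.

Definition L2loc f : Prop := forall T, 0 < T -> L2 T f.

Definition C1 T f : Prop :=
  exists f' : R -> V, {within `[0, T], continuous f'} /\
    forall t, t \in `[0, T] ->
      ((s - t)^-1)%:C *: (f s - f t) @[s --> within `[0, T] t^'] --> f' t.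

End bochner.

Section semigroups.
Variables (R : realType) (H : hilbertType R).
Implicit Types S : R -> H -> H.

Definition contraction_semigroup S : Prop :=
  [/\ forall t, 0 <= t -> linear (S t),
    forall x, S 0 x = x,
    forall s t x, 0 <= s -> 0 <= t -> S (s + t) x = S s (S t x),
    forall t x, 0 <= t -> `|S t x| <= `|x| &
    forall x, S t x @[t --> 0^'+] --> x].

Definition generates S (A : operator H) : Prop :=
  forall x y, dom A x /\ A x = y <->
    (h^-1)%:C *: (S h x - x) @[h --> 0^'+] --> y.

Definition maximal_dissipative (A : operator H) : Prop :=
  exists S, contraction_semigroup S /\ generates S A.

(* Unique on [0, +oo[ when it exists; the values at t < 0 are never used. *)
Definition semigroup_of (A : operator H) : R -> H -> H :=
  @xget (R -> H -> H) (fun=> id) [set S | contraction_semigroup S /\ generates S A].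

Definition mild_solution (U : hilbertType R) (A : operator H) (B : U -> H)
    (x0 : H) (u : R -> U) (t : R) : H :=
  semigroup_of A t x0 +
  bochner_integral t (fun s => semigroup_of A (t - s) (B (u s))).

End semigroups.

Section dissipation_operator.
Variables (R : realType) (H U : hilbertType R).
Variables (A : operator H) (B : U -> H).
Local Notation mu := (@lebesgue_measure R).
Local Notation HA := (graph_space A).

(* [RT] is given on representatives; the bound and the linearity make it
   well defined on classes. *)
Definition is_dissipation_operator_on (sqrtM : HA -> HA) (T : R)
    (RT : H -> (R -> U) -> R -> HA) : Prop :=
  [/\ forall x0 u, L2 T u -> L2 T (RT x0 u),
    forall (a : R[i]) x0 x1 u v, L2 T u -> L2 T v ->
      {ae mu, forall t, t \in `[0, T] ->
        RT (a *: x0 + x1) (fun s => a *: u s + v s) t =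
        a *: RT x0 u t + RT x1 v t},
    exists c : R, forall x0 u, L2 T u ->
      (sq_norm T (RT x0 u) <= c%:E * ((hnorm x0 ^+ 2)%:E + sq_norm T u))%E &
    forall x0 u, dom A x0 -> C1 T u ->
      {ae mu, forall t, t \in `[0, T] ->
        exists2 x : HA, gval x = mild_solution A B x0 u t &
          RT x0 u t = sqrtM x}].

Definition is_dissipation_operator (Rop : H -> (R -> U) -> R -> HA) : Prop :=
  exists M sqrtM : {linear HA -> HA},
    [/\ bounded_nonneg_self_adjoint M,
      forall x y : HA, dissipation_form A x y = hdot (M x) y,
      bounded_nonneg_self_adjoint sqrtM,
      forall x, sqrtM (sqrtM x) = M x &
      forall x0 u, L2loc u -> L2loc (Rop x0 u)] /\
    forall T, 0 < T -> exists RT, is_dissipation_operator_on sqrtM T RT /\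
      forall x0 u, L2loc u ->
        {ae mu, forall t, t \in `[0, T] -> Rop x0 u t = RT x0 u t}.

End dissipation_operator.

(* Main.v *)
Require Import Defs.
From HB Require Import structures.
From mathcomp Require Import all_boot all_order all_algebra.
From mathcomp Require Import complex.
From mathcomp Require Import all_classical all_reals all_analysis.
From mathcomp Require Import finmap measurable_realfun.
From mathcomp Require Import ring lra.
Import Order.TTheory GRing.Theory Num.Theory.
Import numFieldNormedType.Exports.

Set Implicit Arguments.
Unset Strict Implicit.
Unset Printing Implicit Defensive.

Local Open Scope classical_set_scope.
Local Open Scope ring_scope.

(* The idea. The dissipation operator is [sqrtM] applied to the mild solution
   whenever the data are smooth, and [|sqrtM x|_A ^ 2 = r[x]] on [dom A].
   If [|Rop| = |R^(1/2) x_u|] almost everywhere, take [u = 0] and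
   [x0] in [dom A]: the identity [r[S(t) x0] = |R^(1/2) S(t) x0| ^ 2] holds for
   times [t] decreasing to 0. Weak lower semicontinuity gives
   [|R^(1/2) x| ^ 2 <= r[x]]; applied to [x0 - S(t) x0] this turns weak into
   strong convergence, hence [r[x] = |R^(1/2) x| ^ 2], and [R^(1/2)] is closed.
   Conversely, a closed extension [b] of [r] is densely defined and the form
   representation theorem gives [b[x] = |R^(1/2) x| ^ 2]. Approximate [(x0, u)]
   by data in [dom A] and [C1] fast enough for the images under the dissipation
   operator to converge almost everywhere; at such a time the mild solutions
   converge in [H] and are Cauchy for [b], so closedness of [b] concludes. *)

(** * Hilbert space basics *)

(** Condition (i) holds only for almost every [t], so it says nothing at [t = 0]. The value [r[x]]
    must be reached along good times, which works because [S(t)] commutes with [A] on [dom A]: the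
    orbit of [x] then converges to [x] in the graph norm, and [r] is continuous for that norm. The
    representation theorem is proved without spectral calculus. The closed form [b] yields by
    minimisation a bounded operator [K], the future resolvent [(1 + R)^-1], with [0 <= K <= 1]. For
    [P = K^(1/2)] and [N = (1 - K)^(1/2)] one has [P^2 + N^2 = 1], and [N P^-1] is the square root
    of [R = (1 - K) K^-1]; thus only bounded operators need square roots. Estimates use the real
    inner product [rdot], and the imaginary parts are recovered by inserting a factor ['i]. Norms of
    vector-valued integrals are bounded by pairing with an arbitrary vector, which leaves Lebesgue
    integrals of real functions. *)

Section hilbert_basics.
Context {R : realType} {H : preHilbertType R}.
Implicit Types x y z : H.

Lemma hdotDl x y z : hdot (x + y) z = hdot x z + hdot y z.
Proof. by have := hdot_linear z 1 x y; rewrite scale1r mul1r. Qed.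

Lemma hdot0l z : hdot (0 : H) z = 0.
Proof. by apply: (addrI (hdot 0 z)); rewrite -hdotDl !addr0. Qed.

Lemma hdotZl (a : R[i]) x z : hdot (a *: x) z = a * hdot x z.
Proof. by have := hdot_linear z a x 0; rewrite addr0 hdot0l addr0. Qed.

Lemma hdotDr x y z : hdot z (x + y) = hdot z x + hdot z y.
Proof. by rewrite hdotC hdotDl rmorphD/= -!hdotC. Qed.

Lemma hdot0r z : hdot z (0 : H) = 0.
Proof. by rewrite hdotC hdot0l rmorph0. Qed.

Lemma hdotZr (a : R[i]) x z : hdot z (a *: x) = Num.conj a * hdot z x.
Proof. by rewrite hdotC hdotZl rmorphM/= -hdotC. Qed.

Lemma hdotNl x z : hdot (- x) z = - hdot x z.
Proof. by rewrite -scaleN1r hdotZl mulN1r. Qed.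

Lemma hdotNr x z : hdot z (- x) = - hdot z x.
Proof. by rewrite hdotC hdotNl rmorphN/= -hdotC. Qed.

Lemma hdotBl x y z : hdot (x - y) z = hdot x z - hdot y z.
Proof. by rewrite hdotDl hdotNl. Qed.

Lemma hdotBr x y z : hdot z (x - y) = hdot z x - hdot z y.
Proof. by rewrite hdotDr hdotNr. Qed.

Lemma normr_hnorm x : `|x| = (hnorm x)%:C%C.
Proof.
rewrite /hnorm; have: 0 <= `|x| :> R[i] by exact: normr_ge0.
by case: `|x| => a b; rewrite lecE/= => /andP[/eqP-> _].
Qed.

Lemma hnorm_ge0 x : 0 <= hnorm x.
Proof. by have := normr_ge0 x; rewrite normr_hnorm lecR. Qed.

Lemma hdot_hnorm x : hdot x x = (hnorm x ^+ 2)%:C%C.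
Proof. by rewrite hdot_norm normr_hnorm rmorphXn. Qed.

Lemma hnorm0 : hnorm (0 : H) = 0.
Proof. by rewrite /hnorm normr0. Qed.

Lemma hnorm0_eq0 x : hnorm x = 0 -> x = 0.
Proof. by move=> h; apply/normr0_eq0; rewrite normr_hnorm h. Qed.

Lemma hnormD x y : hnorm (x + y) <= hnorm x + hnorm y.
Proof. by have := ler_normD x y; rewrite !normr_hnorm -rmorphD lecR. Qed.

Lemma hnormN x : hnorm (- x) = hnorm x.
Proof. by rewrite /hnorm normrN. Qed.

Lemma hnormBC x y : hnorm (x - y) = hnorm (y - x).
Proof. by rewrite -hnormN opprB. Qed.

Lemma hnormB x y : hnorm (x - y) <= hnorm x + hnorm y.
Proof. by rewrite -(hnormN y) hnormD. Qed.

Lemma hnorm_triangle z x y : hnorm (x - y) <= hnorm (x - z) + hnorm (z - y).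
Proof. by rewrite (le_trans _ (hnormD _ _))// addrA subrK. Qed.

Lemma ler_hnormB x y : `|hnorm x - hnorm y| <= hnorm (x - y).
Proof.
have := hnormD (x - y) y; have := hnormD (y - x) x; rewrite !subrK hnormBC => h1 h2.
by rewrite ler_norml; apply/andP; split; lra.
Qed.

Lemma hnormZ (a : R) x : hnorm (a%:C%C *: x) = `|a| * hnorm x.
Proof.
rewrite {1}/hnorm normrZ normr_hnorm normc_def/= expr0n/= addr0 sqrtr_sqr.
by rewrite !mul0r subr0.
Qed.

(** The real inner product underlying [hdot]: minimisation and order arguments take place in [R],
    and [hdot_rdot] returns to the complex product. *)
Definition rdot x y : R := complex.Re (hdot x y).

Lemma rdotC x y : rdot x y = rdot y x.
Proof. by rewrite /rdot hdotC; case: (hdot y x). Qed.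

Lemma rdotDl x y z : rdot (x + y) z = rdot x z + rdot y z.
Proof. by rewrite /rdot hdotDl; case: (hdot x z); case: (hdot y z). Qed.

Lemma rdotNl x z : rdot (- x) z = - rdot x z.
Proof. by rewrite /rdot hdotNl; case: (hdot x z). Qed.

Lemma rdotZl (a : R) x z : rdot (a%:C%C *: x) z = a * rdot x z.
Proof. by rewrite /rdot hdotZl; case: (hdot x z) => * /=; rewrite mul0r subr0. Qed.

Lemma rdotBl x y z : rdot (x - y) z = rdot x z - rdot y z.
Proof. by rewrite rdotDl rdotNl. Qed.

Lemma rdotDr x y z : rdot z (x + y) = rdot z x + rdot z y.
Proof. by rewrite !(rdotC z) rdotDl. Qed.

Lemma rdotBr x y z : rdot z (x - y) = rdot z x - rdot z y.
Proof. by rewrite !(rdotC z) rdotBl. Qed.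

Lemma rdotZr (a : R) x z : rdot z (a%:C%C *: x) = a * rdot z x.
Proof. by rewrite !(rdotC z) rdotZl. Qed.

Lemma rdotxx x : rdot x x = hnorm x ^+ 2.
Proof. by rewrite /rdot hdot_hnorm. Qed.

(** The second argument is conjugate linear, so multiplying it by ['i] moves the imaginary part into
    the real part. Real identities valid for all vectors thereby lift to [hdot]. *)
Lemma hdot_rdot x y : hdot x y = (rdot x y +i* rdot x ('i%C *: y))%C.
Proof.
rewrite /rdot hdotZr; case: (hdot x y) => a b /=.
by rewrite mul0r sub0r mulN1r opprK.
Qed.

Lemma hnormDsq x y : hnorm (x + y) ^+ 2 = hnorm x ^+ 2 + 2 * rdot x y + hnorm y ^+ 2.
Proof. by rewrite -!rdotxx rdotDl !rdotDr (rdotC y x); ring. Qed.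

Lemma hnormBsq x y : hnorm (x - y) ^+ 2 = hnorm x ^+ 2 - 2 * rdot x y + hnorm y ^+ 2.
Proof. by rewrite -!rdotxx rdotBl !rdotBr (rdotC y x); ring. Qed.

Lemma rdot_le x y : rdot x y <= hnorm x * hnorm y.
Proof.
have [y0|y0] := eqVneq (hnorm y) 0.
  by rewrite (hnorm0_eq0 y0) /rdot hdot0r hnorm0 mulr0.
have y_gt0 : 0 < hnorm y by rewrite lt_neqAle eq_sym y0 hnorm_ge0.
have [x0|x0] := eqVneq (hnorm x) 0.
  by rewrite (hnorm0_eq0 x0) /rdot hdot0l hnorm0 mul0r.
have x_gt0 : 0 < hnorm x by rewrite lt_neqAle eq_sym x0 hnorm_ge0.
(* This square expands to [2 |x| |y| (|x| |y| - rdot x y)]. *)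
have := sqr_ge0 (hnorm ((hnorm y)%:C%C *: x - (hnorm x)%:C%C *: y)).
rewrite hnormBsq !hnormZ rdotZl rdotZr !ger0_norm ?hnorm_ge0// => h.
rewrite -(ler_pM2l (mulr_gt0 y_gt0 x_gt0)); lra.
Qed.

Lemma normr_rdot_le x y : `|rdot x y| <= hnorm x * hnorm y.
Proof.
by rewrite ler_norml -(hnormN x) lerNl -rdotNl rdot_le hnormN rdot_le.
Qed.

Lemma rdot_eq x y : (forall z, rdot x z = rdot y z) -> x = y.
Proof.
move=> xy; apply/eqP; rewrite -subr_eq0; apply/eqP/hnorm0_eq0/eqP.
by rewrite -sqrf_eq0 -rdotxx rdotBl xy subrr.
Qed.

Lemma hdot_eq x y : (forall z, hdot x z = hdot y z) -> x = y.
Proof. by move=> xy; apply: rdot_eq => z; rewrite /rdot xy. Qed.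

(** Take [z = x]. Norms of vector-valued integrals are bounded through this duality. *)
Lemma hnorm_le_dual (C : R) x : 0 <= C ->
  (forall z, rdot x z <= C * hnorm z) -> hnorm x <= C.
Proof.
move=> C0 /(_ x); rewrite rdotxx expr2.
have [->//|x0] := eqVneq (hnorm x) 0.
by rewrite ler_pM2r// lt_neqAle eq_sym x0 hnorm_ge0.
Qed.

Lemma cvg_hnormP {T : Type} (F : set_system T) {FF : Filter F} (f : T -> H) (l : H) :
  f @ F --> l <-> forall e : R, 0 < e -> \forall t \near F, hnorm (f t - l) < e.
Proof.
split=> [/cvgrPdist_lt h e e0|h].
  have /h : 0 < e%:C%C by rewrite ltcR.
  by apply: filterS => t; rewrite normr_hnorm ltcR hnormBC.
(* Radii live in [R[i]]; a positive one has zero imaginary part and is therefore a real number. *)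
apply/cvgrPdist_lt => -[e e']; rewrite ltcE/= => /andP[/eqP-> e0].
by apply: filterS (h e e0) => t; rewrite normr_hnorm ltcR hnormBC.
Qed.

Lemma cvg_hnorm0P {T : Type} (F : set_system T) {FF : Filter F} (f : T -> H) (l : H) :
  f @ F --> l <-> hnorm (f t - l) @[t --> F] --> (0 : R).
Proof.
split=> [/cvg_hnormP h|/cvgrPdist_lt h].
  apply/cvgrPdist_lt => e /h; apply: filterS => t.
  by rewrite sub0r normrN ger0_norm ?hnorm_ge0.
apply/cvg_hnormP => e /h; apply: filterS => t.
by rewrite sub0r normrN ger0_norm ?hnorm_ge0.
Qed.

Lemma cvg_hnorm {T : Type} (F : set_system T) {FF : Filter F} (f : T -> H) (l : H) :
  f @ F --> l -> hnorm (f t) @[t --> F] --> hnorm l.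
Proof.
move=> /cvg_hnormP h; apply/cvgrPdist_lt => e /h; apply: filterS => t.
by apply: le_lt_trans; rewrite hnormBC ler_hnormB.
Qed.

Lemma cvg_rdot {T : Type} (F : set_system T) {FF : Filter F} (f : T -> H) (l : H) z :
  f @ F --> l -> rdot (f t) z @[t --> F] --> rdot l z.
Proof.
move=> /cvg_hnormP h; apply/cvgrPdist_lt => e e0.
have z0 : 0 < hnorm z + 1 by rewrite ltr_wpDl ?hnorm_ge0.
have := h _ (divr_gt0 e0 z0); apply: filterS => t.
rewrite ltr_pdivlMr// -rdotBl; apply: le_lt_trans.
apply: le_trans (normr_rdot_le _ _) _.
by rewrite hnormBC ler_wpM2l ?hnorm_ge0// lerDl.
Qed.

Lemma dense_hnormP (D : set H) :
  dense D <-> forall x (e : R), 0 < e -> exists2 y, D y & hnorm (x - y) < e.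
Proof.
split=> [dD x e e0|h].
  have [|//|y [xy Dy]] := dD (ball x e%:C%C).
  - by exists x; apply: ballxx; rewrite ltcR.
  - exact: ball_open.
  by exists y => //; move: xy; rewrite -ball_normE/= normr_hnorm ltcR.
move=> O [x Ox]; rewrite openE => /(_ x Ox)/nbhs_ballP[] /= -[e e']/=.
rewrite ltcE/= => /andP[/eqP-> e0] eO; have [y Dy xy] := h x e e0.
exists y; split=> //; apply: eO.
by rewrite -ball_normE/= normr_hnorm ltcR.
Qed.

End hilbert_basics.

Lemma hnorm_cauchy_cvg {R : realType} {H : hilbertType R} (u : nat -> H) :
  (forall e : R, 0 < e -> exists N, forall n m, (N <= n)%N -> (N <= m)%N ->
    hnorm (u n - u m) < e) ->
  exists l : H, u @ \oo --> l.
Proof.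
move=> h; apply/cvg_ex/cauchy_cvgP.
apply/cauchyP => -[e e']/=; rewrite ltcE/= => /andP[/eqP-> e0].
have [N hN] := h e e0; exists (u N); exists N => // n /= Nn.
by rewrite -ball_normE/= normr_hnorm ltcR hN.
Qed.

Lemma conj_realC {R : realType} (a : R) : Num.conj (a%:C%C : R[i]) = a%:C%C.
Proof. by apply: conj_Creal; rewrite complex_real. Qed.

Arguments cvg_rdot {R H T F FF f l} z _.

Lemma cvgR_unique {R : realType} {T : Type} {F : set_system T} {FF : ProperFilter F}
    (f : T -> R) (a b : R) : f @ F --> a -> f @ F --> b -> a = b.
Proof. by move=> /(cvg_lim (@Rhausdorff R)) <- /(cvg_lim (@Rhausdorff R)) <-. Qed.

Lemma cvgH_unique {R : realType} {H : preHilbertType R} {T : Type} {F : set_system T}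
    {FF : ProperFilter F} (f : T -> H) (a b : H) : f @ F --> a -> f @ F --> b -> a = b.
Proof. by move=> /(cvg_lim (@norm_hausdorff _ _)) <- /(cvg_lim (@norm_hausdorff _ _)) <-. Qed.
Arguments cvgR_unique {R T F FF f a b} _ _.
Arguments cvgH_unique {R H T F FF f a b} _ _.

(** * Square roots of bounded operators *)

Lemma quadratic_discriminant {R : realFieldType} (a c d : R) : 0 <= d ->
  (forall t, 0 <= a + 2 * t * c + t ^+ 2 * d) -> c ^+ 2 <= a * d.
Proof.
move=> d0 h; have [d_eq0|d_neq0] := eqVneq d 0.
  have [->|c0] := eqVneq c 0; first by rewrite d_eq0 mulr0 expr0n.
  (* With [d = 0] the quadratic is affine in [t], and this [t] would give it the value -1. *)
  have := h (- ((a + 1) / (2 * c))); rewrite d_eq0 mulr0 addr0.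
  have -> : a + 2 * - ((a + 1) / (2 * c)) * c = -1 by field.
  by rewrite oppr_ge0 ler10.
have d1 : 0 < d by rewrite lt_neqAle eq_sym d_neq0.
have := h (- (c / d)); rewrite -(pmulr_lge0 _ d1).
have -> : (a + 2 * (- (c / d)) * c + (- (c / d)) ^+ 2 * d) * d
  = a * d - c ^+ 2 by field.
by rewrite subr_ge0.
Qed.

(* A minimising sequence of [q w w - 2 * l w]; no completeness is needed, so
   the limit can be taken afterwards in whichever norm is complete. *)
Lemma approx_riesz {R : realType} {V : lmodType R[i]} (W : set V)
    (q : V -> V -> R) (l : V -> R) (C : R) :
  W 0 -> (forall x y, W x -> W y -> W (x + y)) ->
  (forall (a : R) x, W x -> W (a%:C%C *: x)) ->
  (forall x y z, W x -> W y -> W z -> q (x + y) z = q x z + q y z) ->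
  (forall a x z, W x -> W z -> q (a%:C%C *: x) z = a * q x z) ->
  (forall x y, W x -> W y -> q x y = q y x) ->
  (forall x, W x -> 0 <= q x x) ->
  (forall x y, W x -> W y -> l (x + y) = l x + l y) ->
  (forall a x, W x -> l (a%:C%C *: x) = a * l x) ->
  (forall w, W w -> 2 * l w <= q w w + C) ->
  exists w_ : nat -> V, [/\ forall n, W (w_ n),
    forall n m, q (w_ n - w_ m) (w_ n - w_ m) <= 2 * (n.+1%:R^-1 + m.+1%:R^-1) &
    forall n w, W w -> (q (w_ n) w - l w) ^+ 2 <= q w w * n.+1%:R^-1].
Proof.
move=> W0 WD WZ qD qZ qC q0 lD lZ lC.
have WN x : W x -> W (- x).
  by move=> /(WZ (-1)); rewrite rmorphN1 scaleN1r.
pose J w := q w w - 2 * l w.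
have Jinf : has_inf (J @` W).
  split; first by exists (J 0), 0.
  by exists (- C) => _ [w Ww <-]; rewrite /J; have := lC w Ww; lra.
pose m := inf (J @` W).
have Jm w : W w -> m <= J w.
  by move=> Ww; apply: ge_inf; [case: Jinf|exists w].
have /choice[w_ hw] n : exists w, W w /\ J w <= m + n.+1%:R^-1.
  have [|_ [w Ww <-] Jw] := inf_adherent (eps := n.+1%:R^-1) _ Jinf.
    by rewrite invr_gt0 ltr0n.
  by exists w; split=> //; exact: ltW.
have Ww n : W (w_ n) by case: (hw n).
have Jw n : J (w_ n) <= m + n.+1%:R^-1 by case: (hw n).
exists w_; split=> //.
  move=> n k.
  set x := w_ n; set y := w_ k.
  have hx : W x by exact: Ww.
  have hy : W y by exact: Ww.
  have qDr a b c : W a -> W b -> W c -> q c (a + b) = q c a + q c b.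
    by move=> *; rewrite qC ?qD ?(qC c)//; exact: WD.
  have qNl a c : W a -> W c -> q (- a) c = - q a c.
    by move=> *; rewrite -scaleN1r -(rmorphN1 (real_complex R)) qZ// mulN1r.
  have qNr a c : W a -> W c -> q c (- a) = - q c a.
    by move=> *; rewrite qC ?qNl ?(qC c)//; exact: WN.
  have hs : W (x + y) by exact: WD.
  (* Parallelogram identity: [J x + J y - 2 J ((x + y) / 2)] is half of [q (x - y) (x - y)], and the
     midpoint cannot go below [m]. *)
  have := Jm _ (WZ 2^-1 _ hs).
  rewrite /J qZ ?(qC (x + y)) ?qZ ?lZ//; try exact: WZ.
  have hN : W (- y) by exact: WN.
  have hB : W (x - y) by exact: WD.
  rewrite qD// !qDr// lD//.
  have := Jw n; have := Jw k; rewrite -/x -/y /J.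
  rewrite ?qD// ?qDr// ?qNl ?qNr// ?qNl// !(qC y x)//.
  move: n.+1%:R^-1 k.+1%:R^-1 => e1 e2; lra.
move=> n w hw'.
set x := w_ n; have hx : W x by exact: Ww.
set c := q x w - l w; set e := n.+1%:R^-1.
(* Moving a near-minimiser by [t w] gains at most [e]; the discriminant of this quadratic in [t]
   bounds the defect [c] in the Euler equation. *)
have hwx (t : R) : 0 <= e + 2 * t * c + t ^+ 2 * q w w.
  have ht := WZ t _ hw'.
  have hs : W (x + t%:C%C *: w) by exact: WD.
  have := Jm _ hs; have := Jw n; rewrite -/x -/e /J.
  rewrite qD// !(qC _ (x + _))// !qD// !qZ// ?(qC _ (t%:C%C *: w))// ?qZ// lD// lZ//.
  by rewrite (qC w x)// /c; lra.
by rewrite mulrC; apply: quadratic_discriminant => //; exact: q0.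
Qed.

Section operator_sqrt.
Context {R : realType} {H : hilbertType R}.
Implicit Types (K P : H -> H) (x y : H).

Definition hsymmetric K := forall x y, hdot (K x) y = hdot x (K y).

Lemma hsymmetric_linear K : hsymmetric K -> linear K.
Proof.
move=> Ks a x y; apply: hdot_eq => z.
by rewrite hdotDl hdotZl !Ks hdotDl hdotZl.
Qed.

(* [P = 1 - Y], where [Y] is the increasing limit of
   [Y_{n+1} = (1 - K + Y_n ^ 2) / 2]; the increments are dominated by those of
   the scalar iteration [a_{n+1} = (1 + a_n ^ 2) / 2], which stays below 1. *)
Lemma exists_operator_sqrt K : hsymmetric K ->
  (forall x, hnorm (x - K x) <= hnorm x) ->
  exists P, [/\ hsymmetric P, forall x, hnorm (x - P x) <= hnorm x,
    forall x, P (P x) = K x &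
    forall L : H -> H, linear L ->
      (exists C : R, forall x, hnorm (L x) <= C * hnorm x) ->
      (forall x, L (K x) = K (L x)) -> forall x, L (P x) = P (L x)].
Proof.
move=> Ks K1.
(* For symmetric [K] the bound on [1 - K] amounts to [0 <= K <= 2]. The root [P] satisfies the same
   bound, so the construction can be iterated. *)
pose Z x := x - K x.
pose Y := fix Y n x : H := if n is n'.+1 then (2^-1)%:C%C *: (Z x + Y n' (Y n' x)) else 0.
pose a := fix a n : R := if n is n'.+1 then 2^-1 * (1 + a n' ^+ 2) else 0.
have YS n x : Y n.+1 x = (2^-1)%:C%C *: (Z x + Y n (Y n x)) by [].
have aS n : a n.+1 = 2^-1 * (1 + a n ^+ 2) by [].
have a01 n : 0 <= a n <= 1.
  elim: n => [|n /andP[a0 a1]]; first by rewrite /a lexx ler01.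
  by rewrite aS; apply/andP; split; nra.
have aincr n : a n <= a n.+1.
  elim: n => [|n IH]; first by rewrite aS /=; lra.
  have /andP[? ?] := a01 n; have /andP[? ?] := a01 n.+1.
  by rewrite (aS n.+1) [leLHS]aS; nra.
have Zs : hsymmetric Z by move=> x y; rewrite /Z hdotBl hdotBr Ks.
have Ys n : hsymmetric (Y n).
  elim: n => [|n IH] x y; first by rewrite /= hdot0l hdot0r.
  by rewrite !YS hdotZl hdotZr hdotDl hdotDr !IH Zs; rewrite conj_realC.
have Yl n := hsymmetric_linear (Ys n).
(* Each [Y n] is a polynomial in [K]. *)
have Ycomm (L : H -> H) n : linear L -> (forall x, L (K x) = K (L x)) ->
    forall x, L (Y n x) = Y n (L x).
  move=> Ll LK.
  have LD x y : L (x + y) = L x + L y by have := Ll 1 x y; rewrite !scale1r.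
  have L0 : L 0 = 0 by apply: (addrI (L 0)); rewrite -LD !addr0.
  have LZ b x : L (b *: x) = b *: L x by have := Ll b x 0; rewrite addr0 L0 addr0.
  have LN x : L (- x) = - L x by rewrite -scaleN1r LZ scaleN1r.
  elim: n => [|n IH] x //=.
  by rewrite LZ LD LD LN LK -!IH.
have YD n x y : Y n (x + y) = Y n x + Y n y by have := Yl n 1 x y; rewrite !scale1r.
have YN n x : Y n (- x) = - Y n x.
  by apply/hdot_eq => z; rewrite hdotNl !Ys hdotNl.
have YZ n b x : Y n (b *: x) = b *: Y n x.
  by apply/hdot_eq => z; rewrite hdotZl !Ys hdotZl.
have Ynorm n x : hnorm (Y n x) <= a n * hnorm x.
  elim: n x => [|n IH] x; first by rewrite /= hnorm0 mul0r.
  rewrite YS hnormZ aS ger0_norm// -mulrA ler_pM2l//.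
  apply: le_trans (hnormD _ _) _.
  have := K1 x; have := IH x; have := IH (Y n x); rewrite -/(Z x).
  by have /andP[? ?] := a01 n; have := hnorm_ge0 (Y n x); nra.
have YK n x : Y n (K x) = K (Y n x).
  by rewrite (Ycomm K)//; exact: hsymmetric_linear.
have YY n k x : Y n (Y k x) = Y k (Y n x) by exact: Ycomm.
have dY n x : hnorm (Y n.+1 x - Y n x) <= (a n.+1 - a n) * hnorm x.
  elim: n x => [|n IH] x.
    rewrite /= !addr0 expr0n/= addr0 subr0 subr0 mulr1.
    by rewrite hnormZ ger0_norm// ler_pM2l// K1.
  (* The iterates commute, so the difference of their squares factors as
     [(Y_{n+1} - Y_n)(Y_{n+1} + Y_n)], to which the previous increment bound applies. *)
  have -> : Y n.+2 x - Y n.+1 x =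
      (2^-1)%:C%C *: (Y n.+1 (Y n.+1 x + Y n x) - Y n (Y n.+1 x + Y n x)).
    rewrite [in LHS]YS [Y n.+1 x in X in _ - X]YS -scalerBr; congr (_ *: _).
    rewrite !YD opprD addrACA subrr add0r (YY n n.+1) opprD addrA.
    by rewrite [X in _ = X - _]addrK.
  rewrite hnormZ ger0_norm//.
  have := IH (Y n.+1 x + Y n x).
  have := hnormD (Y n.+1 x) (Y n x); have := Ynorm n x; have := Ynorm n.+1 x.
  have := aincr n; have := hnorm_ge0 (Y n.+1 x + Y n x); have := hnorm_ge0 x.
  have := aS n; have := aS n.+1.
  set p := hnorm _; set q := hnorm (Y n.+1 x + Y n x); set r := hnorm (Y n.+1 x).
  set s := hnorm (Y n x); set t := hnorm (_ - _).
  move: (a n.+2) (a n.+1) (a n) => d b c -> hb *.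
  have : (b - c) * q <= (b - c) * ((b + c) * p) by rewrite ler_wpM2l; lra.
  rewrite {3}hb; nra.
have amono n k : (n <= k)%N -> a n <= a k.
  by move/(@nondecreasing_seqP _ _ a).1; apply.
have dYm n k x : (n <= k)%N -> hnorm (Y k x - Y n x) <= (a k - a n) * hnorm x.
  elim: k => [|k IH]; first by rewrite leqn0 => /eqP->; rewrite !subrr hnorm0 mul0r.
  rewrite leq_eqVlt => /predU1P[->|]; first by rewrite !subrr hnorm0 mul0r.
  rewrite ltnS => /IH h; apply: le_trans (hnorm_triangle (Y k x) _ _) _.
  by have := dY k x; lra.
have acvg : cvgn a.
  apply: nondecreasing_is_cvgn; first by apply/nondecreasing_seqP.
  by exists 1 => _ [n _ <-]; case/andP: (a01 n).
have acauchy (e : R) : 0 < e -> exists N, forall n k, (N <= n)%N -> (N <= k)%N -> `|a n - a k| < e.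
  move=> e0; have /cvgrPdist_lt/(_ (e / 2)) := acvg.
  rewrite divr_gt0// => /(_ isT)[N _ hN]; exists N => n k Nn Nk.
  have := hN _ Nn; have := hN _ Nk => /=; rewrite !ltr_norml => /andP[? ?] /andP[? ?].
  by apply/andP; split; lra.
have Yd n k x : hnorm (Y n x - Y k x) <= `|a n - a k| * hnorm x.
  have [nk|/ltnW kn] := leqP n k.
    by rewrite hnormBC distrC ger0_norm ?subr_ge0 ?amono// dYm.
  by rewrite ger0_norm ?subr_ge0 ?amono// dYm.
have /choice[Yo hYo] x : exists l : H, Y n x @[n --> \oo] --> l.
  apply: hnorm_cauchy_cvg => e e0.
  have x0 : 0 < hnorm x + 1 by rewrite ltr_wpDl ?hnorm_ge0.
  have [N hN] := acauchy _ (divr_gt0 e0 x0); exists N => n k Nn Nk.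
  apply: le_lt_trans (Yd _ _ _) _.
  have := hN n k Nn Nk; rewrite ltr_pdivlMr//; apply: le_lt_trans.
  by rewrite ler_wpM2l// lerDl.
have Yos : hsymmetric Yo.
  move=> x y.
  have Yor z w : rdot (Yo z) w = rdot z (Yo w).
    rewrite (rdotC z); apply: cvgR_unique (cvg_rdot w (hYo z)) _.
    rewrite (_ : (fun n => _) = fun n => rdot (Y n w) z); first exact: cvg_rdot.
    by apply/funext => n; rewrite rdotC /rdot Ys.
  have Yoi z : Yo ('i%C *: z) = 'i%C *: Yo z.
    apply: cvgH_unique (hYo _) _.
    rewrite (_ : (fun n => _) = fun n => 'i%C *: Y n z).
      by apply: cvgZr; exact: hYo.
    by apply/funext => n; rewrite YZ.
  by rewrite !hdot_rdot -Yoi !Yor.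
have Yon x : hnorm (Yo x) <= hnorm x.
  apply/ler_addgt0Pr => e e0; have /cvg_hnormP/(_ e e0)[n _ /(_ n (leqnn n)) h] := hYo x.
  have := hnorm_triangle (Y n x) (Yo x) 0; rewrite !subr0 hnormBC.
  by have := Ynorm n x; have := a01 n; have := hnorm_ge0 x; move: h => /=; nra.
have YoD x y : Yo (x + y) = Yo x + Yo y.
  by have := hsymmetric_linear Yos 1 x y; rewrite !scale1r.
have YoN x : Yo (- x) = - Yo x.
  by apply/hdot_eq => z; rewrite hdotNl !Yos hdotNl.
(* For [P = 1 - Yo] this fixed point equation reads [P^2 = 1 - 2 Yo + Yo^2 = 1 - Z = K]. *)
have YoE x : Yo x = (2^-1)%:C%C *: (Z x + Yo (Yo x)).
  apply: cvgH_unique (hYo x) _; apply/cvg_hnormP => e e0.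
  have e4 : 0 < e / 2 by rewrite divr_gt0.
  have /cvg_hnormP/(_ _ e4)[N1 _ h1] := hYo x.
  have /cvg_hnormP/(_ _ e4)[N2 _ h2] := hYo (Yo x).
  exists (maxn N1 N2).+1 => // -[//|n] hn.
  have /andP[n1 n2] : (N1 <= n)%N && (N2 <= n)%N by rewrite -geq_max.
  rewrite YS -scalerBr hnormZ ger0_norm// addrAC opprD addrA subrr sub0r addrC.
  have := h1 n n1; have := h2 n n2 => /=.
  have := hnorm_triangle (Y n (Yo x)) (Y n (Y n x)) (Yo (Yo x)).
  rewrite -YN -YD.
  have := Ynorm n (Y n x - Yo x); have := a01 n; have := hnorm_ge0 (Y n x - Yo x).
  nra.
exists (fun x => x - Yo x); split.
- by move=> x y; rewrite hdotBl hdotBr Yos.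
- by move=> x; rewrite opprB addrC subrK.
- move=> x; rewrite YoD YoN.
  have -> : Yo (Yo x) = (2 : R)%:C%C *: Yo x - Z x.
    by rewrite [X in _ *: X]YoE scalerA -rmorphM mulfV ?pnatr_eq0// scale1r addrC addKr.
  rewrite (_ : (2 : R)%:C%C *: Yo x = Yo x + Yo x); last first.
    by rewrite -[2]/(1 + 1) rmorphD scalerDl scale1r.
  rewrite [X in _ - X](_ : _ = Z x - Yo x).
    by rewrite [Z x - _]addrC addrKA opprB addrC subrK.
  by rewrite opprB addrC opprD addrA subrK.
move=> L Ll [C LC] LK x.
have LD u v : L (u + v) = L u + L v by have := Ll 1 u v; rewrite !scale1r.
have L0 : L 0 = 0 by apply: (addrI (L 0)); rewrite -LD !addr0.
have LN u : L (- u) = - L u by have := Ll (-1) u 0; rewrite !scaleN1r !addr0 L0 addr0.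
rewrite LD LN; congr (_ - _).
apply: cvgH_unique _ (hYo (L x)).
rewrite (_ : (fun n => _) = fun n => L (Y n x)); last first.
  by apply/funext => n; rewrite Ycomm.
apply/cvg_hnormP => e e0.
have C0 : 0 < `|C| + 1 by rewrite ltr_wpDl.
have /cvg_hnormP/(_ _ (divr_gt0 e0 C0)) := hYo x; apply: filterS => n.
rewrite ltr_pdivlMr// -LN -LD; apply: le_lt_trans; apply: le_trans (LC _) _.
rewrite mulrC ler_wpM2l ?hnorm_ge0// (le_trans (ler_norm _))// lerDl//.
Qed.
End operator_sqrt.

(** * Closed forms *)

Section closed_forms.
Context {R : realType} {H : hilbertType R}.
Implicit Types (b : sform H) (x y z : H).

Definition rform b x y : R := complex.Re (b x y).

Section nonneg_form.
Variable b : sform H.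
Hypothesis b_nonneg : nonneg_symmetric b.

Lemma fdom0 : fdom b 0.
Proof. by case: b_nonneg => -[/set_mem]. Qed.

Lemma fdom_lin (a : R[i]) x y : fdom b x -> fdom b y -> fdom b (a *: x + y).
Proof.
by case: b_nonneg => -[_ h] _ _ _ /mem_set hx /mem_set hy; exact/set_mem/h.
Qed.

Lemma fdomZ (a : R[i]) x : fdom b x -> fdom b (a *: x).
Proof. by move=> bx; rewrite -[_ *: _]addr0; apply: fdom_lin => //; exact: fdom0. Qed.

Lemma fdomD x y : fdom b x -> fdom b y -> fdom b (x + y).
Proof. by move=> bx bY; rewrite -[x]scale1r; exact: fdom_lin. Qed.

Lemma fdomN x : fdom b x -> fdom b (- x).
Proof. by move=> bx; rewrite -scaleN1r; exact: fdomZ. Qed.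

Lemma fdomB x y : fdom b x -> fdom b y -> fdom b (x - y).
Proof. by move=> bx bY; apply: fdomD => //; exact: fdomN. Qed.

Lemma fvalDl x y z : fdom b x -> fdom b y -> fdom b z -> b (x + y) z = b x z + b y z.
Proof.
by case: b_nonneg => _ h _ _ bx bY bz; have := h 1 x y z bx bY bz; rewrite scale1r mul1r.
Qed.

Lemma fval0l z : fdom b z -> b 0 z = 0.
Proof.
by move=> bz; apply: (addrI (b 0 z)); rewrite -fvalDl ?addr0//; exact: fdom0.
Qed.

Lemma fvalZl (a : R[i]) x z : fdom b x -> fdom b z -> b (a *: x) z = a * b x z.
Proof.
case: b_nonneg => _ h _ _ bx bz; have := h a x 0 z bx fdom0 bz.
by rewrite addr0 fval0l// addr0.
Qed.

Lemma fvalC x y : fdom b x -> fdom b y -> b x y = Num.conj (b y x).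
Proof. by case: b_nonneg => _ _ h _; exact: h. Qed.

Lemma rformDl x y z : fdom b x -> fdom b y -> fdom b z ->
  rform b (x + y) z = rform b x z + rform b y z.
Proof. by move=> *; rewrite /rform fvalDl//; case: (b x z); case: (b y z). Qed.

Lemma rformZl (a : R) x z : fdom b x -> fdom b z ->
  rform b (a%:C%C *: x) z = a * rform b x z.
Proof.
by move=> *; rewrite /rform fvalZl//; case: (b x z) => * /=; rewrite mul0r subr0.
Qed.

Lemma rformC x y : fdom b x -> fdom b y -> rform b x y = rform b y x.
Proof. by move=> *; rewrite /rform fvalC//; case: (b y x). Qed.

Lemma fval_rform x : fdom b x -> b x x = (rform b x x)%:C%C.
Proof.
case: b_nonneg => _ _ _ h /h; rewrite /rform; case: (b x x) => u v.
by rewrite lecE/= => /andP[/eqP->].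
Qed.

Lemma rform_ge0 x : fdom b x -> 0 <= rform b x x.
Proof. by move=> bx; case: b_nonneg => _ _ _ /(_ _ bx); rewrite fval_rform// lecR. Qed.

Lemma rformNl x z : fdom b x -> fdom b z -> rform b (- x) z = - rform b x z.
Proof.
by move=> *; rewrite -scaleN1r -(rmorphN1 (real_complex R)) rformZl// mulN1r.
Qed.

Lemma rformBl x y z : fdom b x -> fdom b y -> fdom b z ->
  rform b (x - y) z = rform b x z - rform b y z.
Proof. by move=> *; rewrite rformDl ?rformNl//; exact: fdomN. Qed.

Lemma rform_cauchy_schwarz x y : fdom b x -> fdom b y ->
  rform b x y ^+ 2 <= rform b x x * rform b y y.
Proof.
move=> bx bY; apply: quadratic_discriminant; first exact: rform_ge0.
move=> t; have bty := fdomZ t%:C%C bY; have := rform_ge0 (fdomD bx bty).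
rewrite rformDl//; try exact: fdomD.
rewrite !(rformC _ (fdomD bx bty))// !rformDl// ?rformZl//.
by rewrite !(rformC _ bty)// rformZl// ?rformZl// (rformC bY bx); lra.
Qed.

Lemma fval_rformi x y : fdom b x -> fdom b y ->
  b x y = (rform b x y +i* rform b x ('i%C *: y))%C.
Proof.
move=> bx bY; rewrite (rformC bx (fdomZ _ bY)) /rform fvalZl//.
rewrite (fvalC bY bx); case: (b x y) => u v /=.
by rewrite mul0r sub0r mul1r opprK.
Qed.

End nonneg_form.

(** [closed_form] provides only the limit of the values [b[x_n]]. Applied once more, to
    [m |-> x_n - x_m] with [n] fixed, it yields convergence in the form norm as well. *)
Lemma closed_form_cvg b (x_ : nat -> H) x : nonneg_symmetric b -> closed_form b ->
  (forall n, fdom b (x_ n)) -> x_ @ \oo --> x ->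
  (forall e : R, 0 < e -> exists N, forall n m, (N <= n)%N -> (N <= m)%N ->
    rform b (x_ n - x_ m) (x_ n - x_ m) < e) ->
  [/\ fdom b x, rform b (x_ n) (x_ n) @[n --> \oo] --> rform b x x &
      forall e : R, 0 < e -> exists N, forall n, (N <= n)%N ->
        rform b (x_ n - x) (x_ n - x) < e].
Proof.
move=> bn bc.
have key (y_ : nat -> H) y : (forall n, fdom b (y_ n)) -> y_ @ \oo --> y ->
  (forall e : R, 0 < e -> exists N, forall n m, (N <= n)%N -> (N <= m)%N ->
    rform b (y_ n - y_ m) (y_ n - y_ m) < e) ->
  fdom b y /\ rform b (y_ n) (y_ n) @[n --> \oo] --> rform b y y.
  move=> by_ yy h; have [|bY hb] := bc y_ y by_ yy.
    apply/cvgrPdist_lt => -[e e']; rewrite ltcE/= => /andP[/eqP-> e0].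
    have [N hN] := h e e0; exists ([set n | (N <= n)%N], [set n | (N <= n)%N]).
      by split; exists N.
    move=> [n m]/= [Nn Nm]; rewrite sub0r normrN.
    have byy := fdomB bn (by_ n) (by_ m).
    rewrite (fval_rform bn byy) normc_def/= expr0n/= addr0 sqrtr_sqr ltcR.
    by rewrite ger0_norm ?(rform_ge0 bn)//; exact: hN.
  split=> //; apply/cvgrPdist_lt => e e0.
  have /cvgrPdist_lt/(_ e%:C%C) := hb; rewrite ltcR => /(_ e0).
  apply: filterS => n; rewrite !(fval_rform bn)// -rmorphB normc_def/=.
  by rewrite expr0n/= addr0 sqrtr_sqr ltcR.
move=> bx xx h; have [hbx hbb] := key x_ x bx xx h; split=> // e e0.
have e2 : 0 < e / 2 by rewrite divr_gt0.
have [N hN] := h _ e2; exists N => n Nn.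
have [||m|] := key (fun m => x_ n - x_ m) (x_ n - x).
- by move=> m; exact: fdomB.
- by apply: cvgB => //; exact: cvg_cst.
- move=> m0; have [M hM] := h m m0; exists M => k l Mk Ml.
  have -> : x_ n - x_ k - (x_ n - x_ l) = x_ l - x_ k.
    by rewrite opprB addrC addrA subrK.
  exact: hM.
move=> _ hc; apply: (@le_lt_trans _ _ (e / 2)); last by lra.
rewrite -(cvg_lim (@Rhausdorff R) hc); apply: limr_le.
  by apply/cvg_ex; eexists; exact: hc.
by exists N => // k Nk; apply/ltW/hN.
Qed.

(** The near-minimisers of [approx_riesz] are Cauchy both in norm and for [b], so completeness of
    [H] and closedness of [b] supply a limit, which may lie outside [W]. With [W] the whole domain
    this constructs resolvents; with a smaller real subspace it shows how far [W] is dense. *)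
Lemma form_riesz b (W : set H) (l : H -> R) (C : R) :
  nonneg_symmetric b -> closed_form b -> W `<=` fdom b ->
  W 0 -> (forall x y, W x -> W y -> W (x + y)) ->
  (forall (a : R) x, W x -> W (a%:C%C *: x)) ->
  (forall x y, W x -> W y -> l (x + y) = l x + l y) ->
  (forall a x, W x -> l (a%:C%C *: x) = a * l x) ->
  (forall w, W w -> 2 * l w <= rform b w w + hnorm w ^+ 2 + C) ->
  exists (w_ : nat -> H) (y : H), [/\ forall n, W (w_ n), fdom b y, w_ @ \oo --> y,
    rform b (w_ n) (w_ n) @[n --> \oo] --> rform b y y /\
    (forall e : R, 0 < e -> exists N, forall n m, (N <= n)%N -> (N <= m)%N ->
      rform b (w_ n - w_ m) (w_ n - w_ m) < e) &
    forall w, W w -> rform b y w + rdot y w = l w].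
Proof.
move=> bn bc Wb W0 WD WZ lD lZ lC.
have [|||||||w_ [Ww wq wl]] :=
  @approx_riesz R H W (fun x y => rform b x y + rdot x y) l C W0 WD WZ.
- by move=> x y z /Wb ? /Wb ? /Wb ?; rewrite (rformDl bn)// rdotDl; ring.
- by move=> a x z /Wb ? /Wb ?; rewrite (rformZl bn)// rdotZl; ring.
- by move=> x y /Wb ? /Wb ?; rewrite (rformC bn)// rdotC.
- by move=> x /Wb ?; rewrite addr_ge0 ?(rform_ge0 bn)// rdotxx sqr_ge0.
- exact: lD.
- exact: lZ.
- by move=> w /lC; rewrite rdotxx.
have inv_small (e : R) : 0 < e -> exists N, forall n, (N <= n)%N -> n.+1%:R^-1 < e.
  move=> e0; have /cvgrPdist_lt/(_ e e0)[N _ hN] := @cvg_harmonic R.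
  exists N => n Nn; have := hN n Nn => /=.
  by rewrite sub0r normrN ger0_norm.
have bw n : fdom b (w_ n) by exact: Wb.
have wcauchy (e : R) : 0 < e -> exists N, forall n m, (N <= n)%N -> (N <= m)%N ->
    rform b (w_ n - w_ m) (w_ n - w_ m) + hnorm (w_ n - w_ m) ^+ 2 < e.
  move=> e0; have [|N hN] := inv_small (e / 4); first by rewrite divr_gt0.
  exists N => n m /hN Nn /hN Nm; apply: (@le_lt_trans _ _ (2 * (n.+1%:R^-1 + m.+1%:R^-1))); first by rewrite -rdotxx.
  by move: (n.+1%:R^-1) (m.+1%:R^-1) Nn Nm => u v; lra.
have [y wy] : exists y : H, w_ @ \oo --> y.
  apply: hnorm_cauchy_cvg => e e0; have [|N hN] := wcauchy (e ^+ 2).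
    by rewrite exprn_gt0.
  exists N => n m Nn Nm; have := hN n m Nn Nm.
  have := rform_ge0 bn (fdomB bn (bw n) (bw m)) => h1 h2.
  rewrite -(@ltr_pXn2r _ 2)// ?nnegrE ?hnorm_ge0 ?ltW//.
  lra.
have bcauchy (e : R) : 0 < e -> exists N, forall n m, (N <= n)%N -> (N <= m)%N ->
    rform b (w_ n - w_ m) (w_ n - w_ m) < e.
  move=> /wcauchy[N hN]; exists N => n m Nn Nm; apply: le_lt_trans (hN n m Nn Nm).
  by rewrite lerDl sqr_ge0.
have [bY rby wby] := closed_form_cvg bn bc bw wy bcauchy.
exists w_, y; split=> // w Ww'; have bw' := Wb _ Ww'.
(* The error splits into the Euler defect at [w_ n] and the contributions of [w_ n - y] to the form
   and to the inner product; each is brought below [e / 3]. *)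
apply/eqP; rewrite -subr_eq0 -normr_le0; apply/ler_addgt0Pr => e e0.
rewrite add0r.
set p := rform b w w; have p0 : 0 <= p by exact: rform_ge0.
set q := hnorm w; have q0 : 0 <= q by exact: hnorm_ge0.
have e3 : 0 < e / 3 by rewrite divr_gt0.
have pq0 : 0 < p + q ^+ 2 + 1 by rewrite ltr_wpDl// addr_ge0// sqr_ge0.
have d0 : 0 < (e / 3) ^+ 2 / (p + q ^+ 2 + 1) by rewrite divr_gt0// exprn_gt0.
have [N1 h1] := inv_small _ d0.
have [N2 h2] := wby _ d0.
have /cvg_hnormP/(_ (e / 3 / (q + 1)))[|N3 _ h3] := wy.
  by rewrite divr_gt0// ltr_wpDl.
pose n := maxn N1 (maxn N2 N3).
have {}h1 := h1 n (leq_maxl _ _).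
have {}h2 : _ := h2 n (leq_trans (leq_maxl _ _) (leq_maxr _ _)).
have {}h3 : hnorm (w_ n - y) < _ := h3 n (leq_trans (leq_maxr _ _) (leq_maxr _ _)).
have {}wl := wl n w Ww'.
have sq_small (u v : R) : 0 <= v -> v <= p + q ^+ 2 -> forall s,
   s < (e / 3) ^+ 2 / (p + q ^+ 2 + 1) -> 0 <= s -> u ^+ 2 <= v * s -> `|u| <= e / 3.
  move=> v0 vp s hs s0 us.
  rewrite -(@ler_pXn2r _ 2)// ?nnegrE ?(ltW e3)// real_normK ?num_real//.
  apply: (le_trans us); move: hs; rewrite ltr_pdivlMr// => hs.
  by apply: le_trans (ltW hs); rewrite mulrC ler_wpM2l//; lra.
have A1 : `|rform b (w_ n) w + rdot (w_ n) w - l w| <= e / 3.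
  apply: (sq_small _ (p + rdot w w) _ _ _ h1) => //; rewrite ?rdotxx//.
  by rewrite addr_ge0// sqr_ge0.
have A2 : `|rform b (w_ n - y) w| <= e / 3.
  apply: (sq_small _ p _ _ _ h2) => //; first by rewrite lerDl sqr_ge0.
    by apply: rform_ge0 => //; exact: fdomB.
  by rewrite mulrC; apply: rform_cauchy_schwarz => //; exact: fdomB.
have A3 : `|rdot (w_ n - y) w| <= e / 3.
  apply: le_trans (normr_rdot_le _ _) _; rewrite -/q.
  move: h3; rewrite ltr_pdivlMr ?ltr_wpDl// => /ltW; apply: le_trans.
  by rewrite ler_wpM2l ?hnorm_ge0// lerDl.
move: A1 A2 A3; rewrite (rformBl bn)// rdotBl !ler_norml.
by move=> /andP[? ?] /andP[? ?] /andP[? ?]; apply/andP; split; lra.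
Qed.

Lemma zero_form_nonneg : nonneg_symmetric (SForm [set: H] (fun _ _ => 0)).
Proof.
split=> /=.
- by split=> [|a x y _ _]; apply: mem_set.
- by move=> *; rewrite mulr0 addr0.
- by move=> *; rewrite rmorph0.
- by [].
Qed.

Lemma zero_form_closed : closed_form (SForm [set: H] (fun _ _ => 0)).
Proof. by move=> x_ x _ _ _; split=> //=; exact: cvg_cst. Qed.

(** For the zero form, [form_riesz] is the orthogonal projection of [x] on the closure of [W]; the
    residue [x - y] is orthogonal to [W] and hence vanishes. *)
Lemma dense_orthogonal (W : set H) :
  W 0 -> (forall x y, W x -> W y -> W (x + y)) ->
  (forall (a : R) x, W x -> W (a%:C%C *: x)) ->
  (forall x, (forall w, W w -> rdot x w = 0) -> x = 0) -> dense W.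
Proof.
move=> W0 WD WZ Wx; apply/dense_hnormP => x e e0.
have [|||w_ [y [Ww _ wy _ yw]]] :=
  @form_riesz _ W (rdot x) (hnorm x ^+ 2) zero_form_nonneg zero_form_closed (fun _ _ => I) W0 WD WZ.
- by move=> *; exact: rdotDr.
- by move=> *; exact: rdotZr.
- move=> w _; rewrite /rform/= add0r; have := sqr_ge0 (hnorm (x - w)).
  by rewrite hnormBsq; lra.
have xy : x = y.
  apply/eqP; rewrite -subr_eq0; apply/eqP/Wx => w Ww'.
  by rewrite rdotBl -(yw w Ww') /rform/= add0r subrr.
have /cvg_hnormP/(_ e e0)[N _ hN] := wy.
by exists (w_ N) => //; rewrite xy hnormBC; exact: (hN N (leqnn _)).
Qed.

End closed_forms.

(** * The representation theorem for closed forms *)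

Section representation.
Context {R : realType} {H : hilbertType R}.
Implicit Types (b : sform H) (x y z f g : H).

Lemma dense_rdot_eq0 (D : set H) x : dense D ->
  (forall z, D z -> rdot x z = 0) -> x = 0.
Proof.
move=> /dense_hnormP dD xD; apply: hnorm0_eq0; apply: contrapT => /eqP x0.
have x1 : 0 < hnorm x by rewrite lt_neqAle eq_sym x0 hnorm_ge0.
have [z Dz] := dD x _ x1; have := rdot_le x (x - z); rewrite rdotBr (xD z Dz) subr0 rdotxx.
by move: (hnorm (x - z)) => d; nra.
Qed.

Lemma submod_closedP (D : set H) : D 0 ->
  (forall (a : R[i]) x y, D x -> D y -> D (a *: x + y)) ->
  submod_closed (fun x => x \in D).
Proof.
move=> D0 DL; split=> [|a x y /set_mem Dx /set_mem Dy]; apply: mem_set => //.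
exact: DL.
Qed.

(** The unbounded operator [N P^-1] on the range of [P]; injectivity makes the preimage chosen by
    [xget] unique. *)
Definition range_operator (P N : H -> H) (Pl : linear P) (Nl : linear N)
    (Pinj : injective P) : operator H.
Proof.
refine (@Operator R H [set x | exists f, P f = x]
  (fun x => N (xget 0 [set f | P f = x])) _ _).
- apply: submod_closedP => [|a _ _ [f <-] [g <-]]; last by exists (a *: f + g); exact: Pl.
  exists 0; have := Pl (-1) 0 0; rewrite !scaleN1r oppr0 addr0 => ->.
  by rewrite addNr.
- move=> a _ _ [f <-] [g <-]; rewrite -Pl -Nl; congr N.
  have inv h : xget 0 [set f | P f = P h] = h.
    by apply: Pinj; exact: (@xgetI _ 0 [set f | P f = P h] h).
  by rewrite !inv.
Defined.

Lemma range_operatorE P N Pl Nl Pinj f :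
  @range_operator P N Pl Nl Pinj (P f) = N f.
Proof.
by congr N; apply: Pinj; exact: (@xgetI _ 0 [set g | P g = P f] f).
Qed.

(** Self-adjointness describes the graph by the identities [hdot (Q w) x = hdot w z], which are
    stable under limits of [x] and [z]. *)
Lemma self_adjoint_closed (Q : operator H) (x_ : nat -> H) x z :
  self_adjoint Q -> (forall n, dom Q (x_ n)) ->
  x_ @ \oo --> x -> Q (x_ n) @[n --> \oo] --> z -> dom Q x /\ Q x = z.
Proof.
move=> [_ sQ] dx xx Qx; apply/sQ => w dw.
have e1 u : dom Q u -> rdot (Q u) x = rdot u z.
  move=> du; rewrite rdotC; apply: cvgR_unique (cvg_rdot (Q u) xx) _.
  rewrite (_ : (fun n => _) = fun n => rdot (Q (x_ n)) u).
    by rewrite rdotC; exact: cvg_rdot.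
  apply/funext => n; rewrite (rdotC (Q _)) rdotC /rdot; congr complex.Re.
  exact: (sQ _ _).1.
(* The limit was taken in real parts only; ['i *: w] as a second test vector gives the imaginary
   parts. *)
have iQ u : dom Q u -> dom Q ('i%C *: u) /\ Q ('i%C *: u) = 'i%C *: Q u.
  have [dm0 dml] := dom_submod Q.
  have d0 : dom Q 0 by exact: set_mem dm0.
  have Q0 : Q 0 = 0.
    have := app_linear 1 d0 d0; rewrite !scale1r addr0 => /eqP.
    by rewrite -subr_eq0 opprD addrA subrr add0r oppr_eq0 => /eqP.
  move=> du; have := app_linear 'i%C du d0; rewrite Q0 !addr0 => ->; split=> //.
  rewrite -[_ *: u]addr0; apply: set_mem; apply: dml => //; exact: mem_set.
have [diw Qiw] := iQ w dw.
rewrite [LHS]hdotC [RHS]hdotC; congr (Num.conj _).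
rewrite !hdot_rdot -Qiw rdotC e1// (rdotC x (Q _)) e1//.
by rewrite (rdotC w) (rdotC _ z).
Qed.

(** On the range of [K], which is the domain of [Rad], the identity [|Q x|^2 = b[x]] is an algebraic
    computation. It extends to [fdom b] because this range is dense there for the form norm and [Q]
    is closed. *)
Lemma closed_form_sqrt b : nonneg_symmetric b -> closed_form b -> dense (fdom b) ->
  exists Rad Q : operator H,
    [/\ self_adjoint Rad, nonneg_operator Rad, is_sqrt Rad Q &
      forall x, fdom b x -> dom Q x /\ hnorm (Q x) ^+ 2 = rform b x x].
Proof.
move=> bn bc bd.
(* [K f] represents the functional [rdot f] in the inner product given by [b] plus that of [H], as
   [(1 + Rad)^-1 f] should. *)
have /choice[K hK] f : exists y, fdom b y /\
    forall z, fdom b z -> rform b y z + rdot y z = rdot f z.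
  have [|||w_ [y [_ by_ _ _ yz]]] := @form_riesz R H b _ (rdot f) (hnorm f ^+ 2) bn bc
      (fun _ h => h) (fdom0 bn) (@fdomD _ _ _ bn) (fun a => fdomZ bn a%:C%C).
  - by move=> *; exact: rdotDr.
  - by move=> *; exact: rdotZr.
  - move=> w bw; have := rform_ge0 bn bw; have := sqr_ge0 (hnorm (f - w)).
    by rewrite hnormBsq; lra.
  - by exists y.
have bK f : fdom b (K f) by case: (hK f).
have {hK}Kr f z : fdom b z -> rform b (K f) z + rdot (K f) z = rdot f z.
  by case: (hK f) => _; exact.
have Kc f z : fdom b z -> b (K f) z + hdot (K f) z = hdot f z.
  move=> bz; have biz := fdomZ bn 'i%C bz.
  by rewrite (fval_rformi bn)// !hdot_rdot -(Kr f _ bz) -(Kr f _ biz).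
have Ks : hsymmetric K.
  move=> f g; rewrite [LHS]hdotC -(Kc g _ (bK f)) -(Kc f _ (bK g)) rmorphD/= -hdotC.
  congr (_ + _).
  by rewrite -(fvalC bn).
have Kl := hsymmetric_linear Ks.
(* Testing the equation of [K f] with [K f] itself gives [|K f|^2 <= rdot f (K f)]. The result
   bounds both [1 - K] and [K], so both have square roots. *)
have KN f : hnorm (f - K f) ^+ 2 + hnorm (K f) ^+ 2 <= hnorm f ^+ 2.
  have := Kr f _ (bK f); have := rform_ge0 bn (bK f).
  by rewrite hnormBsq rdotxx; lra.
have K1 f : hnorm (f - K f) <= hnorm f.
  rewrite -(@ler_pXn2r _ 2)// ?nnegrE ?hnorm_ge0//.
  by have := KN f; have := sqr_ge0 (hnorm (K f)); lra.
have K2 f : hnorm (f - (f - K f)) <= hnorm f.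
  rewrite opprB addrC subrK -(@ler_pXn2r _ 2)// ?nnegrE ?hnorm_ge0//.
  by have := KN f; have := sqr_ge0 (hnorm (f - K f)); lra.
have K0 f : K f = 0 -> f = 0.
  move=> Kf; apply: dense_rdot_eq0 bd _ => z bz.
  by rewrite -(Kr f z bz) Kf /rdot hdot0l addr0 /rform (fval0l bn).
have [P [Ps P1 PP Pcomm]] := exists_operator_sqrt Ks K1.
have Zs : hsymmetric (fun f => f - K f) by move=> f g; rewrite hdotBl hdotBr Ks.
have [N [Ns N1 NN Ncomm]] := exists_operator_sqrt Zs K2.
(* [W] and [V] are fourth roots of [K] and [1 - K]; they make [Q] non-negative, since
   [hdot (N f) (P f)] equals [|V (W f)|^2]. *)
have [W [Ws _ WW Wcomm]] := exists_operator_sqrt Ps P1.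
have [V [Vs _ VV _]] := exists_operator_sqrt Ns N1.
have Pl := hsymmetric_linear Ps; have Nl := hsymmetric_linear Ns.
have addH (L : H -> H) x y : linear L -> L (x + y) = L x + L y.
  by move=> /(_ 1 x y); rewrite !scale1r.
have subH (L : H -> H) x y : linear L -> L (x - y) = L x - L y.
  by move=> Ll; rewrite [x - y]addrC [RHS]addrC -(scaleN1r y) -(scaleN1r (L y)) Ll.
have inj0 (L : H -> H) : linear L -> (forall x, L x = 0 -> x = 0) -> injective L.
  move=> Ll L0 x y xy; apply/eqP; rewrite -subr_eq0; apply/eqP/L0.
  by rewrite subH// xy subrr.
have Kinj : injective K by exact: inj0.
have lin0 (L : H -> H) : linear L -> L 0 = 0.
  by move=> Ll; have := subH L 0 0 Ll; rewrite !subrr.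
have Pinj : injective P.
  by apply: inj0 => // x Px; apply: K0; rewrite -PP Px lin0.
have bounded2 (L : H -> H) : (forall x, hnorm (x - L x) <= hnorm x) ->
    exists C : R, forall x, hnorm (L x) <= C * hnorm x.
  move=> h; exists 2 => x; have := hnorm_triangle x (L x) 0.
  by rewrite !subr0 hnormBC; have := h x; lra.
(* [P] commutes with [P^2 = K], hence with [1 - K] and with its root [N]. *)
have NP x : P (N x) = N (P x).
  apply: Ncomm => //; first exact: bounded2.
  by move=> y; rewrite subH// -!PP.
have NW x : N (W x) = W (N x) by apply: Wcomm => //; exact: bounded2.
have PNsum x : x = P (P x) + N (N x) by rewrite PP NN addrC subrK.
pose Q := range_operator Pl Nl Pinj.
have KRl : linear (fun f => f - K f) by exact: hsymmetric_linear.
pose Rad := range_operator Kl KRl Kinj.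
have QE f : Q (P f) = N f by exact: range_operatorE.
have RadE f : Rad (K f) = f - K f by rewrite range_operatorE.
have dQ f : dom Q (P f) by exists f.
have dRad f : dom Rad (K f) by exists f.
have Rad_dense : dense (dom Rad).
  apply: dense_orthogonal.
  - by exists 0; exact: lin0.
  - by move=> _ _ [f <-] [g <-]; exists (f + g); exact: addH.
  - move=> a _ [f <-]; exists (a%:C%C *: f); have := Kl a%:C%C f 0.
    by rewrite !addr0 lin0// addr0.
  (* By symmetry of [K], a vector orthogonal to its range is in its kernel. *)
  - move=> x xK; apply: K0; apply: rdot_eq => z.
    by rewrite /rdot Ks -/(rdot x (K z)) xK ?hdot0l.
have Q_dense : dense (dom Q).
  apply/dense_hnormP => x e e0; have /dense_hnormP/(_ x e e0)[_ [f <-] h] := Rad_dense.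
  by exists (K f) => //; rewrite -PP; exact: dQ.
have Qsa : self_adjoint Q.
  split=> // y z; split=> [[[g <-] <-] _ [f <-]|h].
    by rewrite !QE Ns -NP Ps.
  have yz : N y = P z.
    apply: hdot_eq => f; rewrite Ns Ps [LHS]hdotC [RHS]hdotC; congr (Num.conj _).
    by rewrite -QE h.
  (* From [N y = P z] and [P^2 + N^2 = 1], the vector [P y + N z] is sent to [y] by [P] and to [z]
     by [N]. *)
  have yE : y = P (P y + N z).
    by rewrite addH// NP -yz -PNsum.
  rewrite yE; split; first exact: dQ.
  by rewrite QE addH// -NP yz -PNsum.
have Rsa : self_adjoint Rad.
  split=> // y z; split=> [[[g <-] <-] _ [f <-]|h].
    by rewrite !RadE hdotBl hdotBr -(Ks f g).
  have yz : y - K y = K z.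
    apply: hdot_eq => f; rewrite Zs Ks [LHS]hdotC [RHS]hdotC; congr (Num.conj _).
    by rewrite -RadE h.
  have yE : y = K (y + z) by rewrite addH// -yz addrC subrK.
  split; first by rewrite yE; exact: dRad.
  by rewrite {1}yE RadE -yE addrC addKr.
have Rval f : rdot (Rad (K f)) (K f) = rform b (K f) (K f).
  by rewrite RadE rdotBl -Kr// addrK.
have QQ f : dom Q (Q (P (P f))) /\ Q (Q (P (P f))) = f - K f.
  by rewrite QE -NP QE NN; split.
exists Rad, Q; split=> //.
- move=> _ [f <-].
  by rewrite RadE hdotBl -Kc// addrK (fval_rform bn)// lecR (rform_ge0 bn).
- split=> //.
  + move=> _ [f <-]; rewrite QE -WW -Ws -NW -(VV (W f)) Vs hdot_hnorm lecR.
    exact: sqr_ge0.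
  + move=> x; split=> [[f <-]|[[f <-]]]; first by rewrite -PP; split; [exact: dQ|have [] := QQ f].
    (* If [N f = P g], then [f = P (P f + N g)], so [P f] lies in the range of [P^2 = K]. *)
    rewrite QE => -[g gE]; exists (P f + N g); rewrite -PP; congr P.
    by rewrite addH// NP gE -PNsum.
  + by move=> _ [f <-]; rewrite RadE -[in RHS]PP; have [_ ->] := QQ f.
move=> x bx.
have rKC f z : fdom b z -> rform b z (K f) + rdot z (K f) = rdot z f.
  by move=> bz; rewrite (rformC bn)// rdotC Kr// rdotC.
(* The functional represented by [x] is minimised over the range of [K] only. The limit [y] agrees
   with [x] against every [K z], which means [rdot y z = rdot x z]; so [y = x] and the [w_ n]
   approximate [x] in the form norm. *)
have [_ [f _ <-]//|||||||w_ [y [Kw by_ wy [rby wcauchy] yw]]] := @form_riesz R H b (range K)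
  (fun w => rform b x w + rdot x w) (rform b x x + hnorm x ^+ 2) bn bc.
- by exists 0 => //; exact: lin0.
- by move=> _ _ [f _ <-] [g _ <-]; exists (f + g) => //; exact: addH.
- move=> a _ [f _ <-]; exists (a%:C%C *: f) => //; have := Kl a%:C%C f 0.
  by rewrite !addr0 lin0// addr0.
- move=> _ _ [f _ <-] [g _ <-]; by rewrite -(addH K)// !rKC// rdotDr.
- move=> a _ [f _ <-].
  have -> : a%:C%C *: K f = K (a%:C%C *: f).
    by have := Kl a%:C%C f 0; rewrite !addr0 lin0// addr0.
  by rewrite !rKC// rdotZr.
- move=> _ [f _ <-]; have := rform_ge0 bn (fdomB bn bx (bK f)).
  have := sqr_ge0 (hnorm (x - K f)); rewrite hnormBsq.
  have bxK := fdomB bn bx (bK f).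
  rewrite (rformBl bn)// !(rformC bn _ bxK)// !(rformBl bn)// (rformC bn (bK f) bx).
  by lra.
have {yw}xy : x = y.
  by apply: rdot_eq => z; rewrite -(rKC z x bx) -(rKC z y by_) yw//; exists z.
subst y.
(* Both sides equal [rdot (h - K h) (K h)], since [Q (K h) = N (P h)]. *)
have QK f g : hnorm (Q (K f) - Q (K g)) ^+ 2 = rform b (K f - K g) (K f - K g).
  rewrite -(subH K)//; set h := f - g.
  have -> : Q (K f) - Q (K g) = N (P h) by rewrite -!PP !QE -(subH N)// -(subH P).
  rewrite -Rval RadE -rdotxx.
  have -> : rdot (N (P h)) (N (P h)) = rdot (P h - K (P h)) (P h).
    by rewrite rdotC /rdot Ns NN -/(rdot _ _) rdotC.
  have -> : rdot (h - K h) (K h) = rdot (P (h - K h)) (P h) by rewrite /rdot Ps PP.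
  by rewrite (subH P)// -!PP.
have [z Qz] : exists z : H, Q (w_ n) @[n --> \oo] --> z.
  apply: hnorm_cauchy_cvg => e e0; have [|N0 hN] := wcauchy (e ^+ 2).
    by rewrite exprn_gt0.
  exists N0 => n m Nn Nm; rewrite -(@ltr_pXn2r _ 2)// ?nnegrE ?hnorm_ge0 ?ltW//.
  have := hN n m Nn Nm; have [f _ <-] := Kw n; have [g _ <-] := Kw m.
  by rewrite QK.
have [dx Qx] : dom Q x /\ Q x = z.
  apply: self_adjoint_closed wy Qz => // n; have [f _ <-] := Kw n.
  by rewrite -PP.
split=> //; rewrite Qx; apply: cvgR_unique rby.
rewrite (_ : (fun n => _) = fun n => hnorm (Q (w_ n)) ^+ 2); last first.
  apply/funext => n; have [f _ <-] := Kw n.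
  have Q0 : Q 0 = 0 by rewrite -{1}(lin0 P Pl) QE lin0.
  by have := QK f 0; rewrite (lin0 K)// Q0 !subr0 => ->.
by rewrite expr2; under eq_fun do rewrite expr2; apply: cvgM; exact: cvg_hnorm.
Qed.
End representation.

(** * Bochner integrals *)

Section finitely_valued.
Context {R : realType}.
Implicit Types (X Y Z : Type).

(** [simple_function] for any codomain, so that simple vector functions can be combined with real
    and boolean ones. *)
Definition finitely_valued X (s : R -> X) : Prop :=
  finite_set (range s) /\ forall v, measurable (s @^-1` [set v]).

Lemma finitely_valued_comp2 X Y Z (F : X -> Y -> Z) (s1 : R -> X) (s2 : R -> Y) :
  finitely_valued s1 -> finitely_valued s2 ->
  finitely_valued (fun t => F (s1 t) (s2 t)).
Proof.
move=> [f1 m1] [f2 m2]; have f12 := finite_setX f1 f2.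
split.
  apply: sub_finite_set (finite_image (fun p => F p.1 p.2) f12) => _ [t _ <-].
  by exists (s1 t, s2 t) => //; split=> /=; exists t.
move=> v.
rewrite (_ : _ @^-1` _ = \bigcup_(p in (range s1 `*` range s2) `&` [set p | F p.1 p.2 = v])
    (s1 @^-1` [set p.1] `&` s2 @^-1` [set p.2])).
  apply: fin_bigcup_measurable; first exact: finite_setIl.
  by move=> p _; exact: measurableI.
apply/seteqP; split=> [t /= tv|t [p [_ /= <-] [/= -> ->]]//].
by exists (s1 t, s2 t) => //; split=> //; split; exists t.
Qed.

Lemma finitely_valued_comp X Z (F : X -> Z) (s : R -> X) :
  finitely_valued s -> finitely_valued (F \o s).
Proof. by move=> fs; have := finitely_valued_comp2 (fun x _ => F x) fs fs. Qed.

Lemma finitely_valued_cst X (x : X) : finitely_valued (fun=> x).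
Proof.
split; first by apply: sub_finite_set (finite_set1 x) => _ [t _ <-].
move=> v; have [<-|xv] := pselect (x = v).
  by rewrite (_ : _ @^-1` _ = setT)//; apply/seteqP; split.
by rewrite (_ : _ @^-1` _ = set0)//; apply/seteqP; split.
Qed.

Lemma finitely_valued_in (E : set R) : measurable E ->
  finitely_valued (fun t => t \in E).
Proof.
move=> mE; split.
  by apply: (@sub_finite_set _ _ [set true; false]) => // -[] _; [left|right].
case.
  by rewrite (_ : _ @^-1` _ = E)//; apply/seteqP; split=> t /=; move=> h; [exact: (set_mem h)|exact: (mem_set h)].
rewrite (_ : _ @^-1` _ = ~` E); first exact: measurableC.
apply/seteqP; split=> t /=; first by move=> h /mem_set; rewrite h.
by move=> tE; apply/negbTE; apply/negP => /set_mem.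
Qed.

Lemma finitely_valued_measurable (s : R -> R) : finitely_valued s ->
  measurable_fun [set: R] s.
Proof.
move=> [fs ms] _ Y mY; rewrite setTI.
rewrite (_ : _ @^-1` _ = \bigcup_(v in range s `&` Y) (s @^-1` [set v])).
  by apply: fin_bigcup_measurable => //; exact: finite_setIl.
by apply/seteqP; split=> [t tY|t [v [_ Yv] /= ->]//]; exists (s t) => //; split=> //; exists t.
Qed.

End finitely_valued.

Section bochner_integral_theory.
Context {R : realType} {V : preHilbertType R}.
Implicit Types (T : R) (f s : R -> V) (l : V -> R).
Local Notation mu := (@lebesgue_measure R).

Lemma itv_lt_pinfty T : (mu `[0%R, T] < +oo)%E.
Proof. by rewrite lebesgue_measure_itv/=; case: ifP => // _; rewrite -EFinB ltry. Qed.

Lemma Rintegral_itv_cst (a b c : R) : a <= b ->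
  \int[mu]_(t in `[a, b]) c = (b - a) * c.
Proof.
move=> ab; rewrite Rintegral_cst// mulrC; congr (_ * _).
have := lebesgue_measure_itv `[a, b] => /= ->; rewrite lte_fin.
by case: ltgtP ab => // -> _; rewrite subrr.
Qed.

Lemma integrable_bounded T (f : R -> R) (c : R) :
  measurable_fun `[0, T] f -> (forall t, t \in `[0, T] -> `|f t| <= c) ->
  mu.-integrable `[0, T] (EFin \o f).
Proof.
move=> mf fc; apply: measurable_bounded_integrable => //; first exact: itv_lt_pinfty.
exists c; split; first exact: num_real.
by move=> d cd t /= tT; apply: le_trans (ltW cd); exact: fc.
Qed.

Lemma integrableDr (D : set R) (f g : R -> R) : measurable D ->
  mu.-integrable D (EFin \o f) -> mu.-integrable D (EFin \o g) ->
  mu.-integrable D (EFin \o (fun t => f t + g t)).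
Proof.
move=> mD If Ig; rewrite (_ : _ \o _ = (EFin \o f) \+ (EFin \o g))%E//.
exact: integrableD.
Qed.

Lemma integrableZr (D : set R) (c : R) (f : R -> R) : measurable D ->
  mu.-integrable D (EFin \o f) -> mu.-integrable D (EFin \o (fun t => c * f t)).
Proof.
move=> mD If; rewrite (_ : _ \o _ = fun t => c%:E * (EFin \o f) t)%E//.
exact: integrableZl.
Qed.

Lemma Rintegral_sum (I : choiceType) (r : seq I) (h : I -> R -> R) (D : set R) :
  measurable D -> (forall i, mu.-integrable D (EFin \o h i)) ->
  mu.-integrable D (EFin \o (fun t => \sum_(i <- r) h i t)) /\
  \int[mu]_(t in D) (\sum_(i <- r) h i t) = \sum_(i <- r) \int[mu]_(t in D) h i t.
Proof.
move=> mD hi; elim: r => [|i r [IH1 IH2]].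
  rewrite big_nil; split.
    by under eq_fun do rewrite big_nil; exact: integrable0.
  under eq_Rintegral do rewrite big_nil.
  by rewrite Rintegral_cst// mul0r.
rewrite big_cons; split.
  rewrite (_ : (fun t => _) = fun t => h i t + \sum_(j <- r) h j t).
    exact: integrableDr.
  by apply/funext => t; rewrite big_cons.
under eq_Rintegral do rewrite big_cons.
by rewrite RintegralD// IH2.
Qed.

(** Homogeneity is only over [R] because the functionals in use are real parts of inner products. *)
Definition real_linear l := (forall x y, l (x + y) = l x + l y) /\
  forall (a : R) x, l (a%:C%C *: x) = a * l x.

Lemma real_linearB l : real_linear l -> forall x y, l (x - y) = l x - l y.
Proof.
move=> [lD lZ] x y; rewrite lD; congr (_ + _).
by rewrite -[in LHS]scaleN1r -(rmorphN1 (real_complex R)) lZ mulN1r.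
Qed.

Lemma simple_integral_linear T s l : simple_function s -> real_linear l ->
  mu.-integrable `[0, T] (EFin \o (l \o s)) /\
  l (simple_integral T s) = \int[mu]_(t in `[0, T]) l (s t).
Proof.
move=> ss [lD lZ]; have [fs ms] := ss.
have l0 : l 0 = 0 by apply: (addrI (l 0)); rewrite -lD !addr0.
pose h v t := l v * \1_(s @^-1` [set v]) t.
have hint v : mu.-integrable `[0, T] (EFin \o h v).
  apply: (@integrable_bounded _ _ (`|l v|)).
    by apply: measurable_funM => //; apply: measurable_funTS; exact: measurable_indic.
  move=> t _; rewrite /h normrM ler_piMr// indicE.
  by case: (_ \in _); rewrite ?normr1 ?normr0.
have hE : l \o s = fun t => \sum_(v <- fset_set (range s)) h v t.
  apply/funext => t /=.
  rewrite (big_fsetD1 (s t))/=; last by rewrite in_fset_set// mem_set//; exists t.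
  rewrite big_seq big1 => [|v].
    by rewrite /h indicE mem_set//= mulr1 addr0.
  rewrite in_fsetD1 => /andP[vt _]; rewrite /h indicE memNset ?mulr0//= => svt.
  by rewrite svt eqxx in vt.
have [hi hs] := Rintegral_sum (fset_set (range s)) (measurable_itv `[0, T]) hint.
split; first by rewrite hE.
rewrite (_ : (fun t => l (s t)) = l \o s)// hE hs /simple_integral.
rewrite fsbig_finite//=; elim/big_ind2 : _ => //= [x1 x2 y1 y2 <- <-//|v _].
rewrite lZ /h RintegralZl//.
  rewrite mulrC; congr (_ * _).
  rewrite /Rintegral integral_indic//; last exact: ms.
  by rewrite setIC.
apply: (@integrable_bounded _ _ 1).
  by apply: measurable_funTS; exact: measurable_indic.
by move=> t _; rewrite indicE; case: (_ \in _); rewrite ?normr1 ?normr0.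
Qed.

End bochner_integral_theory.

Section strong_measurability.
Context {R : realType}.
Implicit Types (T : R).
Local Notation mu := (@lebesgue_measure R).

Lemma strongly_measurable_comp2 {V W Z : preHilbertType R} (F : V -> W -> Z) T f g :
  (forall (x_ : nat -> V) (y_ : nat -> W) (x : V) (y : W),
    x_ @ \oo --> x -> y_ @ \oo --> y -> F (x_ n) (y_ n) @[n --> \oo] --> F x y) ->
  strongly_measurable T f -> strongly_measurable T g ->
  strongly_measurable T (fun t => F (f t) (g t)).
Proof.
move=> hF [s [ss sf]] [r [rs rg]]; exists (fun n t => F (s n t) (r n t)); split.
  by move=> n; exact: (finitely_valued_comp2 F (ss n) (rs n)).
by move=> t tT; apply: hF; [exact: sf|exact: rg].
Qed.

Lemma simple_strongly_measurable {V : preHilbertType R} T (s : R -> V) :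
  simple_function s -> strongly_measurable T s.
Proof. by move=> ss; exists (fun=> s); split=> // t _; exact: cvg_cst. Qed.

Lemma strongly_measurableD {V : preHilbertType R} T (f g : R -> V) :
  strongly_measurable T f -> strongly_measurable T g ->
  strongly_measurable T (fun t => f t + g t).
Proof. by apply: (strongly_measurable_comp2 (F := +%R)) => *; exact: cvgD. Qed.

Lemma strongly_measurableB {V : preHilbertType R} T (f g : R -> V) :
  strongly_measurable T f -> strongly_measurable T g ->
  strongly_measurable T (fun t => f t - g t).
Proof.
by apply: (strongly_measurable_comp2 (F := fun x y => x - y)) => *; exact: cvgB.
Qed.

Lemma strongly_measurable_fun {V : preHilbertType R} (g : V -> R) T (f : R -> V) :
  (forall (x_ : nat -> V) (x : V),
    x_ @ \oo --> x -> g (x_ n) @[n --> \oo] --> g x) ->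
  strongly_measurable T f -> measurable_fun `[0, T] (g \o f).
Proof.
move=> gc [s [ss sf]].
apply: (@measurable_fun_cvg _ _ _ _ (fun n => g \o s n)).
  move=> n; apply: measurable_funTS; apply: finitely_valued_measurable.
  exact: (finitely_valued_comp g (ss n)).
by move=> t tT; apply: gc; exact: sf.
Qed.

Lemma strongly_measurable_hnorm {V : preHilbertType R} T (f : R -> V) :
  strongly_measurable T f -> measurable_fun `[0, T] (fun t => hnorm (f t)).
Proof. by apply: strongly_measurable_fun => *; exact: cvg_hnorm. Qed.

(** [s n] is kept where its norm is at most twice that of [f] and replaced by 0 elsewhere. Where
    [f t] is non-zero the bound holds eventually, so convergence survives, and dominated convergence
    becomes available. *)
Lemma simple_approximation {V : preHilbertType R} T (f : R -> V) :
  strongly_measurable T f -> exists s : nat -> R -> V,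
  [/\ forall n, simple_function (s n),
    forall t, t \in `[0, T] -> s n t @[n --> \oo] --> f t &
    forall n t, t \in `[0, T] -> hnorm (s n t) <= 2 * hnorm (f t)].
Proof.
move=> sf; have [s [ss scv]] := sf.
pose E n := `[0, T] `&` [set t | hnorm (s n t) <= 2 * hnorm (f t)].
have mE n : measurable (E n).
  have m1 : measurable_fun `[0, T] (@hnorm R V \o s n).
    apply: measurable_funTS; apply: finitely_valued_measurable.
    exact: (finitely_valued_comp (@hnorm R V) (ss n)).
  have m2 : measurable_fun `[0, T] (fun t => 2 * hnorm (f t)).
    by apply: measurable_funM => //; exact: strongly_measurable_hnorm.
  have := measurable_fun_ler m1 m2; rewrite /measurable_fun.
  by move=> /(_ (measurable_itv _) [set true] I); exact.
exists (fun n t => if t \in E n then s n t else 0); split.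
- move=> n; apply: (finitely_valued_comp2 (fun (b : bool) x => if b then x else 0)).
    exact: finitely_valued_in.
  exact: ss.
- move=> t tT; apply/cvg_hnormP => e e0.
  have [f0|f0] := eqVneq (hnorm (f t)) 0.
    exists 0%N => // n _ /=; case: ifPn => [/set_mem[_ /=]|_].
      rewrite f0 mulr0 (hnorm0_eq0 f0) subr0; move=> h; exact: le_lt_trans h e0.
    by rewrite (hnorm0_eq0 f0) subr0 hnorm0.
  have f1 : 0 < hnorm (f t) by rewrite lt_neqAle eq_sym f0 hnorm_ge0.
  have /cvg_hnormP/(_ _ f1)[N1 _ h1] := scv t tT.
  have /cvg_hnormP/(_ _ e0)[N2 _ h2] := scv t tT.
  exists (maxn N1 N2) => // n; rewrite /= geq_max => /andP[n1 n2].
  rewrite ifT; first exact: h2.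
  apply/mem_set; split => //=.
  by have := hnorm_triangle (f t) (s n t) 0; rewrite !subr0; have := h1 n n1 => /=; lra.
- move=> n t tT; case: ifPn => [/set_mem[]//|_].
  by rewrite hnorm0 mulr_ge0// hnorm_ge0.
Qed.

End strong_measurability.

Section bochner_integral_bounds.
Context {R : realType}.
Implicit Types (T : R).
Local Notation mu := (@lebesgue_measure R).

Definition hintegrable {V : preHilbertType R} T (f : R -> V) :=
  strongly_measurable T f /\
  mu.-integrable `[0, T] (EFin \o (fun t => hnorm (f t))).

Lemma simple_hintegrable {V : preHilbertType R} T (s : R -> V) :
  simple_function s -> hintegrable T s.
Proof.
move=> ss; split; first exact: simple_strongly_measurable.
have fh := finitely_valued_comp (@hnorm R V) ss.
have [M hM] : exists M, forall t, hnorm (s t) <= M.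
  have [fs _] := fh.
  exists (\sum_(v <- fset_set (range (@hnorm R V \o s))) `|v|) => t.
  have st : hnorm (s t) \in fset_set (range (@hnorm R V \o s)).
    by rewrite in_fset_set// mem_set//; exists t.
  rewrite (big_fsetD1 _ st)/= (le_trans (ler_norm _))// lerDl.
  by apply: sumr_ge0.
apply: (integrable_bounded (c := M)).
  by apply: measurable_funTS; exact: finitely_valued_measurable.
by move=> t _; rewrite ger0_norm ?hnorm_ge0.
Qed.

Lemma hintegrable_dominated {V W : preHilbertType R} T (f : R -> V) (g : R -> R) :
  strongly_measurable T f -> mu.-integrable `[0, T] (EFin \o g) ->
  (forall t, t \in `[0, T] -> hnorm (f t) <= g t) -> hintegrable T f.
Proof.
move=> sf ig fg; split=> //; apply: le_integrable ig => //.
  by apply/measurable_EFinP; exact: strongly_measurable_hnorm.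
move=> t tT; rewrite /= lee_fin ger0_norm ?hnorm_ge0//.
by apply: le_trans (ler_norm _); exact: fg.
Qed.

Lemma hintegrableB {V : preHilbertType R} T (f g : R -> V) :
  hintegrable T f -> hintegrable T g -> hintegrable T (fun t => f t - g t).
Proof.
move=> [sf hf] [sg hg].
apply: (hintegrable_dominated (W := V) (g := fun t => hnorm (f t) + hnorm (g t))).
- exact: strongly_measurableB.
- exact: integrableDr.
- by move=> t _; exact: hnormB.
Qed.

Lemma bounded_linear_cvg {V : preHilbertType R} (l : V -> R) (C : R) :
  real_linear l -> (forall x, `|l x| <= C * hnorm x) ->
  forall (x_ : nat -> V) (x : V), x_ @ \oo --> x -> l (x_ n) @[n --> \oo] --> l x.
Proof.
move=> ll lC x_ x /cvg_hnormP xx; apply/cvgrPdist_lt => e e0.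
have C0 : 0 < `|C| + 1 by rewrite ltr_wpDl.
have := xx _ (divr_gt0 e0 C0); apply: filterS => n.
rewrite ltr_pdivlMr// => h.
rewrite -real_linearB//; apply: le_lt_trans (lC _) _; rewrite hnormBC; apply: le_lt_trans h.
by rewrite mulrC ler_wpM2l ?hnorm_ge0// (le_trans (ler_norm _))// lerDl.
Qed.

Lemma hintegrable_linear {V : preHilbertType R} T (f : R -> V) (l : V -> R) (C : R) :
  hintegrable T f -> real_linear l -> (forall x, `|l x| <= C * hnorm x) ->
  mu.-integrable `[0, T] (EFin \o (l \o f)) /\
  `|\int[mu]_(t in `[0, T]) l (f t)| <= C * \int[mu]_(t in `[0, T]) hnorm (f t).
Proof.
move=> [sf hf] ll lC.
have iC : mu.-integrable `[0, T] (EFin \o (fun t => C * hnorm (f t))).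
  exact: integrableZr.
have il : mu.-integrable `[0, T] (EFin \o (l \o f)).
  apply: le_integrable iC => //.
    apply/measurable_EFinP; apply: strongly_measurable_fun sf.
    exact: bounded_linear_cvg lC.
  by move=> t tT; rewrite /= lee_fin; apply: le_trans (lC _) (ler_norm _).
split=> //; apply: le_trans (le_normr_Rintegral _ il) _ => //.
rewrite -RintegralZl//; apply: le_Rintegral => //.
  exact: (integrable_norm il).
by move=> t _; exact: lC.
Qed.

Lemma Rintegral_cvg0 {V : preHilbertType R} T (f : nat -> R -> V) :
  (\int[mu]_(t in `[0%R, T]) (hnorm (f n t))%:E)%E @[n --> \oo] --> 0%E ->
  \int[mu]_(t in `[0, T]) hnorm (f n t) @[n --> \oo] --> (0 : R).
Proof. by move=> h; exact: (fine_cvg h). Qed.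

(** True for simple functions; the error in passing to [f] is at most [C] times the integral of
    [|f - s n|]. As the functionals separate points, the integral is determined by these
    identities. *)
Lemma bochner_integral_linear {V : preHilbertType R} T (f : R -> V) (v : V)
    (l : V -> R) (C : R) : is_bochner_integral T f v -> real_linear l ->
  (forall x, `|l x| <= C * hnorm x) ->
  hintegrable T f /\ l v = \int[mu]_(t in `[0, T]) l (f t).
Proof.
move=> [sf [s [ss sint sv]]] ll lC.
have hs n := simple_hintegrable T (ss n).
have hf : hintegrable T f.
  (* From some [N] on the error integral is finite, and then [|f| <= |f - s N| + |s N|] has an
     integrable bound. *)
  have /fine_cvgP[[N _ /(_ N (leqnn _))/= iN] _] := sint.
  apply: (hintegrable_dominated (W := V) (g := fun t => hnorm (f t - s N t) + hnorm (s N t))) => //.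
    apply: integrableDr => //; last by case: (hs N).
    apply/integrableP; split.
      have msf : strongly_measurable T (fun t => f t - s N t).
        by apply: strongly_measurableB => //; case: (hs N).
      by apply/measurable_EFinP; exact: strongly_measurable_hnorm.
    by under eq_integral do rewrite /= ger0_norm ?hnorm_ge0//; rewrite ltey_eq iN.
  by move=> t _; have := hnorm_triangle (s N t) (f t) 0; rewrite !subr0.
split=> //.
have lim1 := bounded_linear_cvg ll lC sv.
apply: (cvgR_unique lim1).
have ldiff n : l (simple_integral T (s n)) - \int[mu]_(t in `[0, T]) l (f t) =
    - \int[mu]_(t in `[0, T]) l (f t - s n t).
  have [is_ ->] := simple_integral_linear T (ss n) ll.
  have [if_ _] := hintegrable_linear hf ll lC.
  rewrite -opprB; congr (- _); rewrite -RintegralB//.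
  by apply: eq_Rintegral => t _; rewrite real_linearB.
apply/cvgrPdist_lt => e e0.
have C0 : 0 < `|C| + 1 by rewrite ltr_wpDl.
have /cvgrPdist_lt/(_ _ (divr_gt0 e0 C0)) := Rintegral_cvg0 sint.
apply: filterS => n; rewrite sub0r normrN ltr_pdivlMr// => h.
rewrite distrC ldiff normrN.
have [_] := hintegrable_linear (hintegrableB hf (hs n)) ll lC.
move=> /le_lt_trans; apply; apply: le_lt_trans h.
have I0 : 0 <= \int[mu]_(t in `[0, T]) hnorm (f t - s n t).
  by apply: Rintegral_ge0 => t _; exact: hnorm_ge0.
by rewrite ger0_norm//; have := ler_norm C; nra.
Qed.

Lemma rdot_real_linear {V : preHilbertType R} (z : V) : real_linear (fun x => rdot x z).
Proof. by split=> *; [exact: rdotDl|exact: rdotZl]. Qed.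

Lemma rdot_bounded {V : preHilbertType R} (z x : V) : `|rdot x z| <= hnorm z * hnorm x.
Proof. by rewrite mulrC normr_rdot_le. Qed.

Lemma bochner_integral_exists {V : hilbertType R} T (f : R -> V) :
  hintegrable T f -> exists v, is_bochner_integral T f v.
Proof.
move=> hf; have [sf If] := hf; have [s [ss scv s2]] := simple_approximation sf.
have hs n := simple_hintegrable T (ss n).
have sint : (\int[mu]_(t in `[0%R, T]) (hnorm (f t - s n t))%:E)%E @[n --> \oo] --> 0%E.
  (* The factor 3 comes from [|f - s n| <= |f| + 2 |f|]. *)
  have I3 : mu.-integrable `[0, T] (EFin \o (fun t => 3 * hnorm (f t))).
    exact: integrableZr.
  have := @dominated_cvg _ _ _ mu `[0, T] _ (fun n t => (hnorm (f t - s n t))%:E)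
    (fun=> 0%E) (EFin \o (fun t => 3 * hnorm (f t))).
  rewrite integral0; apply => //.
  - move=> n; have [sd _] := hintegrableB hf (hs n).
    by apply/measurable_EFinP; exact: strongly_measurable_hnorm.
  - move=> t tT; apply: cvg_EFin; first by near=> n.
    have /cvg_hnorm0P := scv t tT; apply: cvg_trans.
    by apply: near_eq_cvg; near=> n => /=; rewrite hnormBC.
  - move=> n t tT; rewrite /= lee_fin ger0_norm ?hnorm_ge0//.
    by have := s2 n t tT; have := hnormB (f t) (s n t); lra.
have [v sv] : exists v : V, simple_integral T (s n) @[n --> \oo] --> v.
  apply: hnorm_cauchy_cvg => e e0; have e2 : 0 < e / 2 by rewrite divr_gt0.
  have /cvgrPdist_lt/(_ _ e2)[N _ hN] := Rintegral_cvg0 sint.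
  exists N => n m Nn Nm.
  have := hN n Nn; have := hN m Nm => /=.
  rewrite !sub0r !normrN => /(le_lt_trans (ler_norm _)) hm /(le_lt_trans (ler_norm _)) hn.
  apply: (@le_lt_trans _ _ (\int[mu]_(t in `[0, T]) hnorm (f t - s n t) +
     \int[mu]_(t in `[0, T]) hnorm (f t - s m t))); last by lra.
  have [_ Im] := hintegrableB hf (hs m); have [_ In] := hintegrableB hf (hs n).
  apply: hnorm_le_dual => [|z].
    by rewrite addr_ge0//; apply: Rintegral_ge0 => t _; exact: hnorm_ge0.
  have lz := rdot_real_linear z.
  have [i1 e1] := simple_integral_linear T (ss n) lz.
  have [i2 e2'] := simple_integral_linear T (ss m) lz.
  rewrite rdotBl e1 e2' -RintegralB// -RintegralD// -RintegralZr//; last exact: integrableDr.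
  apply: le_Rintegral => //.
  - have [i3 _] := hintegrable_linear (hintegrableB (hs n) (hs m)) lz (rdot_bounded z).
    rewrite (_ : (fun t => _) = (fun t => rdot (s n t - s m t) z))//.
    by apply/funext => t; rewrite rdotBl.
  - rewrite (_ : (fun t => _) = (fun t => hnorm z * (hnorm (f t - s n t) + hnorm (f t - s m t)))).
      by apply: integrableZr => //; exact: integrableDr.
    by apply/funext => t; rewrite mulrC.
  - move=> t _; rewrite -rdotBl (le_trans (rdot_le _ _))// ler_wpM2r ?hnorm_ge0//.
    by rewrite (hnormBC (f t)) hnorm_triangle.
by exists v; split=> //; exists s.
Unshelve. all: by end_near. Qed.

Lemma bochner_integralP {V : hilbertType R} T (f : R -> V) :
  hintegrable T f -> is_bochner_integral T f (bochner_integral T f).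
Proof. by move=> /bochner_integral_exists[v fv]; exact: (xgetI 0 fv). Qed.

Lemma real_linear_bochner_integral {V : hilbertType R} T (f : R -> V) (l : V -> R) (C : R) :
  hintegrable T f -> real_linear l -> (forall x, `|l x| <= C * hnorm x) ->
  l (bochner_integral T f) = \int[mu]_(t in `[0, T]) l (f t).
Proof.
by move=> hf ll lC; have [_] := bochner_integral_linear (bochner_integralP hf) ll lC.
Qed.

Lemma hnorm_bochner_integralB {V : hilbertType R} T (f g : R -> V) :
  hintegrable T f -> hintegrable T g ->
  hnorm (bochner_integral T f - bochner_integral T g) <=
  \int[mu]_(t in `[0, T]) hnorm (f t - g t).
Proof.
move=> hf hg; apply: hnorm_le_dual => [|z].
  by apply: Rintegral_ge0 => t _; exact: hnorm_ge0.
have lz := rdot_real_linear z; have bz := rdot_bounded z.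
rewrite rdotBl !(real_linear_bochner_integral _ lz bz)//.
have [If _] := hintegrable_linear hf lz bz; have [Ig _] := hintegrable_linear hg lz bz.
have [i3 h3] := hintegrable_linear (hintegrableB hf hg) lz bz.
rewrite -RintegralB//; rewrite mulrC; apply: le_trans h3.
apply: le_trans (ler_norm _); rewrite le_eqVlt; apply/orP; left; apply/eqP.
by apply: eq_Rintegral => t _; rewrite rdotBl.
Qed.

Lemma bochner_integral0 {V : hilbertType R} T :
  bochner_integral T (fun _ : R => 0 : V) = 0.
Proof.
have h0 : hintegrable T (fun _ : R => 0 : V).
  exact/simple_hintegrable/finitely_valued_cst.
apply: rdot_eq => z; rewrite (real_linear_bochner_integral h0 (rdot_real_linear z) (rdot_bounded z)).
have r0 : rdot (0 : V) z = 0 by rewrite /rdot hdot0l.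
by under eq_Rintegral do rewrite r0; rewrite Rintegral_cst// mul0r r0.
Qed.

End bochner_integral_bounds.

(** * Contraction semigroups *)

Section integral_shift.
Context {R : realType}.
Local Notation mu := (@lebesgue_measure R).

Lemma Rintegral_shift (g : R -> R) (a b c : R) : a <= b -> continuous g ->
  \int[mu]_(x in `[a + c, b + c]) g x = \int[mu]_(x in `[a, b]) g (x + c).
Proof.
move=> ab cg; rewrite [in LHS]/Rintegral.
pose F (x : R) := x + c.
have dF (x : R) : is_derive x 1 F 1.
  by rewrite /F; apply: is_derive_eq; rewrite addr0.
have F1 : F^`()%classic = cst 1.
  by apply/funext => x; rewrite derive1E; apply: derive_val.
have cF : continuous F by move=> x; apply: cvgD; [exact: cvg_id|exact: cvg_cst].
rewrite -[a + c]/(F a) -[b + c]/(F b) integration_by_substitution_increasing//.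
- rewrite F1 /Rintegral; congr fine; apply: eq_integral => x _.
  by rewrite /= mulr1.
- by move=> x y _ _ xy; rewrite /F ltrD2r.
- by rewrite F1 => x _; exact: cvg_cst.
- by rewrite F1; exact: is_cvg_cst.
- by rewrite F1; exact: is_cvg_cst.
- split.
  + by move=> x _; exact: ex_derive.
  + by apply: cvg_at_right_filter; exact: cF.
  + by apply: cvg_at_left_filter; exact: cF.
- exact: continuous_subspaceT.
Qed.

End integral_shift.

(** * Measurability by discretising time *)

Section discretization.
Context {R : realType}.
Implicit Types (T : R).

(* Rounds [t] down to a multiple of [d], capped at [K * d]. *)
Definition round_down (d : R) (K : nat) (t : R) : R :=
  \sum_(k < K) (if k.+1%:R * d <= t then d else 0).

Lemma round_down_finitely_valued d K : finitely_valued (round_down d K).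
Proof.
elim: K => [|K IH].
  rewrite (_ : round_down d 0 = fun=> 0); first exact: finitely_valued_cst.
  by apply/funext => t; rewrite /round_down big_ord0.
have hE : finitely_valued (fun t => t \in `[K.+1%:R * d, +oo[%classic).
  exact: finitely_valued_in.
have := finitely_valued_comp2 (fun x (b : bool) => x + if b then d else 0) IH hE.
congr finitely_valued; apply/funext => t; rewrite /round_down big_ord_recr/=.
by rewrite mem_setE in_itv/= andbT.
Qed.

Lemma round_down_bounds d K t : 0 < d -> 0 <= t -> t < K.+1%:R * d ->
  0 <= round_down d K t <= t /\ t - round_down d K t < d.
Proof.
move=> d0 t0; elim: K => [|K IH] tK.
  by rewrite /round_down big_ord0 lexx t0 subr0; split=> //; move: tK; rewrite mul1r.
rewrite /round_down big_ord_recr/= -/(round_down d K t).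
case: ifPn => [Kt|]; last by rewrite -ltNge addr0; exact: IH.
(* Past the last threshold all earlier ones have been crossed, so every term of the sum is [d]. *)
have -> : round_down d K t = K%:R * d.
  transitivity (\sum_(k < K) d); last by rewrite sumr_const card_ord mulr_natl.
  apply: eq_bigr => k _; rewrite ifT//; apply: le_trans Kt.
  by rewrite ler_wpM2r ?(ltW d0)// ler_nat ltnS ltnW.
move: Kt tK; rewrite -[K.+2%:R]natr1 -[K.+1%:R]natr1.
have : 0 <= K%:R :> R by [].
by move: (K%:R : R) => k *; split; [apply/andP; split|]; nra.
Qed.

Lemma exists_discretization T : exists d : nat -> R -> R,
  (forall n, finitely_valued (d n)) /\
  forall n t, 0 <= t <= T -> 0 <= d n t <= t /\ t - d n t < n.+1%:R^-1.
Proof.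
(* Enough steps of length [1 / (n + 1)] for [T] to lie below the next multiple. *)
pose K n := Num.truncn (n.+1%:R * T).
exists (fun n => round_down n.+1%:R^-1 (K n)); split.
  by move=> n; exact: round_down_finitely_valued.
move=> n t /andP[t0 tT]; apply: round_down_bounds => //.
rewrite ltr_pdivlMr// mulrC; apply: le_lt_trans (truncnS_gt _).
by rewrite ler_wpM2l.
Qed.

(** Sampling time by [d n] and the vector by simple functions makes [G] finitely valued. Times are
    rounded downwards because the kernel [S (t - s)] of the mild solution is controlled only for
    [s <= t]. *)
Lemma strongly_measurable_joint {V W : preHilbertType R} T (G : R -> W -> V)
    (g : R -> W) : strongly_measurable T g ->
  (forall (r_ : nat -> R) (w_ : nat -> W) t, t \in `[0, T] ->
    (forall n, 0 <= r_ n <= t) -> r_ @ \oo --> t -> w_ @ \oo --> g t ->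
    G (r_ n) (w_ n) @[n --> \oo] --> G t (g t)) ->
  strongly_measurable T (fun t => G t (g t)).
Proof.
move=> [s [ss sg]] hG; have [d [fd dt]] := exists_discretization T.
exists (fun n t => G (d n t) (s n t)); split.
  by move=> n; exact: (finitely_valued_comp2 G (fd n) (ss n)).
move=> t tT; have tT' : 0 <= t <= T by move: tT; rewrite in_itv.
apply: hG => //; last exact: sg.
  by move=> n; case: (dt n t tT').
apply/cvgrPdist_lt => e e0; have /cvgrPdist_lt/(_ e e0)[N _ hN] := @cvg_harmonic R.
exists N => // n Nn; have := hN n Nn => /=.
rewrite sub0r normrN ger0_norm// => h.
have [/andP[_ h1] h2] := dt n t tT'.
by rewrite ger0_norm ?subr_ge0//; exact: lt_trans h2 h.
Qed.

Lemma continuous_strongly_measurable {V : preHilbertType R} T (F : R -> V) :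
  (forall (r_ : nat -> R) t, t \in `[0, T] ->
    (forall n, 0 <= r_ n <= t) -> r_ @ \oo --> t -> F (r_ n) @[n --> \oo] --> F t) ->
  strongly_measurable T F.
Proof.
move=> hF; apply: (strongly_measurable_joint (G := fun t (_ : V) => F t) (g := fun=> 0)).
  exact/simple_strongly_measurable/finitely_valued_cst.
by move=> r_ w_ t tT rt rr _; exact: hF.
Qed.

Lemma scale_strongly_measurable {V : preHilbertType R} T (phi : R -> R) (v : V) :
  continuous phi -> strongly_measurable T (fun t => (phi t)%:C%C *: v).
Proof.
move=> cphi; apply: continuous_strongly_measurable => r_ t _ _ rt.
have prt : phi (r_ n) @[n --> \oo] --> phi t by apply: continuous_cvg => //; exact: cphi.
apply/cvg_hnormP => e e0; have v0 : 0 < hnorm v + 1 by rewrite ltr_wpDl ?hnorm_ge0.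
have /cvgrPdist_lt/(_ _ (divr_gt0 e0 v0)) := prt; apply: filterS => n.
rewrite ltr_pdivlMr// distrC -scalerBl -rmorphB hnormZ; apply: le_lt_trans.
by rewrite ler_wpM2l// lerDl.
Qed.

End discretization.

(** * Orbits of a contraction semigroup and density of the generator's domain *)

Section semigroup_theory.
Context {R : realType} {H : hilbertType R}.
Variables (S : R -> H -> H).
Hypothesis Ssg : contraction_semigroup S.
Local Notation mu := (@lebesgue_measure R).

Lemma semigroupD t x y : 0 <= t -> S t (x + y) = S t x + S t y.
Proof. by case: Ssg => Sl _ _ _ _ t0; have := Sl t t0 1 x y; rewrite !scale1r. Qed.

Lemma semigroupr0 t : 0 <= t -> S t 0 = 0.
Proof. by move=> t0; apply: (addrI (S t 0)); rewrite -semigroupD// !addr0. Qed.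

Lemma semigroupZ t (a : R[i]) x : 0 <= t -> S t (a *: x) = a *: S t x.
Proof.
case: Ssg => Sl _ _ _ _ t0; have := Sl t t0 a x 0.
by rewrite !addr0 semigroupr0// addr0.
Qed.

Lemma semigroupB t x y : 0 <= t -> S t (x - y) = S t x - S t y.
Proof. by move=> t0; rewrite semigroupD// -scaleN1r semigroupZ// scaleN1r. Qed.

Lemma hnorm_semigroup t x : 0 <= t -> hnorm (S t x) <= hnorm x.
Proof.
by case: Ssg => _ _ _ h _ t0; have := h t x t0; rewrite !normr_hnorm lecR.
Qed.

Lemma semigroup_add s t x : 0 <= s -> 0 <= t -> S (s + t) x = S s (S t x).
Proof. by case: Ssg => _ _ h _ _; exact: h. Qed.

Lemma semigroup_start x (e : R) : 0 < e -> exists2 d : R, 0 < d &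
  forall t, 0 <= t -> t < d -> hnorm (S t x - x) < e.
Proof.
move=> e0; case: Ssg => _ S0 _ _ /(_ x)/cvg_hnormP/(_ e e0).
rewrite near_withinE => /nbhs_ballP[d /= d0 hd]; exists d => // t t0 td.
have [->|tn0] := eqVneq t 0; first by rewrite S0 subrr hnorm0.
apply: hd; last by rewrite lt_neqAle eq_sym tn0.
by rewrite -ball_normE/= sub0r normrN ger0_norm.
Qed.

(** For [s <= t] the difference is, up to sign, [S s] applied to [S (t - s) x - x]; contractivity
    transports the modulus at time 0 to all times, with the same [d]. *)
Lemma semigroup_continuous x (e : R) : 0 < e -> exists2 d : R, 0 < d &
  forall s t, 0 <= s -> 0 <= t -> `|s - t| < d -> hnorm (S s x - S t x) < e.
Proof.
move=> e0; have [d d0 hd] := semigroup_start x e0; exists d => //.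
have key s t : 0 <= s -> s <= t -> `|s - t| < d -> hnorm (S s x - S t x) < e.
  move=> s0 st; rewrite distrC ger0_norm ?subr_ge0// => std.
  rewrite -{1}(subrKC s t) semigroup_add ?subr_ge0// -semigroupB//.
  by apply: le_lt_trans (hnorm_semigroup _ _) _ => //; rewrite hnormBC hd ?subr_ge0.
move=> s t s0 t0; case: (leP s t) => [|/ltW] st h; first exact: key.
by rewrite hnormBC key// distrC.
Qed.

Lemma semigroup_cvg (r_ : nat -> R) (t : R) x : 0 <= t -> (forall n, 0 <= r_ n) ->
  r_ @ \oo --> t -> S (r_ n) x @[n --> \oo] --> S t x.
Proof.
move=> t0 r0 rt; apply/cvg_hnormP => e e0.
have [d d0 hd] := semigroup_continuous x e0.
have /cvgrPdist_lt/(_ d d0) := rt; apply: filterS => n h.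
by apply: hd => //; rewrite distrC.
Qed.

Lemma semigroup_hintegrable T x : hintegrable T (fun t => S t x).
Proof.
apply: (hintegrable_dominated (W := H) (g := fun=> hnorm x)).
- apply: continuous_strongly_measurable => r_ t; rewrite in_itv/= => /andP[t0 _] rt.
  by apply: semigroup_cvg => // n; case/andP: (rt n).
- by apply: (integrable_bounded (c := hnorm x)) => // t _; rewrite ger0_norm ?hnorm_ge0.
- by move=> t; rewrite in_itv/= => /andP[t0 _]; exact: hnorm_semigroup.
Qed.

(** With [v] the integral of the orbit over [[0, h]], the vector [S t v - v] is the integral over
    [[h, h + t]] minus the one over [[0, t]]. Divided by [t], they tend to [S h x] and [x]. Each is
    treated after pairing with a vector [z] and costs at most [e / 4]. *)
Lemma semigroup_mean_domain (h : R) x : 0 < h ->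
  (t^-1)%:C%C *: (S t (bochner_integral h (fun s => S s x)) -
    bochner_integral h (fun s => S s x)) @[t --> 0^'+] --> S h x - x.
Proof.
move=> h0; set v := bochner_integral _ _.
apply/cvg_hnormP => e e0; have e4 : 0 < e / 4 by rewrite divr_gt0.
have [d d0 hd] := semigroup_continuous x e4.
near=> t.
have t0 : 0 < t by near: t; exact: nbhs_right_gt.
have td : t < d by near: t; exact: nbhs_right_lt.
have t0' := ltW t0; have h0' := ltW h0.
have -> : (t^-1)%:C%C *: (S t v - v) - (S h x - x) =
    (t^-1)%:C%C *: (S t v - v - t%:C%C *: (S h x - x)).
  by rewrite [RHS]scalerBr scalerA -rmorphM mulVf ?gt_eqF// scale1r.
rewrite hnormZ ger0_norm ?invr_ge0// mulrC ltr_pdivrMr//.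
apply: (@le_lt_trans _ _ (e / 2 * t)); last by rewrite ltr_pM2r//; lra.
apply: hnorm_le_dual => [|z]; first by rewrite mulr_ge0// divr_ge0// ltW.
(* The absolute value extends the pairing continuously to the whole line, as [Rintegral_shift]
   demands. *)
pose g (s : R) := rdot (S `|s| x) z.
have cg : continuous g.
  move=> s; apply/cvgrPdist_lt => r r0; have z0 : 0 < hnorm z + 1.
    by rewrite ltr_wpDl ?hnorm_ge0.
  have [c c0 hc] := semigroup_continuous x (divr_gt0 r0 z0).
  near=> s'; rewrite /g -rdotBl (le_lt_trans (normr_rdot_le _ _))//.
  apply: (@le_lt_trans _ _ (hnorm (S `|s| x - S `|s'| x) * (hnorm z + 1))).
    by rewrite ler_wpM2l ?hnorm_ge0// lerDl.
  rewrite -ltr_pdivlMr//; apply: hc => //; apply: le_lt_trans (ler_dist_dist _ _) _.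
  by near: s'; apply: cvgr_dist_lt.
have Ig a b : mu.-integrable `[a, b] (EFin \o g).
  by apply: continuous_compact_integrable; [exact: segment_compact|exact: continuous_subspaceT].
have lz := rdot_real_linear z; have bz := rdot_bounded z.
have hS := semigroup_hintegrable h x.
have rv : rdot v z = \int[mu]_(s in `[0, h]) g s.
  rewrite (real_linear_bochner_integral hS lz bz); apply: eq_Rintegral => s.
  by rewrite mem_setE in_itv/= => /andP[s0 _]; rewrite /g ger0_norm.
have rSv : rdot (S t v) z = \int[mu]_(s in `[t, h + t]) g s.
  rewrite (_ : \int[mu]_(s in `[t, h + t]) g s = \int[mu]_(s in `[0 + t, h + t]) g s).
  2: by rewrite add0r.
  rewrite Rintegral_shift//.
  pose l y := rdot (S t y) z.
  rewrite -[LHS]/(l v) /v (real_linear_bochner_integral (l := l) (C := hnorm z) hS).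
  - apply: eq_Rintegral => s; rewrite mem_setE in_itv/= => /andP[s0 _].
    by rewrite /g /l ger0_norm ?addr_ge0// addrC semigroup_add.
  - split=> [y y'|a y]; rewrite /l; first by rewrite semigroupD// rdotDl.
    by rewrite semigroupZ// rdotZl.
  - move=> y; apply: le_trans (normr_rdot_le _ _) _.
    by rewrite mulrC ler_wpM2l ?hnorm_ge0// hnorm_semigroup.
have E1 := @Rintegral_itvB _ g (BLeft 0) (BRight (h + t)) t (Ig 0 (h + t)).
have E2 := @Rintegral_itvB _ g (BLeft 0) (BRight (h + t)) h (Ig 0 (h + t)).
have {}E1 : \int[mu]_(s in `[0, h + t]) g s - \int[mu]_(s in `[0, t]) g s =
    \int[mu]_(s in `[t, h + t]) g s.
  rewrite -[RHS]Rintegral_itv_obnd_cbnd; first by apply: E1; rewrite bnd_simp ?lerDr.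
  by apply: integrableS (Ig t (h + t)) => //; exact: subset_itv_oc_cc.
have {}E2 : \int[mu]_(s in `[0, h + t]) g s - \int[mu]_(s in `[0, h]) g s =
    \int[mu]_(s in `[h, h + t]) g s.
  rewrite -[RHS]Rintegral_itv_obnd_cbnd; first by apply: E2; rewrite bnd_simp ?lerDl.
  by apply: integrableS (Ig h (h + t)) => //; exact: subset_itv_oc_cc.
have small a : 0 <= a ->
    `|\int[mu]_(s in `[a, a + t]) g s - t * g a| <= e / 4 * hnorm z * t.
  move=> a0.
  have cst_int c : \int[mu]_(s in `[a, a + t]) c = t * c.
    by rewrite Rintegral_itv_cst ?lerDl// addrAC subrr add0r.
  have Icst c : mu.-integrable `[a, a + t] (EFin \o fun=> c).
    by apply: continuous_compact_integrable;
      [exact: segment_compact|apply: continuous_subspaceT => y; exact: cvg_cst].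
  rewrite -(cst_int (g a)) -RintegralB// [_ * t]mulrC -cst_int.
  have IB : mu.-integrable `[a, a + t] (EFin \o (fun s => g s - g a)).
    by apply: integrableDr.
  apply: le_trans (le_normr_Rintegral _ IB) _ => //.
  apply: le_Rintegral => //; first exact: (integrable_norm IB).
  move=> s; rewrite /= in_itv/= => /andP[sa sat].
  rewrite /g -rdotBl (le_trans (normr_rdot_le _ _))// ler_wpM2r ?hnorm_ge0//.
  have s0 := le_trans a0 sa; rewrite !ger0_norm//; apply: ltW; apply: hd => //.
  by rewrite ger0_norm ?subr_ge0//; move: td; lra.
have := small 0 (lexx _); have := small h h0'; rewrite add0r.
rewrite !rdotBl rdotZl rdotBl rSv rv -E1.
have -> : rdot (S h x) z = g h by rewrite /g ger0_norm.
have -> : rdot x z = g 0 by case: Ssg => _ S0 _ _ _; rewrite /g normr0 S0.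
rewrite -E2 !ler_norml => /andP[_ h1] /andP[h2 _].
by move: h1 h2; move: (Rintegral _ _ _) (Rintegral _ _ _) (Rintegral _ _ _) => i1 i2 i3; lra.
Unshelve. all: by end_near. Qed.

(** The means of the orbit over [[0, h]] lie in the domain and tend to [x] as [h] shrinks. *)
Lemma generator_dense (A : operator H) : generates S A -> dense (dom A).
Proof.
move=> gA; apply/dense_hnormP => x e e0.
have e2 : 0 < e / 2 by rewrite divr_gt0.
have [d d0 hd] := semigroup_continuous x e2.
pose h := d / 2; have h0 : 0 < h by rewrite divr_gt0.
pose v := bochner_integral h (fun s => S s x).
have [dv _] := (gA v (S h x - x)).2 (semigroup_mean_domain h0).
have dZ (a : R[i]) y : dom A y -> dom A (a *: y).
  have [dm0 dml] := dom_submod A; move=> dy; rewrite -[_ *: y]addr0.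
  by apply: set_mem; apply: dml => //; exact: mem_set.
exists ((h^-1)%:C%C *: v); first exact: dZ.
have -> : x - (h^-1)%:C%C *: v = (h^-1)%:C%C *: (h%:C%C *: x - v).
  by rewrite [RHS]scalerBr scalerA -rmorphM mulVf ?gt_eqF// scale1r.
rewrite hnormZ ger0_norm ?invr_ge0 ?ltW// mulrC ltr_pdivrMr//.
apply: (@le_lt_trans _ _ (e / 2 * h)); last by rewrite ltr_pM2r//; lra.
apply: hnorm_le_dual => [|z]; first by rewrite mulr_ge0// ltW.
have lz := rdot_real_linear z; have bz := rdot_bounded z.
have hS := semigroup_hintegrable h x.
have cst_int (c : R) : \int[mu]_(s in `[0, h]) c = h * c.
  by rewrite Rintegral_itv_cst ?ltW// subr0.
have Icst (c : R) : mu.-integrable `[0, h] (EFin \o fun=> c).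
  by apply: (integrable_bounded (c := `|c|)).
have [IS _] := hintegrable_linear hS lz bz.
rewrite rdotBl rdotZl (real_linear_bochner_integral hS lz bz) -cst_int -RintegralB//.
rewrite mulrAC mulrC -cst_int; apply: le_Rintegral => //.
  have := integrableDr (measurable_itv _) (Icst (rdot x z)) (integrableZr (-1) (measurable_itv _) IS).
  by congr (_.-integrable _ _); apply/funext => s /=; rewrite mulN1r.
move=> s; rewrite /= in_itv/= => /andP[s0 sh].
rewrite -rdotBl (le_trans (rdot_le _ _))// ler_wpM2r ?hnorm_ge0// ltW//.
have {1}-> : x = S 0 x by case: Ssg.
by apply: hd => //; rewrite sub0r normrN ger0_norm//; move: sh; rewrite /h; lra.
Qed.

End semigroup_theory.

(** * Density of C1 controls in L2 *)

Section square_norm.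
Context {R : realType} {V : preHilbertType R}.
Implicit Types (T : R) (f g : R -> V).
Local Notation mu := (@lebesgue_measure R).

Lemma measurable_hnorm_sq T f : strongly_measurable T f ->
  measurable_fun `[0, T] (fun t => (hnorm (f t) ^+ 2)%:E).
Proof.
move=> sf; apply/measurable_EFinP.
rewrite (_ : (fun t => _) = fun t => hnorm (f t) * hnorm (f t)).
  by apply: measurable_funM; exact: strongly_measurable_hnorm.
by apply/funext => t; rewrite expr2.
Qed.

Lemma sq_norm_ge0 T f : (0 <= sq_norm T f)%E.
Proof. by apply: integral_ge0 => t _; rewrite lee_fin sqr_ge0. Qed.

(** From [(a + b)^2 <= 2 (a^2 + b^2)]. This stands in for the triangle inequality in [L2] and
    explains the quarters of [e] below. *)
Lemma sq_normD T f g : strongly_measurable T f -> strongly_measurable T g ->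
  (sq_norm T (fun t => f t + g t)%R <= 2%:E * (sq_norm T f + sq_norm T g))%E.
Proof.
move=> sf sg; have mf := measurable_hnorm_sq sf; have mg := measurable_hnorm_sq sg.
have pos (h : R -> V) t : (0 <= (hnorm (h t) ^+ 2)%:E)%E by rewrite lee_fin sqr_ge0.
rewrite -ge0_integralD// -ge0_integralZl//; last 2 first.
- exact: emeasurable_funD.
- by move=> t _; exact: adde_ge0.
apply: ge0_le_integral => //.
- by move=> t _; exact: (pos (fun t => f t + g t)).
- exact: (measurable_hnorm_sq (strongly_measurableD sf sg)).
- by apply: emeasurable_funM => //; exact: emeasurable_funD.
move=> t _; rewrite -EFinD -EFinM lee_fin.
have := hnormD (f t) (g t); have := hnorm_ge0 (f t + g t).
have := hnorm_ge0 (f t); have := hnorm_ge0 (g t).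
by have := sqr_ge0 (hnorm (f t) - hnorm (g t)); nra.
Qed.

Lemma sq_normN T f : sq_norm T (fun t => - f t) = sq_norm T f.
Proof. by apply: eq_integral => t _; rewrite hnormN. Qed.

Lemma L2D T f g : L2 T f -> L2 T g -> L2 T (fun t => f t + g t).
Proof.
move=> [sf f2] [sg g2]; split; first exact: strongly_measurableD.
apply: le_lt_trans (sq_normD sf sg) _.
by apply: lte_mul_pinfty; rewrite ?lee_fin//; exact: lte_add_pinfty.
Qed.

Lemma L2N T f : L2 T f -> L2 T (fun t => - f t).
Proof.
move=> [sf f2]; split; last by rewrite sq_normN.
by apply: (strongly_measurable_comp2 (F := fun x _ => - x) _ sf sf) => *; exact: cvgN.
Qed.

Lemma L2B T f g : L2 T f -> L2 T g -> L2 T (fun t => f t - g t).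
Proof. by move=> Lf Lg; apply: L2D => //; exact: L2N. Qed.

Lemma L2_hnorm_integrable T f : L2 T f ->
  mu.-integrable `[0, T] (EFin \o (fun t => hnorm (f t) ^+ 2)).
Proof.
move=> [sf f2]; apply/integrableP; split; first exact: measurable_hnorm_sq.
by under eq_integral do rewrite /= ger0_norm ?sqr_ge0//.
Qed.

Lemma L2_hintegrable T f : L2 T f -> hintegrable T f.
Proof.
move=> Lf; have I2 := L2_hnorm_integrable Lf; case: Lf => sf _.
apply: (hintegrable_dominated (W := V) (g := fun t => 1 + hnorm (f t) ^+ 2)) => //.
  apply: integrableDr => //.
  by apply: (integrable_bounded (c := 1)) => // t _; rewrite normr1.
by move=> t _; have := sqr_ge0 (1 - hnorm (f t)); have := hnorm_ge0 (f t); nra.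
Qed.

Lemma sq_norm_restrict T T' f : T' <= T -> strongly_measurable T f ->
  (sq_norm T' f <= sq_norm T f)%E.
Proof.
move=> TT sf; apply: ge0_subset_integral => //.
- exact: measurable_hnorm_sq.
- by move=> t _; rewrite lee_fin sqr_ge0.
- by apply: subset_itvl; rewrite bnd_simp.
Qed.

Lemma L2_restrict T T' f : T' <= T -> L2 T f -> L2 T' f.
Proof.
move=> TT [sf f2]; split; last exact: le_lt_trans (sq_norm_restrict TT sf) f2.
have [s [ss scv]] := sf; exists s; split=> // t; rewrite in_itv/= => /andP[t0 tT].
by apply: scv; rewrite in_itv/= t0 (le_trans tT).
Qed.

Lemma sq_norm_dominated_cvg T (f_ : nat -> R -> V) f (g : R -> R) :
  (forall n, strongly_measurable T (f_ n)) -> strongly_measurable T f ->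
  (forall t, t \in `[0, T] -> f_ n t @[n --> \oo] --> f t) ->
  mu.-integrable `[0, T] (EFin \o g) ->
  (forall n t, t \in `[0, T] -> hnorm (f t - f_ n t) ^+ 2 <= g t) ->
  sq_norm T (fun t => f t - f_ n t) @[n --> \oo] --> 0%E.
Proof.
move=> sf_ sf fcv Ig fg.
have := @dominated_cvg _ _ _ mu `[0, T] _ (fun n t => (hnorm (f t - f_ n t) ^+ 2)%:E)
  (fun=> 0%E) (EFin \o g).
rewrite integral0; apply => //.
- by move=> n; exact: (measurable_hnorm_sq (strongly_measurableB sf (sf_ n))).
- move=> t tT; apply: cvg_EFin; first by near=> n.
  have h : hnorm (f t - f_ n t) @[n --> \oo] --> (0 : R).
    have /cvg_hnorm0P := fcv t tT; apply: cvg_trans.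
    by apply: near_eq_cvg; near=> n => /=; rewrite hnormBC.
  rewrite (_ : _ \o _ = fun n => hnorm (f t - f_ n t) * hnorm (f t - f_ n t)).
    by rewrite -[X in _ --> X](mulr0 0); exact: cvgM.
  by apply/funext => n; rewrite /= expr2.
- by move=> n t tT; rewrite /= lee_fin ger0_norm ?sqr_ge0//; exact: fg.
Unshelve. all: by end_near. Qed.

End square_norm.

Section C1_dense.
Context {R : realType} {V : preHilbertType R}.
Variable T : R.
Implicit Types (f g w : R -> V).
Local Notation mu := (@lebesgue_measure R).

(** A class made for induction: stable under sums, negation and dominated limits, it grows from
    smooth steps to indicators, simple functions and [L2]. *)
Definition C1_approximable f := strongly_measurable T f /\
  forall e : R, 0 < e -> exists w, [/\ C1 T w, strongly_measurable T w &
    (sq_norm T (fun t => f t - w t)%R <= e%:E)%E].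

Lemma C1_approximable_C1 w : C1 T w -> strongly_measurable T w -> C1_approximable w.
Proof.
move=> cw sw; split=> // e e0; exists w; split=> //.
rewrite /sq_norm (eq_integral (fun=> 0%E)); first by rewrite integral0 lee_fin ltW.
by move=> t _; rewrite subrr hnorm0 expr0n.
Qed.

Lemma C1D f g : C1 T f -> C1 T g -> C1 T (fun t => f t + g t).
Proof.
move=> [f' [cf' ff']] [g' [cg' gg']]; exists (fun t => f' t + g' t); split.
  by move=> t; apply: cvgD; [exact: cf'|exact: cg'].
move=> t tT; under eq_fun do rewrite opprD addrACA scalerDr.
by apply: cvgD; [exact: ff'|exact: gg'].
Qed.

Lemma C1N f : C1 T f -> C1 T (fun t => - f t).
Proof.
move=> [f' [cf' ff']]; exists (fun t => - f' t); split.
  by move=> t; apply: cvgN; exact: cf'.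
move=> t tT; under eq_fun do rewrite -opprD scalerN.
by apply: cvgN; exact: ff'.
Qed.

Lemma C1_approximableD f g : C1_approximable f -> C1_approximable g ->
  C1_approximable (fun t => f t + g t).
Proof.
move=> [sf hf] [sg hg]; split=> [|e e0]; first exact: strongly_measurableD.
have e4 : 0 < e / 4 by rewrite divr_gt0.
have [w [cw sw fw]] := hf _ e4; have [r [cr sr gr]] := hg _ e4.
exists (fun t => w t + r t); split; [exact: C1D|exact: strongly_measurableD|].
rewrite (_ : (fun t => _) = fun t => (f t - w t) + (g t - r t)); last first.
  by apply/funext => t; rewrite opprD addrACA.
have sfw := strongly_measurableB sf sw; have sgr := strongly_measurableB sg sr.
apply: le_trans (sq_normD sfw sgr) _.
apply: (@le_trans _ _ (2%:E * ((e / 4)%:E + (e / 4)%:E))%E).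
  by rewrite lee_pmul2l//; exact: leeD.
by rewrite -EFinD -EFinM lee_fin; lra.
Qed.

Lemma C1_approximableN f : C1_approximable f -> C1_approximable (fun t => - f t).
Proof.
move=> [sf hf]; split=> [|e e0].
  by apply: (strongly_measurable_comp2 (F := fun x _ => - x) _ sf sf) => *; exact: cvgN.
have [w [cw sw fw]] := hf _ e0; exists (fun t => - w t); split; first exact: C1N.
  by apply: (strongly_measurable_comp2 (F := fun x _ => - x) _ sw sw) => *; exact: cvgN.
by rewrite (_ : (fun t => _) = fun t => - (f t - w t)) ?sq_normN//; apply/funext => t; rewrite opprD.
Qed.

Lemma C1_approximable_near f : strongly_measurable T f ->
  (forall e : R, 0 < e -> exists2 g, C1_approximable g &
    (sq_norm T (fun t => f t - g t)%R <= e%:E)%E) -> C1_approximable f.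
Proof.
move=> sf h; split=> // e e0; have e4 : 0 < e / 4 by rewrite divr_gt0.
have [g [sg hg] fg] := h _ e4; have [w [cw sw gw]] := hg _ e4.
exists w; split=> //.
rewrite (_ : (fun t => _) = fun t => (f t - g t) + (g t - w t)); last first.
  by apply/funext => t; rewrite addrA subrK.
have sfw := strongly_measurableB sf sg; have sgr := strongly_measurableB sg sw.
apply: le_trans (sq_normD sfw sgr) _.
apply: (@le_trans _ _ (2%:E * ((e / 4)%:E + (e / 4)%:E))%E).
  by rewrite lee_pmul2l//; exact: leeD.
by rewrite -EFinD -EFinM lee_fin; lra.
Qed.

Lemma C1_approximable_lim (f_ : nat -> R -> V) f (g : R -> R) :
  (forall n, C1_approximable (f_ n)) -> strongly_measurable T f ->
  (forall t, t \in `[0, T] -> f_ n t @[n --> \oo] --> f t) ->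
  mu.-integrable `[0, T] (EFin \o g) ->
  (forall n t, t \in `[0, T] -> hnorm (f t - f_ n t) ^+ 2 <= g t) ->
  C1_approximable f.
Proof.
move=> af sf fcv Ig fg; apply: C1_approximable_near => // e e0.
have := sq_norm_dominated_cvg (fun n => (af n).1) sf fcv Ig fg.
move=> /fine_cvgP[fin /cvgrPdist_lt/(_ e e0) small].
have [N _ hN] := filterI fin small.
have [/= h1 h2] := hN N (leqnn N).
exists (f_ N) => //; rewrite -(fineK h1) lee_fin; apply: ltW.
by apply: le_lt_trans h2; rewrite sub0r normrN ler_norm.
Qed.

Lemma C1_scale (phi phi' : R -> R) (v : V) : continuous phi' ->
  (forall t : R, is_derive t 1 phi (phi' t)) -> C1 T (fun t => (phi t)%:C%C *: v).
Proof.
move=> cphi dphi; exists (fun t => (phi' t)%:C%C *: v); split.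
  apply: continuous_subspaceT => t; apply/cvg_hnormP => e e0.
  have v0 : 0 < hnorm v + 1 by rewrite ltr_wpDl ?hnorm_ge0.
  have /cvgrPdist_lt/(_ _ (divr_gt0 e0 v0)) := cphi t; apply: filterS => s.
  rewrite ltr_pdivlMr// distrC -scalerBl -rmorphB hnormZ; apply: le_lt_trans.
  by rewrite ler_wpM2l// lerDl.
move=> t tT; apply/cvg_hnormP => e e0.
have v0 : 0 < hnorm v + 1 by rewrite ltr_wpDl ?hnorm_ge0.
have /cvgrPdist_lt/(_ _ (divr_gt0 e0 v0)) : h^-1 *: (phi (h + t) - phi t) @[h --> 0^'] --> phi' t.
  have [dp <-] := dphi t.
  have := dp; rewrite /derivable /derive.
  by under eq_fun do rewrite [_ *: 1]mulr1.
move=> /nbhs_ballP[d /= d0 hd].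
apply/nbhs_ballP; exists d => //= s ts st _.
have /hd : ball 0 d (s - t).
  by move: ts; rewrite -!ball_normE/= sub0r normrN distrC.
move=> /(_ _); rewrite subr_eq0 subrK => /(_ st).
rewrite ltr_pdivlMr// distrC -scalerBl -rmorphB scalerA -rmorphM -scalerBl -rmorphB hnormZ.
by apply: le_lt_trans; rewrite ler_wpM2l// lerDl.
Qed.

End C1_dense.

Section C1_dense_L2.
Context {R : realType} {V : preHilbertType R}.
Variable T : R.
Local Notation mu := (@lebesgue_measure R).

(* Increasing smooth functions converging pointwise to the indicator of
   [t > x]; the shift [n] of the exponent forces the value 0 at [t = x]. *)
Definition logistic (n : nat) (x t : R) : R :=
  (1 + expR (n%:R - n%:R ^+ 2 * (t - x)))^-1.

Lemma logistic_derivable n x : exists2 phi' : R -> R, continuous phi' &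
  forall t : R, is_derive t 1 (logistic n x) (phi' t).
Proof.
pose q (t : R) : R := expR (n%:R - n%:R ^+ 2 * (t - x)).
have q1 t : 1 + q t != 0 by rewrite gt_eqF// addr_gt0// expR_gt0.
pose l (t : R) : R := n%:R - n%:R ^+ 2 * (t - x).
have dl (t : R) : is_derive t 1 l (- n%:R ^+ 2).
  rewrite /l; apply: is_derive_eq.
  by rewrite /GRing.scale/= add0r mul1r subr0 mulr1.
have dq (t : R) : is_derive t 1 q (q t * - n%:R ^+ 2).
  by apply: (@is_derive1_comp _ expR l); exact: is_derive_expR.
have cq : continuous q.
  by move=> t; apply: differentiable_continuous; apply/derivable1_diffP; exact: ex_derive.
exists (fun t => - ((1 + q t)^-1 ^+ 2) * (q t * - n%:R ^+ 2)).
  move=> t; apply: cvgM; last by apply: cvgM; [exact: cq|exact: cvg_cst].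
  apply: cvgN; under eq_fun do rewrite expr2; rewrite expr2.
  by apply: cvgM; apply: cvgV => //; apply: cvgD; [exact: cvg_cst|exact: cq|exact: cvg_cst|exact: cq].
move=> t; rewrite /logistic -/(q _).
have d1 : is_derive t 1 (fun s => 1 + q s) (0 + q t * - n%:R ^+ 2) by exact: is_deriveD.
have := @is_deriveV _ (fun s => 1 + q s) t _ 1 (q1 t) d1.
by rewrite add0r exprVn.
Qed.

Lemma logistic_ge0_le1 n x t : 0 <= logistic n x t <= 1.
Proof.
have q0 := expR_gt0 (n%:R - n%:R ^+ 2 * (t - x)).
have q1 := addr_gt0 ltr01 q0.
by rewrite /logistic invr_ge0 invf_le1// lerDl !ltW.
Qed.

Lemma logistic_cvg x t : logistic n x t @[n --> \oo] --> ((x < t)%R%:R : R).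
Proof.
have sq : n.+1%:R^-1 @[n --> \oo] --> (0 : R) := @cvg_harmonic R.
case: ltP => [xt|tx]; apply/cvgrPdist_lt => e e0.
  have tx0 : 0 < t - x by rewrite subr_gt0.
  have /cvgrPdist_lt/(_ e e0) := sq.
  (* Once [n (t - x) > 2] the exponent is at most [- n], and [1 + n <= exp n] bounds [q] by
     [1 / (n + 1)]. *)
  move: (nbhs_infty_gtr (2 / (t - x))); apply: filterS2 => n hn.
  rewrite sub0r normrN ger0_norm// => h.
  have /andP[_ l1] := logistic_ge0_le1 n x t.
  rewrite ger0_norm ?subr_ge0//; apply: le_lt_trans h.
  rewrite /logistic; set q := expR _.
  have q0 : 0 < q := expR_gt0 _.
  have n0 : 0 <= n%:R :> R by [].
  have qn : q * n.+1%:R <= 1.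
    rewrite -ler_pdivlMr// mul1r -[q]invrK lef_pV2 ?posrE ?invr_gt0//.
    rewrite /q -expRN; apply: le_trans (expR_ge1Dx _).
    rewrite -natr1; move: hn; rewrite ltr_pdivrMr// => hn; nra.
  have -> : 1 - (1 + q)^-1 = q / (1 + q) by field; rewrite gt_eqF// addr_gt0.
  rewrite -[leRHS]mul1r ler_pdivlMr// mulrAC ler_pdivrMr ?addr_gt0//; lra.
(* For [t <= x] the exponent is at least [n], so the denominator is at least [n + 1]. *)
have /cvgrPdist_lt/(_ e e0) := sq; apply: filterS => n.
rewrite !sub0r !normrN !ger0_norm//; last by case/andP: (logistic_ge0_le1 n x t).
apply: le_lt_trans; rewrite /logistic lef_pV2 ?posrE ?addr_gt0 ?expR_gt0//.
rewrite -natr1 addrC lerD2l; apply: le_trans (expR_ge1Dx _).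
have n2 : 0 <= n%:R ^+ 2 :> R by exact: sqr_ge0.
by nra.
Qed.

Lemma integrable_cst (c : R) : mu.-integrable `[0, T] (EFin \o fun=> c).
Proof. by apply: (integrable_bounded (c := `|c|)). Qed.

Lemma C1_approximable_cst (v : V) : C1_approximable T (fun=> v).
Proof.
apply: C1_approximable_C1; last exact/simple_strongly_measurable/finitely_valued_cst.
exists (fun=> 0); split; first by apply: continuous_subspaceT => t; exact: cvg_cst.
by move=> t _; under eq_fun do rewrite subrr scaler0; exact: cvg_cst.
Qed.

Definition indicv (E : set R) (v : V) (t : R) : V := if t \in E then v else 0.

Lemma indicv_simple E v : measurable E -> simple_function (indicv E v).
Proof.
by move=> mE; exact: (finitely_valued_comp (fun b : bool => if b then v else 0) (finitely_valued_in mE)).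
Qed.

(** Dynkin induction from the rays []x, +oo[], which are stable under intersection and generate the
    Borel sets. Rays are limits of logistic functions, complements are differences with a constant,
    disjoint unions are dominated limits of finite sums. *)
Lemma C1_approximable_indic (E : set R) (v : V) : measurable E ->
  C1_approximable T (indicv E v).
Proof.
move=> mE.
have GE : (@RGenOInfty.G R).-sigma.-measurable E.
  by rewrite -RGenOInfty.measurableE.
apply: (dynkin_induction (G := @RGenOInfty.G R)
  (P := fun E => C1_approximable T (indicv E v)) _ _ _ _ _ _ GE).
- exact: RGenOInfty.measurableE.
- move=> _ _ [x ->] [y ->]; exists (Num.max x y); apply/seteqP; split=> t /=; rewrite !in_itv/= !andbT.
    by move=> [xt yt]; rewrite gt_max xt.
  by rewrite gt_max => /andP[].
- rewrite (_ : indicv _ _ = fun=> v); first exact: C1_approximable_cst.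
  by apply/funext => t; rewrite /indicv mem_setT.
- move=> _ [x ->].
  apply: (@C1_approximable_lim _ _ _ (fun n t => (logistic n x t)%:C%C *: v) _ (fun=> hnorm v ^+ 2)).
  + move=> n; have [phi' cphi dphi] := logistic_derivable n x.
    apply: C1_approximable_C1; first exact: C1_scale cphi dphi.
    apply: scale_strongly_measurable => t.
    apply: differentiable_continuous; apply/derivable1_diffP.
    by have [] := dphi t.
  + exact/simple_strongly_measurable/indicv_simple.
  + move=> t _; apply/cvg_hnormP => e e0.
    have v0 : 0 < hnorm v + 1 by rewrite ltr_wpDl ?hnorm_ge0.
    have /cvgrPdist_lt/(_ _ (divr_gt0 e0 v0)) := @logistic_cvg x t; apply: filterS => n.
    rewrite ltr_pdivlMr// distrC.
    have -> : indicv `]x, +oo[ v t = (((x < t)%R%:R : R))%:C%C *: v.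
      rewrite /indicv mem_setE in_itv/= andbT; case: ifP => _; first by rewrite scale1r.
      by rewrite scale0r.
    by rewrite -scalerBl -rmorphB hnormZ; apply: le_lt_trans; rewrite ler_wpM2l// lerDl.
  + exact: integrable_cst.
  + move=> n t _.
    have -> : indicv `]x, +oo[ v t = (((x < t)%R%:R : R))%:C%C *: v.
      rewrite /indicv mem_setE in_itv/= andbT; case: ifP => _; first by rewrite scale1r.
      by rewrite scale0r.
    rewrite -scalerBl -rmorphB hnormZ exprMn ler_piMl ?sqr_ge0//.
    rewrite real_normK ?num_real//.
    have /andP[] := logistic_ge0_le1 n x t; move: (logistic n x t) => p p0 p1.
    by case: (x < t)%R => /=; nra.
- move=> S mS aS; rewrite (_ : indicv _ _ = fun t => v + - indicv S v t).
    by apply: C1_approximableD; [exact: C1_approximable_cst|exact: C1_approximableN].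
  apply/funext => t; rewrite /indicv in_setC.
  by case: (t \in S) => /=; rewrite ?subrr ?subr0.
- move=> F mF tF aF.
  have aU n : C1_approximable T (indicv (\big[setU/set0]_(k < n) F k) v).
    elim: n => [|n IH].
      rewrite big_ord0 (_ : indicv _ _ = fun=> 0); first exact: C1_approximable_cst.
      by apply/funext => t; rewrite /indicv in_set0.
    rewrite big_ord_recr/= (_ : indicv _ _ = fun t =>
      indicv (\big[setU/set0]_(k < n) F k) v t + indicv (F n) v t).
      exact: C1_approximableD.
    apply/funext => t; rewrite /indicv in_setU.
    case: (boolP (t \in F n)) => tn; last by rewrite orbF addr0.
    rewrite orbT ifN ?add0r//; apply/negP => /set_mem.
    rewrite -bigcup_mkord => -[k /= kn Fkt].
    have : (F k `&` F n) !=set0 by exists t; split=> //; exact: set_mem.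
    by move=> /(tF k n I I) kn'; rewrite kn' ltnn in kn.
  apply: (@C1_approximable_lim _ _ _ (fun n => indicv (\big[setU/set0]_(k < n) F k) v) _
    (fun=> hnorm v ^+ 2)) => //.
  + by apply/simple_strongly_measurable/indicv_simple; exact: bigcup_measurable.
  + move=> t _; have [[k _ Fk]|nF] := pselect ((\bigcup_k F k) t).
      apply/cvg_hnormP => e e0; exists k.+1 => // n /= kn.
      rewrite /indicv !ifT ?subrr ?hnorm0//; apply/mem_set; first by exists k.
      by rewrite -bigcup_mkord; exists k.
    apply/cvg_hnormP => e e0; near=> n.
    rewrite /indicv !ifN ?subrr ?hnorm0//; apply/negP => /set_mem//.
    by rewrite -bigcup_mkord => -[k /= _ Fk]; apply: nF; exists k.
  + exact: integrable_cst.
  + move=> n t _; rewrite /indicv ler_pXn2r ?nnegrE ?hnorm_ge0//.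
    case: ifP => _; case: ifP => _; rewrite ?subrr ?subr0 ?sub0r ?hnormN ?hnorm0 ?hnorm_ge0//.
Unshelve. all: by end_near. Qed.

Lemma C1_approximable_simple (s : R -> V) : simple_function s -> C1_approximable T s.
Proof.
move=> [fs ms].
have sE : s = fun t => \sum_(v <- fset_set (range s)) indicv (s @^-1` [set v]) v t.
  apply/funext => t /=.
  rewrite (big_fsetD1 (s t))/=; last by rewrite in_fset_set// mem_set//; exists t.
  rewrite big_seq big1 => [|v].
    by rewrite /indicv mem_set// addr0.
  rewrite in_fsetD1 => /andP[vt _]; rewrite /indicv memNset//= => svt.
  by rewrite svt eqxx in vt.
rewrite sE; elim: (finmap.enum_fset _) => [|v r IH].
  rewrite (_ : (fun t => _) = fun=> 0); first exact: C1_approximable_cst.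
  by apply/funext => t; rewrite big_nil.
rewrite (_ : (fun t => _) = fun t => indicv (s @^-1` [set v]) v t +
  \sum_(w <- r) indicv (s @^-1` [set w]) w t).
  by apply: C1_approximableD => //; exact: C1_approximable_indic.
by apply/funext => t; rewrite big_cons.
Qed.

Lemma C1_approximable_L2 (u : R -> V) : L2 T u -> C1_approximable T u.
Proof.
move=> Lu; have [su _] := Lu; have [s [ss scv s2]] := simple_approximation su.
(* 9 is the square of the factor in [|u - s n| <= 3 |u|]. *)
apply: (@C1_approximable_lim _ _ _ s _ (fun t => 9 * hnorm (u t) ^+ 2)) => //.
- by move=> n; exact: C1_approximable_simple.
- by apply: integrableZr => //; exact: L2_hnorm_integrable.
- move=> n t tT; have := s2 n t tT; have := hnormB (u t) (s n t).
  by have := hnorm_ge0 (u t - s n t); have := hnorm_ge0 (u t); nra.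
Qed.

End C1_dense_L2.

(** * Mild solutions *)

Section mild_solutions.
Context {R : realType} {H U : hilbertType R}.
Variables (A : operator H) (B : {linear U -> H}) (C : R).
Hypotheses (Amax : maximal_dissipative A) (C0 : 0 <= C)
  (BC : forall w, hnorm (B w) <= C * hnorm w).
Local Notation mu := (@lebesgue_measure R).
Local Notation S := (semigroup_of A).

Lemma semigroup_ofP : contraction_semigroup S /\ generates S A.
Proof. exact: (xgetPex _ Amax). Qed.

Let Ssg : contraction_semigroup S := semigroup_ofP.1.

(** Measurability rests on joint continuity of [(s, w) |-> S (t - s) (B w)]: the orbit of the limit
    vector is continuous, and contractivity absorbs the change of [w] uniformly in time. *)
Lemma control_hintegrable t (u : R -> U) : L2 t u ->
  hintegrable t (fun s => S (t - s) (B (u s))).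
Proof.
move=> Lu; have [su Iu] := L2_hintegrable Lu.
apply: (hintegrable_dominated (W := U) (g := fun s => C * hnorm (u s))).
- apply: (strongly_measurable_joint (G := fun s w => S (t - s) (B w)) su).
  move=> r_ w_ s; rewrite in_itv/= => /andP[s0 st] rs rc wc.
  have rt n : 0 <= t - r_ n by rewrite subr_ge0; have /andP[_ h] := rs n; exact: le_trans h st.
  have ts : 0 <= t - s by rewrite subr_ge0.
  have hB : S (t - r_ n) (B (u s)) @[n --> \oo] --> S (t - s) (B (u s)).
    apply: (semigroup_cvg Ssg) => //.
    by apply: cvgB => //; exact: cvg_cst.
  apply/cvg_hnormP => e e0; have e2 : 0 < e / 2 by rewrite divr_gt0.
  have /cvg_hnormP/(_ _ e2) := hB.
  have C1 : 0 < C + 1 by rewrite ltr_wpDl.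
  have /cvg_hnormP/(_ _ (divr_gt0 e2 C1)) := wc; apply: filterS2 => n.
  rewrite ltr_pdivlMr// => h1 h2.
  have h3 := hnorm_triangle (S (t - r_ n) (B (u s))) (S (t - r_ n) (B (w_ n))) (S (t - s) (B (u s))).
  apply: le_lt_trans h3 _; rewrite -(semigroupB Ssg)// -linearB.
  have h4 := hnorm_semigroup Ssg (B (w_ n - u s)) (rt n).
  have h5 := BC (w_ n - u s); have h6 := hnorm_ge0 (w_ n - u s).
  by nra.
- exact: integrableZr.
- move=> s; rewrite in_itv/= => /andP[_ st].
  by apply: le_trans (hnorm_semigroup Ssg _ _) _; rewrite ?subr_ge0.
Qed.

Lemma mild_solution_diff t x y (u w : R -> U) : 0 <= t -> L2 t u -> L2 t w ->
  hnorm (mild_solution A B x u t - mild_solution A B y w t) <=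
  hnorm (x - y) + C * \int[mu]_(s in `[0, t]) hnorm (u s - w s).
Proof.
move=> t0 Lu Lw; rewrite /mild_solution opprD addrACA.
apply: le_trans (hnormD _ _) _; apply: lerD.
  by rewrite -(semigroupB Ssg)// hnorm_semigroup.
have hu := control_hintegrable Lu; have hw := control_hintegrable Lw.
apply: le_trans (hnorm_bochner_integralB hu hw) _.
have [_ I1] := hintegrableB hu hw.
have [_ I2] := hintegrableB (L2_hintegrable Lu) (L2_hintegrable Lw).
rewrite -RintegralZl//; apply: le_Rintegral => //; first exact: integrableZr.
move=> s; rewrite /= in_itv/= => /andP[_ st].
rewrite -(semigroupB Ssg) ?subr_ge0// -linearB.
by apply: le_trans (hnorm_semigroup Ssg _ _) _; rewrite ?subr_ge0.
Qed.

Lemma mild_solution0 t x : 0 <= t -> mild_solution A B x (fun=> 0) t = S t x.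
Proof.
move=> t0; rewrite /mild_solution -[RHS]addr0; congr (_ + _).
have L0 : L2 t (fun _ : R => 0 : U).
  split; first exact/simple_strongly_measurable/finitely_valued_cst.
  rewrite /sq_norm; under eq_integral do rewrite hnorm0 expr0n/=.
  by rewrite integral0.
(* For [s > t] the integrand is a value of [S] at a negative time, which may be anything; it is
   compared with 0 on [[0, t]] only. *)
rewrite -(bochner_integral0 (V := H) t); apply/eqP; rewrite -subr_eq0; apply/eqP.
apply: hnorm0_eq0; apply/eqP; rewrite eq_le hnorm_ge0 andbT.
have h0 : hintegrable t (fun _ : R => 0 : H).
  exact/simple_hintegrable/finitely_valued_cst.
apply: le_trans (hnorm_bochner_integralB (control_hintegrable L0) h0) _.
rewrite (_ : Rintegral _ _ _ = \int[mu]_(s in `[0, t]) 0).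
  by rewrite Rintegral_cst// mul0r.
apply: eq_Rintegral => s; rewrite mem_setE in_itv/= => /andP[_ st].
by rewrite subr0 linear0 (semigroupr0 Ssg) ?subr_ge0// hnorm0.
Qed.

(** Integrate [|e| <= d + |e|^2 / d]. *)
Lemma Rintegral_hnorm_le t (e : R -> U) (d : R) : 0 <= t -> 0 < d -> L2 t e ->
  (sq_norm t e <= (d ^+ 2)%:E)%E ->
  \int[mu]_(s in `[0, t]) hnorm (e s) <= d * (t + 1).
Proof.
move=> t0 d0 Le he; have I2 := L2_hnorm_integrable Le; have [_ I1] := L2_hintegrable Le.
have I3 := integrableZr d^-1 (measurable_itv _) I2.
have Ic : mu.-integrable `[0, t] (EFin \o fun=> d).
  by apply: (integrable_bounded (c := `|d|)).
apply: (@le_trans _ _ (\int[mu]_(s in `[0, t]) (d + d^-1 * hnorm (e s) ^+ 2))).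
  apply: le_Rintegral => //; first exact: integrableDr.
  move=> s _; rewrite -(ler_pM2l d0) mulrDr mulrA mulfV ?gt_eqF// mul1r.
  by have := sqr_ge0 (d - hnorm (e s)); have := sqr_ge0 (hnorm (e s)); have := sqr_ge0 d; nra.
rewrite RintegralD// Rintegral_itv_cst// subr0 RintegralZl// mulrDr mulr1 [d * t]mulrC lerD2l.
rewrite mulrC ler_pdivrMr// -expr2.
rewrite -lee_fin; apply: le_trans he; rewrite /Rintegral fineK//.
exact: (integrable_fin_num _ I2).
Qed.

Lemma mild_solution_cvg T t x0 (x_ : nat -> H) (u : R -> U) (u_ : nat -> R -> U)
    (k : nat -> R) : 0 <= t <= T ->
  (forall n, 0 < k n <= n.+1%:R^-1) -> L2 T u -> (forall n, L2 T (u_ n)) ->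
  (forall n, hnorm (x0 - x_ n) <= k n) ->
  (forall n, (sq_norm T (fun s => u s - u_ n s)%R <= (k n ^+ 2)%:E)%E) ->
  mild_solution A B (x_ n) (u_ n) t @[n --> \oo] --> mild_solution A B x0 u t.
Proof.
move=> /andP[t0 tT] hk Lu Lu_ xk uk; apply/cvg_hnormP => e e0.
pose D := 1 + C * (t + 1).
have D0 : 0 < D by rewrite ltr_pwDl// mulr_ge0// addr_ge0.
have /cvgrPdist_lt/(_ _ (divr_gt0 e0 D0)) := @cvg_harmonic R.
apply: filterS => n; rewrite /= sub0r normrN ger0_norm// ltr_pdivlMr// => h.
have /andP[k0 k1] := hk n.
have Lut := L2_restrict tT Lu; have Lwt := L2_restrict tT (Lu_ n).
rewrite hnormBC; apply: le_lt_trans (mild_solution_diff _ _ t0 Lut Lwt) _.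
have i1 : \int[mu]_(s in `[0, t]) hnorm (u s - u_ n s) <= k n * (t + 1).
  apply: Rintegral_hnorm_le => //; first exact: L2B.
  apply: le_trans (uk n); apply: sq_norm_restrict => //.
  by case: (L2B Lu (Lu_ n)).
apply: le_lt_trans h; apply: (@le_trans _ _ (k n * D)); last by rewrite ler_pM2r.
by rewrite /D mulrDr mulr1 mulrCA lerD ?xk// ler_wpM2l.
Qed.

End mild_solutions.

(** * Almost everywhere arguments *)

Section almost_everywhere.
Context {R : realType}.
Local Notation mu := (@lebesgue_measure R).

Lemma aeS (P Q : R -> Prop) : (forall t, P t -> Q t) ->
  {ae mu, forall t, P t} -> {ae mu, forall t, Q t}.
Proof. by move=> PQ; apply: (@filterS _ _ (ae_filter_ringOfSetsType mu)). Qed.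

Lemma aeI (P Q : R -> Prop) : {ae mu, forall t, P t} -> {ae mu, forall t, Q t} ->
  {ae mu, forall t, P t /\ Q t}.
Proof. exact: (@filterI _ _ (ae_filter_ringOfSetsType mu)). Qed.

(** The sum of the [|f n|^2] is integrable, hence finite almost everywhere, and the terms of a
    convergent series tend to 0. *)
Lemma ae_cvg0_of_sq_norm {V : preHilbertType R} T (f : nat -> R -> V) :
  (forall n, strongly_measurable T (f n)) ->
  (forall n, (sq_norm T (f n) <= (1 / (2 ^ n.+1)%:R)%:E)%E) ->
  {ae mu, forall t, t \in `[0, T] -> hnorm (f n t) @[n --> \oo] --> (0 : R)}.
Proof.
move=> sf fn.
pose F t := (\big[+%E/0%R]_(0 <= n <oo) (hnorm (f n t) ^+ 2)%:E)%E.
have mf n := measurable_hnorm_sq (sf n).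
have pf n t : (0 <= (hnorm (f n t) ^+ 2)%:E)%E by rewrite lee_fin sqr_ge0.
have IF : mu.-integrable `[0, T] F.
  apply/integrableP; split.
    by apply: ge0_emeasurable_sum => // *; exact: mf.
  have -> : (\int[mu]_(t in `[0%R, T]) `|F t| = \int[mu]_(t in `[0%R, T]) F t)%E.
    by apply: eq_integral => t _; rewrite gee0_abs//; apply: nneseries_ge0.
  rewrite integral_nneseries//.
  apply: (@le_lt_trans _ _ (\big[+%E/0%R]_(0 <= i <oo) (0 + (1 / (2 ^ i.+1)%:R)%:E))%E).
    apply: lee_nneseries => n _; first by move=> _; exact: sq_norm_ge0.
    by rewrite add0e; exact: fn.
  apply: le_lt_trans (epsilon_trick xpredT _ _) _ => //.
  by rewrite eseries0// add0e ltry.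
have mT : mu.-integrable `[0, T] F -> {ae mu, forall t, `[0%R, T]%classic t -> F t \is a fin_num}.
  by apply: integrable_ae; exact: measurable_itv.
have := mT IF; apply: aeS => t ht tT.
have {ht} Ft := ht tT.
have bnd N : series (fun n => hnorm (f n t) ^+ 2) N <= fine (F t).
  rewrite -lee_fin fineK// /series/= -sumEFin.
  exact: nneseries_lim_ge.
have cs : cvgn (series (fun n => hnorm (f n t) ^+ 2)).
  apply: nondecreasing_is_cvgn.
    by apply: nondecreasing_series => n _ _; exact: sqr_ge0.
  by exists (fine (F t)) => _ [N _ <-].
have /cvgrPdist_lt c0 := cvg_series_cvg_0 cs.
apply/cvgrPdist_lt => e e0; have := c0 (e ^+ 2); rewrite exprn_gt0// => /(_ isT).
apply: filterS => n; rewrite !sub0r !normrN !ger0_norm ?sqr_ge0 ?hnorm_ge0//.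
by rewrite ltr_pXn2r ?nnegrE ?hnorm_ge0// ltW.
Qed.

(** Otherwise the interval []0, min(e, 1)[], of positive measure, would be negligible. *)
Lemma ae_exists_small (P : R -> Prop) (e : R) : 0 < e ->
  {ae mu, forall t, t \in `[0, 1] -> P t} -> exists t, [/\ 0 < t, t < e & P t].
Proof.
move=> e0 aeP; apply: contrapT => nP.
pose d := Num.min e 1; have d0 : 0 < d by rewrite lt_min e0 ltr01.
have : mu.-negligible `]0, d[%classic.
  apply: negligibleS aeP => t; rewrite /= in_itv/= => /andP[t0 td] h; apply: nP.
  move: td; rewrite lt_min => /andP[te t1].
  by exists t; split=> //; apply: h; rewrite in_itv/= !ltW.
move=> ng; have /eqP : mu `]0, d[%classic = 0%E.
  by apply: (negligibleP _ _).1 ng; exact: measurable_itv.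
have := lebesgue_measure_itv `]0, d[ => /= ->.
by rewrite lte_fin d0 oppr0 addr0 eqe gt_eqF.
Qed.

End almost_everywhere.

(** * The dissipation form *)

Lemma continuous_linear_bound {R : realType} {H U : preHilbertType R}
    (B : {linear U -> H}) : continuous B ->
  exists2 C : R, 0 <= C & forall w, hnorm (B w) <= C * hnorm w.
Proof.
move=> cB; have /cvg_hnormP/(_ 1 ltr01) := cB 0.
rewrite linear0 => /nbhs_ballP[[d d']] /=; rewrite ltcE/= => /andP[/eqP-> d0] hd.
have d2 : 0 < d / 2 by rewrite divr_gt0.
exists (d / 2)^-1; first by rewrite invr_ge0 ltW.
move=> w; have [w0|w0] := eqVneq (hnorm w) 0.
  by rewrite (hnorm0_eq0 w0) linear0 !hnorm0 mulr0.
have w1 : 0 < hnorm w by rewrite lt_neqAle eq_sym w0 hnorm_ge0.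
(* Rescales [w] to norm [d / 2], inside the ball on which [B] has norm below 1. *)
pose a := d / 2 / hnorm w; have a0 : 0 < a by rewrite divr_gt0.
have := hd (a%:C%C *: w); rewrite -ball_normE/= sub0r normrN normr_hnorm ltcR subr0.
rewrite linearZ !hnormZ gtr0_norm// => h; have {h}/ltW : a * hnorm (B w) < 1.
  by apply: h; rewrite /a divfK//; lra.
by rewrite /a mulrAC ler_pdivrMr// mul1r mulrC -ler_pdivlMr// mulrC.
Qed.

(** [hnorm_le_dual] with test vectors from a dense set only. It serves for weak limits of [Q x_n],
    which are accessible by pairing with [z] in [dom Q]. *)
Lemma hnorm_le_dense {R : realType} {H : preHilbertType R} (D : set H) (C : R) (x : H) :
  dense D -> 0 <= C -> (forall z, D z -> rdot x z <= C * hnorm z) -> hnorm x <= C.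
Proof.
move=> /dense_hnormP dD C0 h; apply: hnorm_le_dual => // z.
apply/ler_addgt0Pr => e e0.
have c0 : 0 < C + hnorm x + 1 by rewrite ltr_wpDl// addr_ge0// hnorm_ge0.
have [y Dy] := dD z _ (divr_gt0 e0 c0); rewrite ltr_pdivlMr// => zy.
have h1 := h y Dy; have h2 := rdot_le x (z - y).
have h3 : hnorm y <= hnorm z + hnorm (z - y).
  by have := hnorm_triangle z y 0; rewrite !subr0 hnormBC; lra.
rewrite rdotBr in h2; have := hnorm_ge0 (z - y); have := hnorm_ge0 x.
nra.
Qed.

Section operator_algebra.
Context {R : realType} {H : hilbertType R}.
Variable A : operator H.

Lemma dom_lin (a : R[i]) x y : dom A x -> dom A y -> dom A (a *: x + y).
Proof.
have [_ dl] := dom_submod A => /mem_set dx /mem_set dy.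
by apply: set_mem; exact: dl.
Qed.

Lemma domB x y : dom A x -> dom A y -> dom A (x - y).
Proof. by move=> dx dy; rewrite addrC -scaleN1r; exact: dom_lin. Qed.

Lemma appB x y : dom A x -> dom A y -> A (x - y) = A x - A y.
Proof.
by move=> dx dy; rewrite addrC -scaleN1r app_linear// scaleN1r addrC.
Qed.

Lemma rform_dissipation x y :
  rform (dissipation_form A) x y = - 2^-1 * (rdot (A x) y + rdot x (A y)).
Proof.
rewrite /rform/= (_ : (- 2^-1 : R[i]) = (- 2^-1)%:C%C).
  by rewrite /rdot; case: (hdot (A x) y) => ? ?; case: (hdot x (A y)) => ? ? /=; ring.
by rewrite rmorphN fmorphV rmorph_nat.
Qed.

Lemma rform_dissipation_diag x : rform (dissipation_form A) x x = - rdot (A x) x.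
Proof. by rewrite rform_dissipation (rdotC x); field. Qed.

Lemma dissipation_nonneg :
  (forall x, dom A x -> 0 <= rform (dissipation_form A) x x) ->
  nonneg_symmetric (dissipation_form A).
Proof.
move=> r0; split.
- exact: dom_submod.
- move=> c x y z dx dy dz /=; rewrite app_linear// !hdotDl !hdotZl; ring.
- move=> x y _ _ /=; rewrite rmorphM rmorphN fmorphV rmorph_nat rmorphD/=.
  by rewrite -!hdotC addrC.
- move=> x dx; have := r0 x dx; rewrite /rform/=.
  set z : R[i] := _ * _; have : z \is Num.real.
    rewrite CrealE /z rmorphM rmorphN fmorphV rmorph_nat rmorphD/= -!hdotC.
    by rewrite addrC.
  by move=> /complex_realP[r ->]; rewrite lecR.
Qed.

(** Polarisation yields the real parts, and the argument ['i *: y] the imaginary ones. *)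
Lemma nonneg_symmetric_eq (a b : sform H) : nonneg_symmetric a -> nonneg_symmetric b ->
  fdom a `<=` fdom b -> (forall x, fdom a x -> rform b x x = rform a x x) ->
  forall x y, fdom a x -> fdom a y -> b x y = a x y.
Proof.
move=> an bn ab ba x y ax ay.
have pol (f : sform H) u v : nonneg_symmetric f -> fdom f u -> fdom f v ->
    rform f u v = 2^-1 * (rform f (u + v) (u + v) - rform f u u - rform f v v).
  move=> fn fu fv; have fuv := fdomD fn fu fv.
  rewrite (rformDl fn)// !(rformC fn _ fuv)// !(rformDl fn)// (rformC fn fv fu); lra.
have eqr : forall u v, fdom a u -> fdom a v -> rform b u v = rform a u v.
  move=> u v au av; rewrite (pol a)// (pol b) ?ba//; try exact: ab.
  exact: fdomD.
have aiy := fdomZ an 'i%C ay.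
by rewrite (fval_rformi bn) ?(fval_rformi an) ?eqr//; exact: ab.
Qed.

End operator_algebra.

(** * From a square root to closability *)

Section dissipation.
Context {R : realType} {H U : hilbertType R}.
Variables (A : operator H) (B : {linear U -> H}) (Rop : H -> (R -> U) -> R -> graph_space A).
Hypotheses (Amax : maximal_dissipative A) (Bc : continuous B)
  (hR : is_dissipation_operator B Rop).
Local Notation mu := (@lebesgue_measure R).
Local Notation S := (semigroup_of A).
Local Notation HA := (graph_space A).

Lemma sqrtM_norm (M sqrtM : {linear HA -> HA}) :
  (forall x y : HA, dissipation_form A x y = hdot (M x) y) ->
  bounded_nonneg_self_adjoint sqrtM -> (forall x, sqrtM (sqrtM x) = M x) ->
  forall x : HA, hnorm (sqrtM x) ^+ 2 = rform (dissipation_form A) (gval x) (gval x).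
Proof.
move=> hM [_ sM _] sqM x; rewrite -rdotxx /rdot -sM sqM.
by rewrite /rform hM.
Qed.

(** [S t] commutes with the difference quotients of the orbit and, being contractive, preserves
    their limit. *)
Lemma semigroup_dom t x : 0 <= t -> dom A x -> dom A (S t x) /\ A (S t x) = S t (A x).
Proof.
have [Ssg gA] := semigroup_ofP Amax => t0 dx.
apply/gA; have /gA h := conj dx (erefl (A x)).
apply/cvg_hnormP => e e0; have /cvg_hnormP/(_ e e0) := h.
move=> he; near=> s.
have s0 : 0 <= s by apply: ltW; near: s; exact: nbhs_right_gt.
rewrite -(semigroup_add Ssg)// (addrC s t) (semigroup_add Ssg)// -(semigroupB Ssg)//.
rewrite -(semigroupZ Ssg)// -(semigroupB Ssg)//.
apply: le_lt_trans (hnorm_semigroup Ssg _ t0) _.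
by near: s.
Unshelve. all: by end_near. Qed.

Lemma closable_of_sqrt (Q : operator H) : self_adjoint Q -> dom A `<=` dom Q ->
  (forall (x0 : H) (u : R -> U), L2loc u ->
    {ae mu, forall t : R, 0 <= t ->
      dom Q (mild_solution A B x0 u t) /\
      hnorm (Rop x0 u t) = hnorm (Q (mild_solution A B x0 u t))}) ->
  closable_form (dissipation_form A).
Proof.
move=> Qsa AQ hQ.
have [C C0 BC] := continuous_linear_bound Bc.
have [Ssg gA] := semigroup_ofP Amax.
have [M [sqrtM [[_ hM bsM sqM _] hT]]] := hR.
have [RT [[_ _ _ RTC1] RTae]] := hT 1 ltr01.
pose r x := rform (dissipation_form A) x x.
have sqN := sqrtM_norm hM bsM sqM.
have L20 T : L2 T (fun _ : R => 0 : U).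
  split; first exact/simple_strongly_measurable/finitely_valued_cst.
  rewrite /sq_norm; under eq_integral do rewrite hnorm0 expr0n/=.
  by rewrite integral0.
have C10 : C1 1 (fun _ : R => 0 : U).
  exists (fun=> 0); split; first by apply: continuous_subspaceT => t; exact: cvg_cst.
  by move=> t _; under eq_fun do rewrite subrr scaler0; exact: cvg_cst.
have aeQ x : dom A x -> {ae mu, forall t, t \in `[0, 1] -> hnorm (Q (S t x)) ^+ 2 = r (S t x)}.
  move=> dx.
  have h1 := RTC1 x _ dx C10.
  have h2 := RTae x _ (fun T _ => L20 T).
  have h3 := hQ x _ (fun T _ => L20 T).
  apply: aeS (aeI h1 (aeI h2 h3)) => t [k1 [k2 k3]] tI.
  have t0 : 0 <= t by move: tI; rewrite in_itv/= => /andP[].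
  have [xi xiE RE] := k1 tI; have [_ k3'] := k3 t0.
  rewrite -(mild_solution0 Amax C0 BC x t0) -k3' k2// RE sqN xiE.
  by [].
have small x (n : nat) : dom A x -> exists t, [/\ 0 < t, t < n.+1%:R^-1 &
    hnorm (Q (S t x)) ^+ 2 = r (S t x)].
  by move=> dx; apply: ae_exists_small (aeQ x dx).
have seq x : dom A x -> exists t_ : nat -> R, [/\ forall n, 0 <= t_ n,
    t_ @ \oo --> (0 : R) & forall n, hnorm (Q (S (t_ n) x)) ^+ 2 = r (S (t_ n) x)].
  move=> dx; have /choice[t_ ht] n := small x n dx.
  exists t_; split=> [n||n]; [by have [/ltW] := ht n| |by have [] := ht n].
  apply/cvgrPdist_lt => e e0; have /cvgrPdist_lt/(_ e e0) := @cvg_harmonic R.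
  apply: filterS => n /=; have [p q _] := ht n.
  by rewrite !sub0r !normrN !gtr0_norm//; exact: lt_trans.
have S0 x : S 0 x = x by case: Ssg.
have Scvg (t_ : nat -> R) x : (forall n, 0 <= t_ n) -> t_ @ \oo --> (0 : R) ->
    S (t_ n) x @[n --> \oo] --> x.
  by move=> tp t0; rewrite -[X in _ --> X]S0; exact: (semigroup_cvg Ssg).
have rdot_cvg (x_ y_ : nat -> H) (x y : H) : x_ @ \oo --> x -> y_ @ \oo --> y ->
    rdot (x_ n) (y_ n) @[n --> \oo] --> rdot x y.
  move=> xx yy.
  have -> : (fun n => rdot (x_ n) (y_ n)) = fun n =>
      2^-1 * (hnorm (x_ n + y_ n) ^+ 2 - hnorm (x_ n) ^+ 2 - hnorm (y_ n) ^+ 2).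
    by apply/funext => n; rewrite hnormDsq; field.
  have -> : rdot x y = 2^-1 * (hnorm (x + y) ^+ 2 - hnorm x ^+ 2 - hnorm y ^+ 2).
    by rewrite hnormDsq; field.
  have sqc (z_ : nat -> H) z : z_ @ \oo --> z -> hnorm (z_ n) ^+ 2 @[n --> \oo] --> hnorm z ^+ 2.
    by move=> zz; rewrite expr2; under eq_fun do rewrite expr2; apply: cvgM; exact: cvg_hnorm.
  apply: cvgMr; apply: cvgB; last exact: sqc.
  by apply: cvgB; apply: sqc => //; exact: cvgD.
have rcvg (t_ : nat -> R) x : dom A x -> (forall n, 0 <= t_ n) -> t_ @ \oo --> (0 : R) ->
    r (S (t_ n) x) @[n --> \oo] --> r x.
  move=> dx tp t0; rewrite /r rform_dissipation_diag.
  under eq_fun do rewrite rform_dissipation_diag (semigroup_dom _ dx).2//.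
  by apply: cvgN; apply: rdot_cvg; exact: Scvg.
have Q_le x : dom A x -> 0 <= r x /\ hnorm (Q x) ^+ 2 <= r x.
  move=> dx; have [t_ [tp t0 tQ]] := seq x dx.
  have rx := rcvg t_ x dx tp t0.
  (* [r x] is a limit of squares, so non-negativity of the form results from the same sequence of
     times. *)
  have r0 : 0 <= r x.
    apply: (ler_cvg_to (cvg_cst (0 : R)) rx); apply: nearW => n.
    by rewrite -tQ sqr_ge0.
  split=> //.
  suff : hnorm (Q x) <= Num.sqrt (r x).
    by rewrite -(@ler_pXn2r _ 2)// ?nnegrE ?hnorm_ge0 ?sqrtr_ge0// sqr_sqrtr.
  apply: (hnorm_le_dense Qsa.1); first exact: sqrtr_ge0.
  move=> z dz.
  have Qsym u : dom Q u -> rdot (Q u) z = rdot u (Q z).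
    by move=> du; rewrite /rdot; congr complex.Re; exact: ((Qsa.2 z (Q z)).1 (conj dz erefl)).
  have lim1 : rdot (Q (S (t_ n) x)) z @[n --> \oo] --> rdot (Q x) z.
    rewrite (Qsym x (AQ x dx)) (_ : (fun n => _) = fun n => rdot (S (t_ n) x) (Q z)).
      by apply: (cvg_rdot (Q z)); exact: Scvg.
    apply/funext => n; apply: Qsym; apply: AQ.
    by have [] := semigroup_dom (tp n) dx.
  have lim2 : Num.sqrt (r (S (t_ n) x)) * hnorm z @[n --> \oo] --> Num.sqrt (r x) * hnorm z.
    apply: cvgMl; apply: continuous_cvg rx; exact: sqrt_continuous.
  apply: ler_cvg_to lim1 lim2 _; apply: nearW => n.
  by rewrite -tQ sqrtr_sqr ger0_norm ?hnorm_ge0// rdot_le.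
have Q_eq x : dom A x -> hnorm (Q x) ^+ 2 = r x.
  move=> dx; have [t_ [tp t0 tQ]] := seq x dx.
  have rx := rcvg t_ x dx tp t0.
  have dS n : dom A (S (t_ n) x) by have [] := semigroup_dom (tp n) dx.
  have QS : Q (S (t_ n) x) @[n --> \oo] --> Q x.
    have rd : r (x - S (t_ n) x) @[n --> \oo] --> (0 : R).
      rewrite /r; under eq_fun do rewrite rform_dissipation_diag appB// (semigroup_dom _ dx).2//.
      have z0 : - rdot (A x - A x) (x - x) = 0 by rewrite subrr /rdot hdot0l/= oppr0.
      rewrite -z0; apply: cvgN; apply: rdot_cvg; apply: cvgB; try exact: cvg_cst; exact: Scvg.
    apply/cvg_hnormP => e e0.
    have /cvgrPdist_lt/(_ (e ^+ 2)) := rd; rewrite exprn_gt0// => /(_ isT); apply: filterS => n.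
    rewrite sub0r normrN => /(le_lt_trans (ler_norm _)) rn.
    have [_ qn] := Q_le _ (domB dx (dS n)).
    rewrite hnormBC -appB; [|exact: AQ..].
    by rewrite -(@ltr_pXn2r _ 2)// ?nnegrE ?hnorm_ge0 ?ltW//; exact: le_lt_trans qn rn.
  have := rdot_cvg _ _ _ _ QS QS; rewrite rdotxx => h.
  apply: cvgR_unique h _.
  by under eq_fun do rewrite rdotxx tQ.
have dn := dissipation_nonneg (fun x dx => (Q_le x dx).1).
(* The closed extension of the dissipation form; its closedness is that of the operator [Q]. *)
pose b := SForm (dom Q) (fun x y => hdot (Q x) (Q y)).
have bn : nonneg_symmetric b.
  split=> /=.
  - exact: dom_submod.
  - by move=> c x y z dx dy dz; rewrite app_linear// hdotDl hdotZl.
  - by move=> x y _ _; rewrite -hdotC.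
  - by move=> x dx; rewrite hdot_hnorm lecR sqr_ge0.
have rb x : rform b x x = hnorm (Q x) ^+ 2 by rewrite -rdotxx.
exists b; split=> //; last first.
  apply: nonneg_symmetric_eq => // x dx; rewrite rb; exact: Q_eq.
move=> x_ x dx xx cau.
have [z Qz] : exists z : H, Q (x_ n) @[n --> \oo] --> z.
  apply: hnorm_cauchy_cvg => e e0.
  have /cvgrPdist_lt/(_ (e ^+ 2)%:C%C) := cau; rewrite ltcR exprn_gt0// => /(_ isT).
  move=> [[P1 P2] [[N1 _ h1] [N2 _ h2]] hP]; exists (maxn N1 N2) => n m.
  rewrite !geq_max => /andP[n1 _] /andP[_ m2].
  have := hP (n, m) (conj (h1 n n1) (h2 m m2)) => /=.
  rewrite sub0r normrN hdot_hnorm normc_def/= expr0n/= addr0 sqrtr_sqr ltcR.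
  rewrite ger0_norm ?sqr_ge0// (appB (dx n) (dx m)).
  by rewrite ltr_pXn2r ?nnegrE ?hnorm_ge0// ltW.
have [dQx QxE] := self_adjoint_closed Qsa dx xx Qz.
split=> //=; rewrite QxE; apply/cvgrPdist_lt => -[e e'].
rewrite ltcE/= => /andP[/eqP-> e0].
have := rdot_cvg _ _ _ _ Qz Qz => /cvgrPdist_lt/(_ e e0); apply: filterS => n.
rewrite !rdotxx !hdot_hnorm -rmorphB normc_def/= expr0n/= addr0 sqrtr_sqr ltcR.
by [].
Unshelve. all: by end_near. Qed.

End dissipation.

(** * From closability to a square root *)

Section closable_dissipation.
Context {R : realType} {H U : hilbertType R}.
Variables (A : operator H) (B : {linear U -> H}) (Rop : H -> (R -> U) -> R -> graph_space A).
Hypotheses (Amax : maximal_dissipative A) (Bc : continuous B)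
  (hR : is_dissipation_operator B Rop).
Local Notation mu := (@lebesgue_measure R).
Local Notation HA := (graph_space A).

Lemma mild_solution_closed_form (b : sform H) : nonneg_symmetric b -> closed_form b ->
  dom A `<=` fdom b ->
  (forall x y, dom A x -> dom A y -> b x y = dissipation_form A x y) ->
  forall (x0 : H) (u : R -> U) T, L2loc u -> 0 < T ->
    {ae mu, forall t, t \in `[0, T] -> fdom b (mild_solution A B x0 u t) /\
      rform b (mild_solution A B x0 u t) (mild_solution A B x0 u t) =
      hnorm (Rop x0 u t) ^+ 2}.
Proof.
move=> bn bc Ab bA x0 u T Lu T0.
have [C C0 BC] := continuous_linear_bound Bc.
have [Ssg gA] := semigroup_ofP Amax.
have [M [sqrtM [[_ hM bsM sqM _] hT]]] := hR.
have [RT [[RTL2 RTlin [c RTc] RTC1] RTae]] := hT T T0.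
have sqN := sqrtM_norm hM bsM sqM.
have LuT := Lu T T0.
(* The bound on [RT] turns errors [k n] in both data into [c (k^2 + k^2) <= 2 |c| k], using
   [k <= 1]; this choice keeps it below [2^-(n+1)], which is summable. The term 1 keeps the
   denominator positive when [c = 0]. *)
pose k (n : nat) : R := (2 ^ n.+1)%:R^-1 / (2 * (`|c| + 1)).
have pow_gt0 n : 0 < (2 ^ n.+1)%:R :> R by rewrite ltr0n expn_gt0.
have c1 : 1 <= 2 * (`|c| + 1) by have := normr_ge0 c; lra.
have c0 : 0 < 2 * (`|c| + 1) by exact: lt_le_trans ltr01 c1.
have k0 n : 0 < k n by rewrite divr_gt0 ?invr_gt0.
have kp n : k n <= (2 ^ n.+1)%:R^-1.
  by rewrite /k ler_pdivrMr// ler_peMr// invr_ge0 ltW.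
have kn n : 0 < k n <= n.+1%:R^-1.
  rewrite k0; apply: le_trans (kp n) _.
  by rewrite lef_pV2 ?posrE// ler_nat ltnW// ltn_expl.
have k1 n : k n <= 1.
  by have /andP[_ h] := kn n; apply: le_trans h _; rewrite invf_le1// ler1n.
have /choice[x_ hx] n : exists x, dom A x /\ hnorm (x0 - x) <= k n.
  have /dense_hnormP/(_ x0 _ (k0 n))[x dx xk] := generator_dense Ssg gA.
  by exists x; split=> //; exact: ltW.
have /choice[u_ hu] n : exists w, [/\ C1 T w, L2 T w &
    (sq_norm T (fun s => u s - w s)%R <= (k n ^+ 2)%:E)%E].
  have [_ h] := C1_approximable_L2 LuT.
  have [w [cw sw uw]] := h _ (exprn_gt0 2 (k0 n)); exists w; split=> //.
  (* Square integrability of [w] follows from that of [u] and of the approximation error. *)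
  rewrite (_ : w = fun s => u s - (u s - w s)); last first.
    by apply/funext => s; rewrite opprB addrC subrK.
  apply: L2B => //; split; first by apply: strongly_measurableB; case: LuT.
  by apply: le_lt_trans uw _; rewrite ltry.
have dx n : dom A (x_ n) by case: (hx n).
have xk n : hnorm (x0 - x_ n) <= k n by case: (hx n).
have cu n : C1 T (u_ n) by case: (hu n).
have L2u n : L2 T (u_ n) by case: (hu n).
have uk n : (sq_norm T (fun s => u s - u_ n s)%R <= (k n ^+ 2)%:E)%E by case: (hu n).
(* The data are written in the shape of the linearity clause for [RT], so that [D n] is almost
   everywhere the difference of the two images. *)
pose D n := RT (-1 *: x_ n + x0) (fun s => -1 *: u_ n s + u s).
have L2d n : L2 T (fun s => -1 *: u_ n s + u s).
  rewrite (_ : (fun s => _) = fun s => u s - u_ n s); first exact: L2B.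
  by apply/funext => s; rewrite scaleN1r addrC.
have Dn n : (sq_norm T (D n) <= (1 / (2 ^ n.+1)%:R)%:E)%E.
  apply: le_trans (RTc _ _ (L2d n)) _.
  rewrite scaleN1r [- x_ n + x0]addrC.
  rewrite (_ : (fun s => _) = fun s => u s - u_ n s); last first.
    by apply/funext => s; rewrite scaleN1r addrC.
  have sum_le : ((hnorm (x0 - x_ n) ^+ 2)%:E + sq_norm T (fun s => u s - u_ n s)%R
      <= (2 * k n)%:E)%E.
    apply: (@le_trans _ _ ((k n ^+ 2)%:E + (k n ^+ 2)%:E)%E).
      apply: leeD; last exact: uk.
      by rewrite lee_fin ler_pXn2r ?nnegrE ?hnorm_ge0// ltW.
    by rewrite -EFinD lee_fin; have := k0 n; have := k1 n; nra.
  apply: (@le_trans _ _ (`|c|%:E * (2 * k n)%:E)%E).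
    apply: (@le_trans _ _ (`|c|%:E *
      ((hnorm (x0 - x_ n) ^+ 2)%:E + sq_norm T (fun s => u s - u_ n s)%R))%E).
      apply: lee_wpmul2r; last by rewrite lee_fin ler_norm.
      by apply: adde_ge0; [rewrite lee_fin sqr_ge0|exact: sq_norm_ge0].
    by apply: lee_wpmul2l => //; rewrite lee_fin.
  rewrite -EFinM lee_fin mul1r.
  have -> : `|c| * (2 * k n) = (2 ^ n.+1)%:R^-1 * (2 * `|c| / (2 * (`|c| + 1))).
    by rewrite /k; move: (_^-1) (_^-1) => p q; ring.
  rewrite ler_piMr ?invr_ge0 ?(ltW (pow_gt0 n))// ler_pdivrMr// mul1r.
  by rewrite ler_pM2l// lerDl.
have sD n : strongly_measurable T (D n) by case: (RTL2 (-1 *: x_ n + x0) _ (L2d n)).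
have ae1 := ae_cvg0_of_sq_norm sD Dn.
(* The exceptional set depends on [n]; countably many are merged into one. *)
have ae2 := ae_foralln (fun n => RTlin (-1) (x_ n) x0 (u_ n) u (L2u n) LuT).
have ae3 := ae_foralln (fun n => RTC1 (x_ n) (u_ n) (dx n) (cu n)).
have ae4 := RTae x0 u Lu.
apply: aeS (aeI ae1 (aeI ae2 (aeI ae3 ae4))) => t [h1 [h2 [h3 h4]]] tI.
have tT : 0 <= t <= T by move: tI; rewrite in_itv/=.
have {}h1 := h1 tI; have {}h2 n := h2 n tI; have {}h4 := h4 tI.
have /choice[xi hxi] n : exists x : HA, gval x = mild_solution A B (x_ n) (u_ n) t /\
    RT (x_ n) (u_ n) t = sqrtM x by have [x ? ?] := h3 n tI; exists x.
pose rho := RT x0 u t.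
have Rcvg : sqrtM (xi n) @[n --> \oo] --> rho.
  apply/cvg_hnorm0P; move: h1; apply: cvg_trans; apply: near_eq_cvg; near=> n.
  by rewrite /D h2 (hxi n).2 scaleN1r addrC hnormBC.
have ycvg : gval (xi n) @[n --> \oo] --> mild_solution A B x0 u t.
  under eq_fun do rewrite (hxi _).1.
  exact: (mild_solution_cvg Amax C0 BC tT kn LuT L2u xk uk).
have dxi n : dom A (gval (xi n)) by exact: set_mem (gvalP (xi n)).
have rb x : dom A x -> rform b x x = rform (dissipation_form A) x x.
  by move=> dAx; rewrite /rform bA.
have rdiff n m : rform b (gval (xi n) - gval (xi m)) (gval (xi n) - gval (xi m)) =
    hnorm (sqrtM (xi n) - sqrtM (xi m)) ^+ 2.
  by rewrite rb; [rewrite -linearB sqN|exact: domB].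
have [|bY rby _] := closed_form_cvg bn bc (fun n => Ab _ (dxi n)) ycvg.
  move=> e e0; have e2 : 0 < Num.sqrt e / 2 by rewrite divr_gt0// sqrtr_gt0.
  have /cvg_hnormP/(_ _ e2)[N _ hN] := Rcvg; exists N => n m Nn Nm.
  rewrite rdiff -[ltRHS]sqr_sqrtr ?ltW//.
  rewrite ltr_pXn2r ?nnegrE ?hnorm_ge0 ?sqrtr_ge0//.
  have := hnorm_triangle rho (sqrtM (xi n)) (sqrtM (xi m)).
  have := hN n Nn; have := hN m Nm => /=; rewrite (hnormBC (sqrtM (xi m))).
  by move: (Num.sqrt e) => q *; lra.
split=> //; rewrite h4; apply: cvgR_unique rby _.
under eq_fun do rewrite rb// -sqN.
by rewrite expr2; under eq_fun do rewrite expr2; apply: cvgM; exact: cvg_hnorm.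
Unshelve. all: by end_near. Qed.

Lemma sqrt_of_closable : closable_form (dissipation_form A) ->
  exists Rad Q : operator H,
    [/\ self_adjoint Rad, nonneg_operator Rad, is_sqrt Rad Q, dom A `<=` dom Q &
      forall (x0 : H) (u : R -> U), L2loc u ->
        {ae mu, forall t : R, 0 <= t ->
          dom Q (mild_solution A B x0 u t) /\
          hnorm (Rop x0 u t) = hnorm (Q (mild_solution A B x0 u t))}].
Proof.
move=> [b [bn bc Ab bA]]; have [Ssg gA] := semigroup_ofP Amax.
have bd : dense (fdom b).
  apply/dense_hnormP => x e e0.
  have /dense_hnormP/(_ x e e0)[y dy xy] := generator_dense Ssg gA.
  by exists y => //; exact: Ab.
have [Rad [Q [Rsa R0 RQ hQ]]] := closed_form_sqrt bn bc bd.
exists Rad, Q; split=> // [x /Ab/hQ[]//|x0 u Lu].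
(* The intervals [[0, n + 1]] exhaust the half-line, again with countably many exceptional sets. *)
have h := ae_foralln (fun n : nat => mild_solution_closed_form bn bc Ab bA x0 Lu (ltr0Sn R n)).
apply: aeS h => t ht t0.
have tI : t \in `[0, (Num.truncn t).+1%:R].
  by rewrite in_itv/= t0 ltW// truncnS_gt.
have [bY rbY] := ht _ tI; have [dQ QE] := hQ _ bY; split=> //.
apply/eqP; rewrite -(@eqrXn2 _ 2)// ?hnorm_ge0//.
by rewrite QE rbY.
Qed.

End closable_dissipation.

Theorem theorem3 (R : realType) (H U : hilbertType R)
    (A : operator H) (A_maxdiss : maximal_dissipative A)
    (B : {linear U -> H}) (B_bounded : continuous B)
    (Rop : H -> (R -> U) -> R -> graph_space A)
    (Rop_dissipation : is_dissipation_operator B Rop) :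
  (exists Rad sqrtRad : operator H,
    [/\ self_adjoint Rad, nonneg_operator Rad, is_sqrt Rad sqrtRad,
      dom A `<=` dom sqrtRad &
      forall (x0 : H) (u : R -> U), L2loc u ->
        {ae @lebesgue_measure R, forall t : R, 0 <= t ->
          dom sqrtRad (mild_solution A B x0 u t) /\
          hnorm (Rop x0 u t) = hnorm (sqrtRad (mild_solution A B x0 u t))}])
  <-> closable_form (dissipation_form A).
Proof.
split=> [[Rad [Q [_ _ [Qsa _ _ _] AQ hQ]]]|]; last exact: sqrt_of_closable.
exact: closable_of_sqrt hQ.
Qed.
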